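(* Let $\mathfrak{g}$ be a simple Lie algebra over $\Bbbk$ of type $D_{4}$, let $\mathfrak{h}$ be a Cartan subalgebra of $\mathfrak{g}$, $R$ the root system of $(\mathfrak{g},\mathfrak{h})$, and $\Pi=\{\alpha_{1},\alpha_{2},\alpha_{3},\alpha_{4}\}$ a base of $R$, numbered so that $\alpha_{2}$ is the simple root linked to each of $\alpha_{1},\alpha_{3},\alpha_{4}$ in the Dynkin diagram. Let $\mathfrak{b}=\mathfrak{h}\oplus\bigoplus_{\alpha\in R_{+}}\mathfrak{g}^{\alpha}$ be the corresponding Borel subalgebra, where $R_{+}$ is the set of positive roots with respect to $\Pi$ and $\mathfrak{g}^{\alpha}$ is the root space of $\alpha$, and let $\mathfrak{p}=\mathfrak{g}^{-\alpha_{2}}\oplus\mathfrak{b}$, a minimal parabolic subalgebra of $\mathfrak{g}$. Then $\mathfrak{p}^{*}$ contains no stable element.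
   Context: $\Bbbk$ is an algebraically closed field of characteristic zero; finite-dimensional vector spaces carry the Zariski topology. For a finite-dimensional Lie algebra $\mathfrak{a}$ and $f\in\mathfrak{a}^{*}$, $\mathfrak{a}^{f}=\{x\in\mathfrak{a}: f([x,y])=0\ \text{for all } y\in\mathfrak{a}\}$. The algebraic adjoint group of $\mathfrak{a}$ is the smallest algebraic subgroup of $\operatorname{Aut}\mathfrak{a}$ whose Lie algebra contains $\operatorname{ad}_{\mathfrak{a}}\mathfrak{a}$. A linear form $f\in\mathfrak{a}^{*}$ is stable if there is a neighbourhood $V$ of $f$ in $\mathfrak{a}^{*}$ such that for every $g\in V$ there is $\alpha$ in the algebraic adjoint group of $\mathfrak{a}$ with $\mathfrak{a}^{g}=\alpha(\mathfrak{a}^{f})$. *)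

(* Defs.v *)
From HB Require Import structures.
From mathcomp Require Import all_boot all_algebra.
From mathcomp Require Import mpoly.

Set Implicit Arguments.
Unset Strict Implicit.
Unset Printing Implicit Defensive.

Import GRing.Theory.
Local Open Scope ring_scope.

HB.mixin Record Vector_isLie (K : fieldType) (L : Type) of Vector K L := {
  lie : L -> L -> L;
  lie_is_linearl : forall y : L, linear (lie^~ y);
  lie_is_linearr : forall x : L, linear (lie x);
  liexx : forall x : L, lie x x = 0;
  lie_jacobi : forall x y z : L,
    lie x (lie y z) + lie y (lie z x) + lie z (lie x y) = 0
}.

#[short(type="lieAlgType")]
HB.structure Definition LieAlgebra (K : fieldType) :=
  {L of Vector K L & Vector_isLie K L}.

Notation "''Dual' ( V )" := 'Hom(V, _^o)
  (at level 8, format "''Dual' ( V )") : type_scope.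

Section LieAlgebraTheory.

Variables (K : fieldType) (L : lieAlgType K).
Implicit Types (x y z : L) (U W : {vspace L}).

HB.instance Definition _ x :=
  GRing.isLinear.Build K L L _ (lie x) (lie_is_linearr x).

Definition ad x : 'End(L) := linfun (lie x).

Lemma adE x y : ad x y = lie x y.
Proof. exact: lfunE. Qed.

Lemma ad_is_linear : linear ad.
Proof.
move=> c x y; apply/lfunP => z.
by rewrite add_lfunE scale_lfunE !adE lie_is_linearl.
Qed.

HB.instance Definition _ := GRing.isLinear.Build K L 'End(L) _ ad ad_is_linear.

Definition lie_space U W : {vspace L} :=
  <<[seq lie x y | x <- vbasis U, y <- vbasis W]>>%VS.

Lemma memv_lie U W x y : x \in U -> y \in W -> lie x y \in lie_space U W.
Proof.
move=> Ux Wy; rewrite -adE (coord_vbasis Ux) linear_sum sum_lfunE.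
apply: memv_suml => i _; rewrite linearZ scale_lfunE memvZ //.
rewrite (coord_vbasis Wy) linear_sum; apply: memv_suml => j _.
rewrite linearZ memvZ //= lfunE /= memv_span //.
by rewrite allpairs_f ?mem_nth ?size_tuple.
Qed.

Lemma lie_spaceP U W (S : {vspace L}) :
  reflect {in U & W, forall x y, lie x y \in S} (lie_space U W <= S)%VS.
Proof.
apply: (iffP idP) => [sUWS x y Ux Wy | sUWS].
  by rewrite (subvP sUWS) ?memv_lie.
by apply/span_subvP => _ /allpairsP[[x y] [/= /vbasis_mem Ux /vbasis_mem Wy ->]]; apply: sUWS.
Qed.

Definition lie_closed U : bool := (lie_space U U <= U)%VS.

Definition lie_ideal U : bool := (lie_space fullv U <= U)%VS.

Definition simple_lie : Prop :=
  (exists x y, lie x y != 0) /\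
  (forall I : {vspace L}, lie_ideal I -> I = 0%VS \/ I = fullv).

Definition nilpotent_lie U : Prop :=
  exists n : nat, iter n (lie_space U) U = 0%VS.

Definition self_normalizing U : Prop :=
  forall x, (forall y, y \in U -> lie x y \in U) -> x \in U.

Definition cartan_subalgebra U : Prop :=
  [/\ lie_closed U, nilpotent_lie U & self_normalizing U].

Definition lie_aut (phi : 'End(L)) : Prop :=
  lker phi == 0%VS /\ (forall x y, phi (lie x y) = lie (phi x) (phi y)).

(* The alternating bilinear form x, y |-> f [x, y], as a map to the dual. *)
Definition kirillov (f : 'Dual(L)) x : 'Dual(L) := (f \o ad x)%VF.

Lemma kirillov_is_linear f : linear (kirillov f).
Proof.
move=> c x y; apply/lfunP => z.
by rewrite add_lfunE scale_lfunE !comp_lfunE linearP add_lfunE scale_lfunE linearP.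
Qed.

HB.instance Definition _ f :=
  GRing.isLinear.Build K L _ _ (kirillov f) (kirillov_is_linear f).

Definition form_stab (f : 'Dual(L)) : {vspace L} := lker (linfun (kirillov f)).

Lemma form_stabP (f : 'Dual(L)) x :
  reflect (forall y, f (lie x y) = 0) (x \in form_stab f).
Proof.
rewrite memv_ker lfunE /=; apply: (iffP eqP) => [fx0 y | fx0].
  by have := congr1 (fun u : 'Dual(L) => u y) fx0; rewrite !lfunE /= lfunE.
by apply/lfunP => y; rewrite !lfunE /= lfunE /= fx0.
Qed.

End LieAlgebraTheory.

(* A subalgebra as a Lie algebra in its own right.  The projection vsproj is
   the identity on the brackets, since U is closed. *)

Definition sub_lie (K : fieldType) (L : lieAlgType K) (U : {vspace L})
  (clU : lie_closed U) : Type := subvs_of U.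

Section SubLie.

Variables (K : fieldType) (L : lieAlgType K) (U : {vspace L}).
Variable clU : lie_closed U.

HB.instance Definition _ := Vector.on (sub_lie clU).

Definition sub_bracket (x y : sub_lie clU) : sub_lie clU :=
  vsproj U (lie (vsval x) (vsval y)).

Lemma sub_bracketE x y : vsval (sub_bracket x y) = lie (vsval x) (vsval y).
Proof.
by rewrite /sub_bracket vsprojK //; have /lie_spaceP := clU; apply; apply: subvsP.
Qed.

Lemma sub_bracket_is_linearl (y : sub_lie clU) : linear (sub_bracket^~ y).
Proof.
move=> c x z; rewrite /sub_bracket.
have -> : vsval (c *: x + z) = c *: vsval x + vsval z by exact: linearP.
by rewrite lie_is_linearl linearP.
Qed.

Lemma sub_bracket_is_linearr (x : sub_lie clU) : linear (sub_bracket x).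
Proof.
move=> c y z; rewrite /sub_bracket.
have -> : vsval (c *: y + z) = c *: vsval y + vsval z by exact: linearP.
by rewrite lie_is_linearr linearP.
Qed.

Lemma sub_bracketxx (x : sub_lie clU) : sub_bracket x x = 0.
Proof. by rewrite /sub_bracket liexx linear0. Qed.

Lemma sub_bracket_jacobi (x y z : sub_lie clU) :
  sub_bracket x (sub_bracket y z) + sub_bracket y (sub_bracket z x)
    + sub_bracket z (sub_bracket x y) = 0.
Proof.
by apply: subvs_inj; rewrite !linearD /= !sub_bracketE lie_jacobi.
Qed.

HB.instance Definition _ := Vector_isLie.Build K (sub_lie clU)
  sub_bracket_is_linearl sub_bracket_is_linearr
  sub_bracketxx sub_bracket_jacobi.

End SubLie.

(* Polynomial functions on V are written in the coordinates
   of vbasis {:V}; the closed sets do not depend on that basis. *)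

Section Zariski.

Variables (K : fieldType) (V : vectType K).

Definition coords (v : V) : 'I_(\dim {:V}) -> K :=
  fun i => coord (vbasis {:V}) i v.

Definition zariski_closed (Z : V -> Prop) : Prop :=
  exists S : {mpoly K[\dim {:V}]} -> Prop,
    forall v, Z v <-> (forall P, S P -> P.@[coords v] = 0).

Definition zariski_open (U : V -> Prop) : Prop :=
  exists2 Z, zariski_closed Z & forall v, U v <-> ~ Z v.

Definition zariski_nbhs (v : V) (N : V -> Prop) : Prop :=
  exists U, [/\ zariski_open U, U v & forall w, U w -> N w].

(* The value at w of the differential of P at the point v. *)
Definition mdiff (P : {mpoly K[\dim {:V}]}) (v w : V) : K :=
  \sum_i (P^`M(i)).@[coords v] * coords w i.

End Zariski.

Section Stable.

Variables (K : fieldType) (L : lieAlgType K).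

(* Subgroups of Aut L that are Zariski closed in GL(L), the latter being an
   open subset of End L. *)
Definition algebraic_subgroup (G : 'End(L) -> Prop) : Prop :=
  [/\ forall phi, G phi -> lie_aut phi,
      G \1%VF,
      forall phi psi, G phi -> G psi -> G (phi \o psi)%VF,
      forall phi, G phi -> G (phi^-1)%VF
    & exists2 Z, zariski_closed Z &
        forall phi, G phi <-> lker phi == 0%VS /\ Z phi].

(* The Lie algebra of G as the tangent space at the identity: the zero set of
   the differentials of all the polynomials vanishing on G. *)
Definition lie_of_group (G : 'End(L) -> Prop) (X : 'End(L)) : Prop :=
  forall P : {mpoly K[\dim {:'End(L)}]},
    (forall phi, G phi -> P.@[coords phi] = 0) -> mdiff P \1%VF X = 0.

(* The smallest algebraic subgroup of Aut L whose Lie algebra contains ad L is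
   taken to be the intersection of all such subgroups; in characteristic zero
   Lie (G1 :&: G2) = Lie G1 :&: Lie G2, so this intersection is one of them. *)
Definition alg_adjoint_group (phi : 'End(L)) : Prop :=
  forall G : 'End(L) -> Prop, algebraic_subgroup G ->
    (forall x : L, lie_of_group G (ad x)) -> G phi.

Definition stable (f : 'Dual(L)) : Prop :=
  exists2 N : 'Dual(L) -> Prop, zariski_nbhs f N &
    forall g, N g -> exists2 phi, alg_adjoint_group phi &
      form_stab g = (phi @: form_stab f)%VS.

End Stable.

Section Roots.

Variables (K : fieldType) (L : lieAlgType K) (h : {vspace L}).
Local Notation dualh := ('Dual(subvs_of h)).
Implicit Types (a b : dualh) (R Pi : seq dualh).

(* The a-eigenspace of h, cut out by the conditions at a basis of h. *)
Definition root_space a : {vspace L} :=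
  (\bigcap_(i < \dim h)
     lker (ad (vbasis h)`_i
       - (a (vsproj h (vbasis h)`_i) : K) *: (\1%VF : 'End(L)))%R)%VS.

Lemma root_spaceP a x :
  reflect (forall t : subvs_of h, lie (vsval t) x = (a t : K) *: x)
          (x \in root_space a).
Proof.
have vsK i : vsval (vsproj h (vbasis h)`_i) = (vbasis h)`_i :> L.
  case: (ltnP i (\dim h)) => [lti | lei]; last first.
    by rewrite nth_default ?size_tuple // linear0.
  by rewrite vsprojK // vbasis_mem // mem_nth // size_tuple.
apply: (iffP idP) => [xa t | xa].
  have -> : t = \sum_i coord (vbasis h) i (vsval t) *: vsproj h (vbasis h)`_i.
    apply: subvs_inj; rewrite {1}(coord_vbasis (subvsP t)) linear_sum.
    by apply: eq_bigr => i _; rewrite linearZ /= vsK.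
  rewrite !linear_sum scaler_suml -adE linear_sum sum_lfunE.
  apply: eq_bigr => i _; rewrite !linearZ scale_lfunE /= vsK -scalerA.
  congr (_ *: _); have: x \in root_space a by [].
  rewrite /root_space => /(subvP (bigcapv_inf i isT (subvv _))).
  by rewrite memv_ker add_lfunE opp_lfunE scale_lfunE id_lfunE subr_eq0 => /eqP.
rewrite memvE; apply/subv_bigcapP => i _; rewrite -memvE memv_ker.
rewrite add_lfunE opp_lfunE scale_lfunE id_lfunE subr_eq0 adE.
by rewrite -{1}vsK xa.
Qed.

Definition root_system R : Prop :=
  uniq R /\
  (forall a, (a \in R) = (a != 0) && (root_space a != 0%VS)).

Definition nat_comb Pi b : Prop :=
  exists n : nat -> nat, b = \sum_(i < size Pi) Pi`_i *+ n i.

(* Linear independence is over K: the Q-span of the roots is a Q-form of their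
   K-span, so this agrees with independence over Q. *)
Definition root_base R Pi : Prop :=
  [/\ {subset Pi <= R}, basis_of <<R>>%VS Pi
    & forall b, b \in R -> nat_comb Pi b \/ nat_comb Pi (- b)].

Definition positive_roots R Pi Rp : Prop :=
  uniq Rp /\ (forall b, b \in Rp <-> b \in R /\ nat_comb Pi b).

(* t, as an element of the bidual of h, is the coroot of a: the only linear
   form with value 2 at a such that b |-> b - b(t) a preserves R. *)
Definition is_coroot R a (t : subvs_of h) : Prop :=
  a t = 2%:R /\ {in R, forall b, b - (b t : K) *: a \in R}.

(* A i j is the Cartan integer <Pi_j, Pi_i^vee>. *)
Definition has_cartan_matrix R Pi (A : nat -> nat -> int) : Prop :=
  exists t : nat -> subvs_of h, forall i, (i < size Pi)%N ->
    is_coroot R Pi`_i (t i) /\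
    forall j, (j < size Pi)%N -> (Pi`_j) (t i) = (A i j)%:~R.

End Roots.

(* Type D4, with the node linked to the three others at index 1 (counting
   from 0). *)
Definition cartan_D4 (i j : nat) : int :=
  if i == j then 2 else if (i == 1)%N || (j == 1)%N then -1 else 0.

(* Main.v *)
(* Index the weight vectors of p by f, e0 (for -alpha2, alpha2), e_i, v_i = [e0, e_i] for the
   three outer simple roots, s_i for the root alpha2 + (the outer simple roots other than i),
   b and t = [e0, b] for the two highest roots, and put h0 = [e0, f].  In S(p) the elements
     H_i = b v_i - t e_i - s_j s_k,
     T = b^2 e0 + b t h0 - t^2 f + sum_i (b v_i - t e_i) s_i - 2 s_1 s_2 s_3
   are semi-invariant, and T^2 and B = H_1 H_2 H_3 have the same weight and the same degree.
   The automorphisms of p scaling T^2 and B by a common factor form an algebraic group whose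
   Lie algebra contains ad p, so T^2/B is invariant under the algebraic adjoint group.  The
   differential 2 B dT - T dB of T^2/B (up to a factor), taken at a form f, is an element of p
   that lies in the stabilizer of f, by invariance, and is killed by f, by Euler's identity.
   Generically the stabilizer is a line, hence spanned by this differential: along the line
   through two forms with the same stabilizer the derivative of T^2/B vanishes.  Around a
   stable form T^2/B would therefore be constant, which it is not.

   The bracket table of p is obtained from the semisimple theory: a coroot z has integral
   eigenvalues, so tr (ad z)^2 <> 0, the Killing form is nondegenerate, and comparing traces
   of commutators yields sl2-triples and one-dimensional root spaces. *)

From HB Require Import structures.
Require Import Defs.
From mathcomp Require Import all_boot all_algebra.
From mathcomp Require Import mpoly ring zify.

Set Implicit Arguments.
Unset Strict Implicit.
Unset Printing Implicit Defensive.

Import GRing.Theory VectorInternalTheory.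
Local Open Scope ring_scope.

(** * Eigenspaces and traces *)

(** The algebraic adjoint group is never determined: it lies in every algebraic group whose Lie
    algebra contains ad p, so one such group is enough. Membership in that Lie algebra is tested by
    polynomial curves through the identity: exponentials for ad-nilpotent elements, and [1 + s D]
    for an outer coweight, whose adjoint action D on p is a projection. Stability yields stabilizers
    that are conjugate rather than equal. Of two generic forms f1, f2 near a stable form, f1 is
    therefore moved by the group to a form f3 with the stabilizer of f2; the ratio T^2/B does not
    change. The form f3 need not lie near f2, but the vanishing of the derivative along their line
    is a polynomial identity in the parameter, so finitely many bad parameters do no harm. On the
    semisimple side a Cartan subalgebra is only nilpotent and self-normalizing; nothing says at
    first that it acts diagonalizably. Generalized eigenspaces of single elements of h replace the
    root decomposition in the construction of sl2-triples. *)

Section LinearAlgebra.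

Variables (K : fieldType) (V : vectType K).
Implicit Types (f g : 'End(V)) (U W : {vspace V}).

Definition lfun_tr f : K := \tr (f2mx f).

Lemma lfun_f2mx (W' : vectType K) (f : 'Hom(V, W')) v : v2r (f v) = v2r v *m f2mx f.
Proof. by rewrite unlock /= r2vK. Qed.

Lemma f2mx_comp f g : f2mx (f \o g)%VF = f2mx g *m f2mx f.
Proof.
apply/row_matrixP => i; rewrite !rowE mulmxA.
have -> (h : 'End(V)) : delta_mx 0 i *m f2mx h = v2r (h (r2v (delta_mx 0 i))).
  by rewrite lfun_f2mx r2vK.
by rewrite comp_lfunE !lfun_f2mx r2vK.
Qed.

Lemma lfun_trM f g : lfun_tr (f \o g)%VF = lfun_tr (g \o f)%VF.
Proof. by rewrite /lfun_tr !f2mx_comp mxtrace_mulC. Qed.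

Lemma f2mxD f g : f2mx (f + g) = f2mx f + f2mx g.
Proof.
apply/row_matrixP => i; rewrite !rowE mulmxDr.
have E (h : 'End(V)) : delta_mx 0 i *m f2mx h = v2r (h (r2v (delta_mx 0 i))).
  by rewrite lfun_f2mx r2vK.
by rewrite !E add_lfunE linearD.
Qed.

Lemma f2mxZ c f : f2mx (c *: f) = c *: f2mx f.
Proof.
apply/row_matrixP => i; rewrite !rowE -scalemxAr.
have E (h : 'End(V)) : delta_mx 0 i *m f2mx h = v2r (h (r2v (delta_mx 0 i))).
  by rewrite lfun_f2mx r2vK.
by rewrite !E scale_lfunE linearZ.
Qed.

Lemma lfun_trB f g : lfun_tr (f - g) = lfun_tr f - lfun_tr g.
Proof.
by rewrite /lfun_tr f2mxD -scaleN1r f2mxZ scaleN1r mxtraceD linearN.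
Qed.

Lemma lfun_trD f g : lfun_tr (f + g) = lfun_tr f + lfun_tr g.
Proof. by rewrite /lfun_tr f2mxD mxtraceD. Qed.

Lemma lfun_trZ c f : lfun_tr (c *: f) = c * lfun_tr f.
Proof. by rewrite /lfun_tr f2mxZ mxtraceZ. Qed.

Lemma eigenvalue_f2mx f c :
  reflect (exists2 v, v != 0 & f v = c *: v) (eigenvalue (f2mx f) c).
Proof.
apply: (iffP eigenvalueP) => [[u Eu nzu] | [v nzv fv]].
  exists (r2v u); first by apply: contra nzu => /eqP u0; rewrite -[u]r2vK u0 linear0.
  by apply: v2r_inj; rewrite lfun_f2mx linearZ /= !r2vK.
exists (v2r v); first by rewrite -lfun_f2mx fv linearZ.
by apply: contra nzv => /eqP v0; rewrite -[v]v2rK v0 linear0.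
Qed.

Fixpoint lpow f n : 'End(V) := if n is m.+1 then (f \o lpow f m)%VF else \1%VF.

Lemma lpowS f n v : lpow f n.+1 v = f (lpow f n v).
Proof. by rewrite comp_lfunE. Qed.

Lemma lpow0 f v : lpow f 0 v = v.
Proof. by rewrite id_lfunE. Qed.

Lemma lpowSr f n v : lpow f n.+1 v = lpow f n (f v).
Proof.
by elim: n => [|n IHn]; rewrite lpowS ?lpow0 // IHn lpowS.
Qed.

Lemma lpowD f m n v : lpow f (m + n) v = lpow f m (lpow f n v).
Proof. by elim: m => [|m IHm]; rewrite ?lpow0 // addSn !lpowS IHm. Qed.

Lemma lpow_img f n U : {in U, forall v, f v \in U} -> {in U, forall v, lpow f n v \in U}.
Proof.
by move=> fU v Uv; elim: n => [|n IHn]; rewrite ?lpow0 // lpowS fU.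
Qed.

Lemma lpow_eig f n c v : f v = c *: v -> lpow f n v = c ^+ n *: v.
Proof.
move=> fv; elim: n => [|n IHn]; first by rewrite lpow0 scale1r.
by rewrite lpowS IHn linearZ /= fv scalerA -exprSr.
Qed.

Lemma shiftE f c v : (f - c *: \1)%VF v = f v - c *: v.
Proof. by rewrite add_lfunE opp_lfunE scale_lfunE id_lfunE. Qed.

End LinearAlgebra.

Section ClosedField.

Variables (K : closedFieldType) (V : vectType K).
Hypothesis charK : [pchar K] =i pred0.
Implicit Types (f g : 'End(V)).

Lemma pchar0_natr_eq0 n : (n%:R == 0 :> K) = (n == 0)%N.
Proof. by rewrite (pcharf0P K).1. Qed.

Lemma pchar0_natr_inj : injective (fun n => n%:R : K).
Proof.
move=> m n /= /eqP; wlog le_nm : m n / (n <= m)%N => [W|].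
  by case/orP: (leq_total n m) => le; [exact: W | rewrite eq_sym => /(W _ _ le)].
rewrite -subr_eq0 -natrB // pchar0_natr_eq0 subn_eq0 => le_mn.
by apply/eqP; rewrite eqn_leq le_mn.
Qed.

Lemma lfun_eigenvalues f :
  exists cs : seq K, [/\ size cs = dim V, lfun_tr f = \sum_(c <- cs) c
    & forall c, c \in cs <-> exists2 v, v != 0 & f v = c *: v].
Proof.
set A := f2mx f; have [cs Ecs] := closed_field_poly_normal (char_poly A).
have mon := char_poly_monic A; rewrite (monicP mon) scale1r in Ecs.
have sz : size cs = dim V.
  by have := size_char_poly A; rewrite Ecs size_prod_XsubC => -[].
exists cs; split=> //.
  have [V0 | Vp] := posnP (dim V).
    rewrite [LHS]big1 => [|i _]; last by have := ltn_ord i; rewrite {2}V0 ltn0.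
    by move: sz; rewrite V0 => /eqP; rewrite size_eq0 => /eqP->; rewrite big_nil.
  apply: oppr_inj; rewrite -(char_poly_trace A Vp) Ecs -{1}sz.
  by rewrite -coefPn_prod_XsubC // -lt0n sz.
move=> c; rewrite -root_prod_XsubC -Ecs -eigenvalue_root_char.
by split=> /eigenvalue_f2mx.
Qed.

Lemma exists_eigenvector f : (0 < dim V)%N -> exists c, exists2 v, v != 0 & f v = c *: v.
Proof.
move=> Vp; have [cs [sz _ csP]] := lfun_eigenvalues f.
exists (head 0 cs); apply/csP.
by case: cs sz {csP} => [/= E|c cs _]; [rewrite -E in Vp | rewrite mem_head].
Qed.

Lemma lfun_tr_neq0 f q : (0 < dim V)%N -> q != 0 ->
  (forall c v, v != 0 -> f v = c *: v -> exists2 k, (0 < k)%N & c = k%:R * q) ->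
  lfun_tr f != 0.
Proof.
move=> Vp nzq eigf; have [cs [sz -> csP]] := lfun_eigenvalues f.
have [n [En np]] : exists n, \sum_(c <- cs) c = n%:R * q /\ ((0 < size cs) ==> (0 < n))%N.
  have: {in cs, forall c, exists2 k, (0 < k)%N & c = k%:R * q}.
    by move=> c /csP[v nzv fv]; apply: eigf fv.
  elim: (cs) => [|c s IHs] css; first by exists 0%N; rewrite big_nil mul0r.
  have [|n [En _]] := IHs; first by move=> d sd; apply: css; rewrite inE sd orbT.
  have [k kp ck] := css c (mem_head _ _).
  exists (k + n)%N; rewrite big_cons En ck -mulrDl natrD addn_gt0 kp.
  by rewrite implybT.
by rewrite En mulf_neq0 // pchar0_natr_eq0; rewrite sz Vp /= in np; rewrite -lt0n.
Qed.

(** With 0 as only eigenvalue the characteristic polynomial is a power of X, and Cayley-Hamilton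
    applies. *)
Lemma lfun_nilpotent f :
  (forall c v, v != 0 -> f v = c *: v -> c = 0) -> lpow f (dim V) = 0.
Proof.
move=> eigf.
set A := f2mx f; have [cs' Ecs] := closed_field_poly_normal (char_poly A).
rewrite (monicP (char_poly_monic A)) scale1r in Ecs.
have sz' : size cs' = dim V.
  by have := size_char_poly A; rewrite Ecs size_prod_XsubC => -[].
have chiX : char_poly A = 'X^(dim V).
  rewrite Ecs -sz'; have: {in cs', forall c, c = 0}.
    move=> c; rewrite -root_prod_XsubC -Ecs -eigenvalue_root_char.
    by case/eigenvalue_f2mx => v nzv; apply: eigf.
  elim: (cs') => [|c s IHs] c0; first by rewrite big_nil.
  rewrite big_cons IHs => [|d sd]; last by apply: c0; rewrite inE sd orbT.
  by rewrite (c0 c (mem_head _ _)) subr0 exprS.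
have nilA n (B : 'M[K]_n) : char_poly B = 'X^n -> forall m, iter n (mulmx B) (m : 'M_n) = 0.
  case: n B => [|n] B EB m; first by apply/matrixP => -[].
  have := Cayley_Hamilton B; rewrite EB rmorphXn /= horner_mx_X => Bn0.
  suff E k : iter k (mulmx B) m = B ^+ k *m m.
    by have := E n.+1; rewrite Bn0 mul0mx.
  elim: k => [|k IHk]; first by rewrite expr0 mul1mx.
  by rewrite iterS IHk mulmxA exprS.
apply/lfunP => v; rewrite zero_lfunE; apply: v2r_inj; rewrite linear0.
have E n u : v2r (lpow f n u) = v2r u *m iter n (mulmx A) 1%:M.
  elim: n u => [|n IHn] u; first by rewrite lpow0 mulmx1.
  by rewrite lpowSr IHn lfun_f2mx -mulmxA.
by rewrite E nilA // mulmx0.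
Qed.

End ClosedField.

Section StableSubspaces.

Variables (K : closedFieldType) (V : vectType K).
Hypothesis charK : [pchar K] =i pred0.
Implicit Types (f g : 'End(V)) (U W : {vspace V}).

Definition lstable U f := {in U, forall v, f v \in U}.

(** A genuine restriction only when [U] is stable under [f]; otherwise the values are projected back
    to [U]. *)
Definition lrestr U f : 'End(subvs_of U) := linfun (vsproj U \o f \o vsval).

Lemma lrestrE U f u : lstable U f -> vsval (lrestr U f u) = f (vsval u).
Proof. by move=> fU; rewrite lfunE /= vsprojK // fU // subvsP. Qed.

Lemma lpow_restr U f n u : lstable U f -> vsval (lpow (lrestr U f) n u) = lpow f n (vsval u).
Proof.
by move=> fU; elim: n => [|n IHn]; rewrite ?lpow0 // !lpowS lrestrE // IHn.
Qed.

Lemma dim_subvs U : dim (subvs_of U) = \dim U.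
Proof. by []. Qed.

Lemma stable_eigenvector U f : U != 0%VS -> lstable U f ->
  exists c v, [/\ v \in U, v != 0 & f v = c *: v].
Proof.
move=> nzU fU; have Up : (0 < dim (subvs_of U))%N by rewrite dim_subvs lt0n dimv_eq0.
have [c [v nzv fv]] := exists_eigenvector (lrestr U f) Up.
exists c, (vsval v); split; first exact: subvsP.
  by apply: contra nzv => /eqP v0; apply/eqP/subvs_inj; rewrite v0 linear0.
by rewrite -lrestrE // fv linearZ.
Qed.

Lemma lpow_nilpotent U f : lstable U f ->
  (forall c v, v \in U -> v != 0 -> f v = c *: v -> c = 0) ->
  {in U, forall v, lpow f (dim V) v = 0}.
Proof.
move=> fU eigf v Uv.
have nil_r : lpow (lrestr U f) (dim (subvs_of U)) = 0.
  apply: lfun_nilpotent => c u nzu fu; apply: (eigf c (vsval u)); first exact: subvsP.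
    by apply: contra nzu => /eqP u0; apply/eqP/subvs_inj; rewrite u0 linear0.
  by rewrite -lrestrE // fu linearZ.
have le_d : (dim (subvs_of U) <= dim V)%N by rewrite dim_subvs -dimvf dimvS ?subvf.
by rewrite -(subnK le_d) lpowD -(vsprojK Uv) -lpow_restr // nil_r zero_lfunE !linear0.
Qed.

(** On the kernel of [lpow f n] the only possible eigenvalue is 0, so the exponent [dim V] always
    suffices. *)
Lemma lpow_stab f n v : lpow f n v = 0 -> lpow f (dim V) v = 0.
Proof.
move=> fv0; pose U := lker (lpow f n).
have Uv : v \in U by rewrite memv_ker fv0.
apply: (@lpow_nilpotent U) Uv => [u | c u]; rewrite memv_ker => /eqP fu0.
  by rewrite memv_ker -lpowSr lpowS fu0 linear0.
move=> nzu fu; apply/eqP; apply: contraTT nzu => nzc; rewrite negbK.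
have := fu0; rewrite (lpow_eig n fu) => /eqP; rewrite scaler_eq0 expf_eq0.
by rewrite (negPf nzc) andbF.
Qed.

(* A commutator of endomorphisms of [U] has trace 0, a nonempty sum of positive multiples of
   [q] has not. *)
Lemma stable_trace U f g q : lstable U f -> lstable U g -> q != 0 ->
  (forall c v, v \in U -> v != 0 -> f (g v) - g (f v) = c *: v ->
     exists2 k, (0 < k)%N & c = k%:R * q) ->
  U = 0%VS.
Proof.
move=> fU gU nzq eigfg; apply/eqP/negPn/negP => nzU.
pose h := ((lrestr U f \o lrestr U g) - (lrestr U g \o lrestr U f))%VF.
have : lfun_tr h != 0.
  apply: (lfun_tr_neq0 charK _ nzq); first by rewrite dim_subvs lt0n dimv_eq0.
  move=> c u nzu hu; apply: (eigfg c (vsval u)); first exact: subvsP.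
    by apply: contra nzu => /eqP u0; apply/eqP/subvs_inj; rewrite u0 linear0.
  move/(congr1 vsval): hu; rewrite linearZ /= => <-.
  by rewrite add_lfunE opp_lfunE !comp_lfunE linearB /= !lrestrE.
by rewrite lfun_trB lfun_trM subrr eqxx.
Qed.

(** By [lpow_stab] the fixed exponent loses nothing against the union of the kernels of all
    powers. *)
Definition gen_eigen f c : {vspace V} := lker (lpow (f - c *: \1%VF) (dim V)).

Lemma gen_eigenP f c v :
  reflect (exists n, lpow (f - c *: \1%VF) n v = 0) (v \in gen_eigen f c).
Proof.
rewrite memv_ker; apply: (iffP eqP) => [fv | [n]]; first by exists (dim V).
exact: lpow_stab.
Qed.

Lemma eigen_gen f c v : f v = c *: v -> v \in gen_eigen f c.
Proof.
by move=> fv; apply/gen_eigenP; exists 1%N; rewrite lpowS lpow0 shiftE fv subrr.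
Qed.

Lemma stable_gen U f d : lstable U f ->
  (forall c v, v \in U -> v != 0 -> f v = c *: v -> c = d) ->
  (U <= gen_eigen f d)%VS.
Proof.
move=> fU eigf; apply/subvP => v Uv; rewrite memv_ker; apply/eqP.
apply: (@lpow_nilpotent U) v Uv => [v Uv | c v Uv nzv].
  by rewrite shiftE memvB ?memvZ ?fU.
rewrite shiftE => /(canRL (subrK _)); rewrite -scalerDl => /eigf E.
by apply: (addIr d); rewrite E // add0r.
Qed.

Lemma gen_eigen_eigen f c d v : v != 0 -> v \in gen_eigen f c -> f v = d *: v -> d = c.
Proof.
move=> nzv /gen_eigenP[n]; set g := f - _ => gv0 fv.
have gv : g v = (d - c) *: v by rewrite shiftE fv scalerBl.
move/eqP: gv0; rewrite (lpow_eig n gv) scaler_eq0 (negPf nzv) orbF expf_eq0.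
by case/andP=> _; rewrite subr_eq0 => /eqP.
Qed.

(** If [d] differs from [c i], the power [dim V] of [f - c i] kills one summand and multiplies [v]
    by a nonzero scalar, which shortens the sum. *)
Lemma gen_eigen_sum (I : eqType) (r : seq I) f (c : I -> K) d v :
  v != 0 -> f v = d *: v -> v \in (\sum_(i <- r) gen_eigen f (c i))%VS ->
  exists2 i, i \in r & d = c i.
Proof.
elim: r v => [|i r IHr] v nzv fv; first by rewrite big_nil memv0 (negPf nzv).
rewrite big_cons => /memv_addP[u uG [w wS Ev]].
have [-> | nei] := eqVneq d (c i); first by exists i; rewrite ?mem_head.
set g := f - c i *: \1%VF; have gE x : g x = f x - c i *: x by exact: shiftE.
have gv : g v = (d - c i) *: v by rewrite gE fv scalerBl.
have gS : lstable (\sum_(j <- r) gen_eigen f (c j))%VS g.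
  move=> x; elim: (r) x {IHr wS} => [|j s IHs] x.
    by rewrite big_nil !memv0 => /eqP->; rewrite linear0.
  rewrite big_cons => /memv_addP[y yG [z zS ->]]; rewrite linearD memv_add ?IHs //.
  move: yG; rewrite !memv_ker => /eqP y0.
  set h := f - _ in y0 *; have hE z' : h z' = f z' - c j *: z' by exact: shiftE.
  have hg z' : h (g z') = g (h z').
    rewrite !hE !gE ![f (_ - _)]linearB /= ![f (_ *: _)]linearZ /= !scalerBr !opprD !opprK.
    by rewrite !scalerA [c j * c i]mulrC !addrA; congr (_ + _); rewrite addrAC.
  have gh n : lpow h n (g y) = g (lpow h n y).
    by elim: n => [|n IHn]; rewrite ?lpow0 // !lpowS IHn hg.
  by rewrite gh y0 linear0.
have: lpow g (dim V) v \in (\sum_(j <- r) gen_eigen f (c j))%VS.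
  rewrite Ev linearD /=; move: uG; rewrite memv_ker => /eqP->.
  by rewrite add0r lpow_img.
rewrite (lpow_eig _ gv) => wS'.
have nzu : (d - c i) ^+ dim V *: v != 0.
  by rewrite scaler_eq0 negb_or nzv expf_neq0 // subr_eq0.
have fu : f ((d - c i) ^+ dim V *: v) = d *: ((d - c i) ^+ dim V *: v).
  by rewrite linearZ /= fv !scalerA mulrC.
by have [j rj ->] := IHr _ nzu fu wS'; exists j; rewrite // inE rj orbT.
Qed.

(** Kernel and image of [lpow f (dim V)] meet in 0 by [lpow_stab], so by dimension they span. *)
Lemma Fitting f v : exists x w, lpow f (dim V) x = 0 /\ v = x + lpow f (dim V) w.
Proof.
set F := lpow f (dim V).
have cap0 : (lker F :&: limg F = 0)%VS.
  apply/eqP; rewrite -subv0; apply/subvP => x; rewrite memv_cap memv_ker memv0.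
  case/andP=> /eqP Fx0 /memv_imgP[w _ Ex].
  by rewrite Ex in Fx0 *; rewrite -lpowD in Fx0; rewrite /F (lpow_stab Fx0).
have : v \in (lker F + limg F)%VS.
  suff ->: (lker F + limg F)%VS = fullv by rewrite memvf.
  apply/eqP; rewrite eqEdim subvf dimv_disjoint_sum //.
  by rewrite -[X in (X <= _)%N](limg_ker_dim F) capfv leqnn.
case/memv_addP => x; rewrite memv_ker => /eqP Fx [y /memv_imgP[w _ ->] ->].
by exists x, w.
Qed.

End StableSubspaces.

(** * Cartan subalgebras and roots *)

Section LieBasics.

Variables (K : fieldType) (L : lieAlgType K).
Implicit Types (x y z : L) (U W : {vspace L}).

Lemma lieDl x y z : lie (x + y) z = lie x z + lie y z.
Proof. by rewrite -[x in LHS]scale1r lie_is_linearl scale1r. Qed.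

Lemma lie0l z : lie 0 z = 0 :> L.
Proof. by apply: (addrI (lie 0 z)); rewrite -lieDl !addr0. Qed.

Lemma lieZl c x z : lie (c *: x) z = c *: lie x z.
Proof. by rewrite -[c *: x]addr0 lie_is_linearl lie0l addr0. Qed.

Lemma lieNl x z : lie (- x) z = - lie x z.
Proof. by rewrite -scaleN1r lieZl scaleN1r. Qed.

Lemma lieBl x y z : lie (x - y) z = lie x z - lie y z.
Proof. by rewrite lieDl lieNl. Qed.

Lemma lieDr x y z : lie x (y + z) = lie x y + lie x z.
Proof. exact: linearD. Qed.

Lemma lie0r x : lie x 0 = 0 :> L.
Proof. exact: linear0. Qed.

Lemma lieZr c x z : lie x (c *: z) = c *: lie x z.
Proof. exact: linearZ. Qed.

Lemma lieNr x z : lie x (- z) = - lie x z.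
Proof. exact: linearN. Qed.

Lemma lieBr x y z : lie x (y - z) = lie x y - lie x z.
Proof. exact: linearB. Qed.

Lemma lie_anti x y : lie x y = - lie y x.
Proof.
have := liexx (x + y); rewrite lieDl !lieDr !liexx add0r addr0.
by move/(canRL (addrK _)); rewrite add0r.
Qed.

Lemma lie_lier x y z : lie x (lie y z) = lie (lie x y) z + lie y (lie x z).
Proof.
have := lie_jacobi x y z; rewrite (lie_anti z (lie x y)) (lie_anti z x) lieNr.
by move/eqP; rewrite -addrA -opprD subr_eq0 => /eqP ->; rewrite addrC.
Qed.

Lemma lie_liel x y z : lie (lie x y) z = lie x (lie y z) - lie y (lie x z).
Proof. by rewrite lie_lier addrK. Qed.

(** By the Leibniz rule one application of [ad s - (c + d)] to [lie x y] advances one factor or the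
    other by a step, whence an induction on the sum of the exponents. *)
Lemma gen_eigen_lie s c d x y :
  (exists n, lpow (ad s - c *: \1%VF) n x = 0) ->
  (exists n, lpow (ad s - d *: \1%VF) n y = 0) ->
  exists n, lpow (ad s - (c + d) *: \1%VF) n (lie x y) = 0.
Proof.
case=> m xm [n yn]; exists (m + n)%N.
have [k] := ubnP (m + n)%N; elim: k m n x y xm yn => // k IHk m n x y xm yn lek.
case: m => [|m] in xm lek *; first by rewrite lpow0 in xm; rewrite xm lie0l linear0.
case: n => [|n] in yn lek *; first by rewrite lpow0 in yn; rewrite yn lie0r linear0.
have E : (ad s - (c + d) *: \1)%VF (lie x y) =
   lie ((ad s - c *: \1)%VF x) y + lie x ((ad s - d *: \1)%VF y).
  rewrite !shiftE !adE lie_lier lieBl lieBr lieZl lieZr scalerDl opprD.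
  by rewrite -!addrA; congr (_ + _); rewrite [RHS]addrCA.
rewrite addSn lpowSr E linearD /= IHk ?add0r -?lpowSr //.
  by rewrite -addSnnS IHk -?lpowSr // addSnnS.
Qed.

End LieBasics.

(** * Common eigenvectors of a nilpotent subalgebra *)

Section Nilpotent.

Variables (K : closedFieldType) (L : lieAlgType K) (h : {vspace L}).
Hypothesis charK : [pchar K] =i pred0.
Hypothesis clh : lie_closed h.
Hypothesis nilh : nilpotent_lie h.
Implicit Types (x y z s : L) (U W : {vspace L}).

Definition hstable W := forall s v, s \in h -> v \in W -> lie s v \in W.

(** One step of Lie's theorem on the quotient of [W] by [W1]: the eigenspace of [s] there is stable
    under [h] once the commutators of [s] with [h] act by 0, and a scalar that is a commutator has
    trace 0. *)
Lemma hstable_scalar_step W1 W s : hstable W1 -> hstable W -> (W1 <= W)%VS ->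
    ~~ (W <= W1)%VS -> s \in h ->
    (forall s', s' \in h -> exists c, forall v, v \in W ->
       lie (lie s s') v - c *: v \in W1) ->
  exists W', [/\ hstable W', (W1 <= W' <= W)%VS, ~~ (W' <= W1)%VS &
    exists c, forall v, v \in W' -> lie s v - c *: v \in W1].
Proof.
move=> st1 st sW1 nW hs sc.
(* The complement [C] with the projection [p] stands for the quotient of [W] by [W1]. *)
pose C := (W :\: W1)%VS; pose p := daddv_pi C W1.
have capC : (C :&: W1 = 0)%VS by apply: capv_diff.
have addC : (C + W1 = W)%VS by rewrite addv_diff; apply/addv_idPl.
have CW v : v \in C -> v \in W by apply/subvP/diffvSl.
have pC v : p v \in C by apply: memv_pi.
have pid v : v \in C -> p v = v by apply: daddv_pi_id.
have pW v : v \in W -> v - p v \in W1.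
  rewrite -addC => /(daddv_pi_add capC) {1}<-.
  by rewrite addrAC subrr add0r memv_pi.
have p0 v : v \in W1 -> p v = 0.
  move=> W1v; apply/eqP; rewrite -memv0 -capC memv_cap pC /=.
  by rewrite -[p v](subKr v) memvB // pW // (subvP sW1).
have nzC : C != 0%VS by rewrite diffv_eq0.
have stab s' : s' \in h -> lstable C (p \o ad s')%VF.
  by move=> hs' v _; rewrite comp_lfunE.
have [c [v [Cv nzv]]] := stable_eigenvector nzC (stab s hs).
rewrite comp_lfunE adE => pv.
have sv : lie s v - c *: v \in W1 by rewrite -pv pW // st // CW.
pose W' := (W :&: (ad s - c *: \1%VF) @^-1: W1)%VS.
have W'P u : (u \in W') = (u \in W) && (lie s u - c *: u \in W1).
  by rewrite memv_cap -memv_preim shiftE adE.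
exists W'; split.
- move=> s' u hs'; rewrite !W'P => /andP[Wu su]; rewrite st //=.
  have [c' cP] := sc s' hs'.
  have c'0 : c' = 0.
    apply/eqP/negPn/negP => nzc'.
    suff: C = 0%VS by move/eqP; rewrite (negPf nzC).
    apply: (stable_trace charK (stab s hs) (stab s' hs') nzc').
    move=> d w Cw nzw; rewrite !comp_lfunE !adE.
    have E a b : a \in h -> b \in h -> p (lie a (p (lie b w))) = p (lie a (lie b w)).
      move=> ha hb; apply/eqP; rewrite -subr_eq0 -linearB -lieBr; apply/eqP/p0.
      rewrite -opprB lieNr memvN; apply: st1 => //; apply: pW.
      by apply: st => //; apply: CW.
    rewrite !E // -linearB -lie_liel /= => pw; exists 1%N => //.
    rewrite mul1r; apply/eqP; rewrite -subr_eq0.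
    have: (d - c') *: w == 0.
      rewrite scalerBl -pw -{2}(pid w Cw) -linearZ -linearB; apply/eqP/p0/cP.
      exact: CW.
    by rewrite scaler_eq0 (negPf nzw) orbF.
  have := cP u Wu; rewrite c'0 scale0r subr0 => su0.
  have ->: lie s (lie s' u) - c *: lie s' u = lie (lie s s') u + lie s' (lie s u - c *: u).
    by rewrite lieBr lieZr lie_lier addrA.
  by rewrite memvD // st1.
- apply/andP; split; last exact: capvSl.
  apply/subvP => u W1u; rewrite W'P (subvP sW1) //=.
  by rewrite memvB ?memvZ ?st1.
- apply/subvPn; exists v; first by rewrite W'P CW.
  apply: contra nzv => W1v; rewrite -memv0 -capC memv_cap Cv.
  exact: W1v.
by exists c => u; rewrite W'P => /andP[].
Qed.

Definition lower_central i := iter i (lie_space h) h.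

Lemma lower_central_sub i : (lower_central i <= h)%VS.
Proof.
elim: i => [|i IHi] /=; first exact: subvv.
apply/lie_spaceP => x y hx /(subvP IHi) hy.
by have /lie_spaceP := clh; apply.
Qed.

(** Runs up the lower central series from its last, zero term: brackets of [h] with one term lie in
    the next, which already acts by scalars on the subspace found so far. *)
Lemma hstable_common_eigen W1 W2 : hstable W1 -> hstable W2 -> (W1 <= W2)%VS ->
    ~~ (W2 <= W1)%VS ->
  exists v, [/\ v \in W2, v \notin W1 &
    forall s, s \in h -> exists c, lie s v - c *: v \in W1].
Proof.
move=> st1 st2 sW12 nW12; have [n hn0] := nilh.
suff down k : (k <= n)%N -> exists W, [/\ hstable W, (W1 <= W <= W2)%VS,
    ~~ (W <= W1)%VS & forall s, s \in lower_central (n - k) -> exists c, forall v, v \in W ->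
       lie s v - c *: v \in W1].
  have [W [stW /andP[sW1 sW2] nW]] := down n (leqnn n); rewrite subnn => scW.
  have [v Wv W1v] := subvPn nW; exists v; split=> // [|s hs]; first exact: (subvP sW2).
  by have [c cP] := scW s hs; exists c; apply: cP.
elim: k => [_|k IHk ltk].
  rewrite subn0; exists W2; rewrite sW12 subvv; split=> // s.
  rewrite /lower_central hn0 memv0 => /eqP->; exists 0 => v _.
  by rewrite lie0l scale0r subr0 mem0v.
have [W [stW /andP[sW1 sW2] nW scW]] := IHk (ltnW ltk).
have En : (n - k = (n - k.+1).+1)%N by rewrite -subSn.
rewrite En in scW.
set i := (n - k.+1)%N in scW *.
have {}scW s : s \in lower_central i.+1 -> exists c, forall v, v \in W -> lie s v - c *: v \in W1.
  by apply: scW.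
suff [W' [stW' /andP[sW1' sW2'] nW' scW']] : exists W', [/\ hstable W', (W1 <= W' <= W)%VS,
    ~~ (W' <= W1)%VS & forall s, s \in (vbasis (lower_central i) : seq L) ->
      exists c, forall v, v \in W' -> lie s v - c *: v \in W1].
  exists W'; split=> //; first by rewrite sW1' (subv_trans sW2').
  move=> s /coord_vbasis->.
  elim/big_ind: _ => [|x y [c cP] [d dP]|j _].
  - by exists 0 => v _; rewrite lie0l scale0r subr0 mem0v.
  - exists (c + d) => v Wv; rewrite lieDl scalerDl opprD addrACA.
    by rewrite memvD ?cP ?dP.
  have [|c cP] := scW' (vbasis (lower_central i))`_j; first by rewrite mem_nth ?size_tuple.
  exists (coord (vbasis (lower_central i)) j s * c) => v Wv.
  by rewrite lieZl -scalerA -scalerBr memvZ ?cP.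
(* Within one term the basis vectors are made scalar one at a time, each time shrinking the
   subspace. *)
have: {subset (vbasis (lower_central i) : seq L) <= lower_central i} by move=> s /vbasis_mem.
elim: (vbasis _ : seq L) => [|s r IHr] sr.
  by exists W; rewrite sW1 subvv.
have [|W' [stW' /andP[sW1' sW2'] nW' scW']] := IHr.
  by move=> t rt; apply: sr; rewrite inE rt orbT.
have hs : s \in lower_central i by apply: sr; rewrite mem_head.
have [|s' hs'|W'' [st'' /andP[s1'' s2''] n'' [c cP]]] :=
  @hstable_scalar_step W1 W' s st1 stW' sW1' nW'.
- exact: (subvP (lower_central_sub i)).
- have [|c cP] := scW (lie s' s); first by rewrite /= memv_lie.
  exists (- c) => v W'v; rewrite [lie s s']lie_anti lieNl scaleNr -opprD memvN.
  by rewrite cP // (subvP sW2').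
exists W''; split=> //; first by rewrite s1'' (subv_trans s2'').
move=> t; rewrite inE => /predU1P[-> | rt]; first by exists c.
have [d dP] := scW' t rt; exists d => v Wv; apply: dP; exact: (subvP s2'').
Qed.

End Nilpotent.

Lemma avoid_seq (K : closedFieldType) (cs : seq K) : exists c, c \notin cs.
Proof.
have : \prod_(c <- cs) ('X - c%:P) != 0 by apply/monic_neq0/monic_prod_XsubC.
by case/closed_nonrootP => c; rewrite root_prod_XsubC => ?; exists c.
Qed.

(** Move [t] along a direction [s] with [u s] nonzero: each nonzero form excludes at most one
    parameter, and an algebraically closed field is infinite. *)
Lemma avoid_hyperplanes (K : closedFieldType) (V : vectType K) (F : seq 'Dual(V)) :
  exists t, forall u, u \in F -> u != 0 -> (u t : K) != 0.
Proof.
elim: F => [|u F [t tF]]; first by exists 0.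
have [u0 | nzu] := eqVneq u 0.
  by exists t => w; rewrite inE u0 => /predU1P[-> | /tF //]; rewrite eqxx.
have [s us] : exists s, (u s : K) != 0.
  by have /lfunPn[s] := nzu; rewrite zero_lfunE; exists s.
have [r] := avoid_seq (0 :: [seq - (w t : K) / (w s : K) | w : 'Dual(V) <- u :: F]).
rewrite inE negb_or => /andP[nzr rF]; exists (t + r *: s) => w Fw nzw.
rewrite linearD linearZ /=.
have [ws0 | nzs] := eqVneq (w s : K) 0.
  rewrite ws0 scaler0 addr0; apply: tF => //; move: Fw; rewrite inE => /predU1P[E | //].
  by rewrite -E ws0 eqxx in us.
apply: contra rF => /eqP E; apply/mapP; exists w => //.
apply: (mulIf nzs); rewrite mulfVK //.
by apply/eqP; rewrite -addr_eq0 addrC E.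
Qed.

Lemma lpow_mod (K : fieldType) (V : vectType K) (W : {vspace V}) (f : 'End(V)) c v n :
  {in W, forall w, f w \in W} -> f v - c *: v \in W -> lpow f n v - c ^+ n *: v \in W.
Proof.
move=> fW fv; elim: n => [|n IHn]; first by rewrite lpow0 scale1r subrr mem0v.
rewrite lpowS -[lpow f n v](subrK (c ^+ n *: v)) exprSr -scalerA [f (_ + _)]linearD /= [f (_ *: _)]linearZ /=.
by rewrite -addrA -scalerBr memvD ?fW // memvZ.
Qed.

Section Cartan.

Variables (K : closedFieldType) (L : lieAlgType K) (h : {vspace L}).
Hypothesis charK : [pchar K] =i pred0.
Hypothesis cartan_h : cartan_subalgebra h.
Variable R : seq 'Dual(subvs_of h).
Hypothesis root_R : root_system R.
Implicit Types (x y z s t : L) (U W : {vspace L}) (a b : 'Dual(subvs_of h)).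

Let clh : lie_closed h. Proof. by case: cartan_h. Qed.
Let nilh : nilpotent_lie h. Proof. by case: cartan_h. Qed.

(** Precomposition with [vsproj] lets a weight be evaluated on elements of [L]; the value is
    meaningful on [h] only. *)
Definition wt a z : K := a (vsproj h z).

Lemma wtD a z z' : wt a (z + z') = wt a z + wt a z'.
Proof. by rewrite /wt !linearD. Qed.

Lemma wtZ a c z : wt a (c *: z) = c * wt a z.
Proof. by rewrite /wt !linearZ. Qed.

Lemma root_lie a x z : x \in root_space a -> z \in h -> lie z x = wt a z *: x.
Proof. by move/root_spaceP => xa hz; rewrite -{1}(vsprojK hz) xa. Qed.

Lemma root_lieP a x :
  reflect (forall z, z \in h -> lie z x = wt a z *: x) (x \in root_space a).
Proof.
apply: (iffP idP) => [xa z hz | xa]; first exact: root_lie.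
by apply/root_spaceP => t; rewrite xa ?subvsP // /wt vsvalK.
Qed.

Lemma memh_lie s t : s \in h -> t \in h -> lie s t \in h.
Proof. by move=> hs ht; have /lie_spaceP := clh; apply. Qed.

Lemma hstable_h : hstable h h.
Proof. by move=> s t; apply: memh_lie. Qed.

Lemma hstable0 : hstable h 0%VS.
Proof. by move=> s v _; rewrite !memv0 => /eqP->; rewrite lie0r. Qed.

Lemma hstable_cap U W : hstable h U -> hstable h W -> hstable h (U :&: W)%VS.
Proof.
by move=> sU sW s v hs; rewrite !memv_cap => /andP[Uv Wv]; rewrite sU ?sW.
Qed.

Lemma hstable_full : hstable h fullv.
Proof. by move=> s v _ _; rewrite memvf. Qed.

Lemma common_eigen_root v : v != 0 ->
  (forall s, s \in h -> exists c, lie s v = c *: v) -> exists a, v \in root_space a.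
Proof.
move=> nzv sv; pose X := [tuple v].
have freeX : free X by rewrite seq1_free.
(* A form with value 1 at [v] turns the eigenvalue into a linear function of [z]; the sign in [a]
   comes from using [ad v] in place of [ad z]. *)
pose phi : 'Dual(L) := linfun (coord X ord0 : L -> K^o).
have phiv : phi v = 1 :> K.
  by rewrite lfunE /= -[v]/(X`_(ord0 : 'I_1)) coord_free.
pose a : 'Dual(subvs_of h) := - (phi \o (ad v \o linfun (@vsval _ _ h)))%VF.
exists a; apply/root_lieP => z hz; have [c Ec] := sv z hz.
have ->: wt a z = c; last by [].
have E : linfun (@vsval _ _ h) (vsproj h z) = z by rewrite lfunE /= vsprojK.
rewrite /wt opp_lfunE !comp_lfunE adE E lie_anti Ec.
by rewrite -scaleNr linearZ /= phiv -[_ *: _]/(_ * _) mulr1 opprK.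
Qed.

Lemma exists_root_vector W : hstable h W -> W != 0%VS ->
  exists a v, [/\ v \in W, v != 0 & v \in root_space a].
Proof.
move=> stW nzW; have [|v [Wv]] :=
  hstable_common_eigen charK clh nilh hstable0 stW (sub0v W); first by rewrite subv0.
rewrite memv0 => nzv sv; have [|a va] := common_eigen_root nzv; last by exists a, v.
move=> s /sv[c]; rewrite memv0 subr_eq0 => /eqP->; by exists c.
Qed.

Lemma weight_root a v : v != 0 -> v \in root_space a -> a = 0 \/ a \in R.
Proof.
move=> nzv va; have [-> | nza] := eqVneq a 0; [by left | right].
rewrite (root_R.2 a) nza /=; apply: contra nzv => /eqP E.
by rewrite -memv0 -E.
Qed.

Lemma lpow_ad_lower s t n : s \in h -> t \in h -> lpow (ad s) n t \in lower_central h n.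
Proof.
move=> hs ht; elim: n => [|n IHn]; first by rewrite lpow0.
by rewrite lpowS adE memv_lie.
Qed.

Lemma gen_eigen0 (V : vectType K) (f : 'End(V)) : gen_eigen f 0 = lker (lpow f (dim V)).
Proof. by rewrite /gen_eigen scale0r subr0. Qed.

Lemma h_sub_gen0 s : s \in h -> (h <= gen_eigen (ad s) 0)%VS.
Proof.
move=> hs; apply/subvP => t ht; apply/gen_eigenP => //; rewrite scale0r subr0.
have [n hn0] := nilh; exists n; apply/eqP; rewrite -memv0 -hn0.
exact: lpow_ad_lower.
Qed.

Lemma lie_gen_eigen s c d x y : x \in gen_eigen (ad s) c -> y \in gen_eigen (ad s) d ->
  lie x y \in gen_eigen (ad s) (c + d).
Proof.
move=> /gen_eigenP xs /gen_eigenP ys; apply/gen_eigenP => //.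
exact: gen_eigen_lie xs ys.
Qed.

Lemma hstable_gen s c : s \in h -> hstable h (gen_eigen (ad s) c).
Proof.
move=> hs t v ht vG; rewrite -[c]add0r lie_gen_eigen //.
exact: (subvP (h_sub_gen0 hs)).
Qed.

Lemma hstable_ad s W : s \in h -> hstable h W -> lstable W (ad s).
Proof. by move=> hs sW v Wv; rewrite adE sW. Qed.

(** The generalized eigenspace of [ad z] is stable under the nilpotent algebra [h], hence contains a
    weight vector, whose weight takes the value [c] at [z]. *)
Lemma eigen_weight W z c v : hstable h W -> z \in h -> v \in W -> v != 0 ->
  lie z v = c *: v -> exists a u, [/\ u \in W, u != 0, u \in root_space a & wt a z = c].
Proof.
move=> stW hz Wv nzv zv; pose G := (W :&: gen_eigen (ad z) c)%VS.
have Gv : v \in G by rewrite memv_cap Wv eigen_gen ?adE.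
have [||a [u [Gu nzu ua]]] := @exists_root_vector G.
- by apply: hstable_cap stW _; apply: hstable_gen.
- by apply: contra nzv => /eqP G0; rewrite -memv0 -G0.
exists a, u; move: Gu; rewrite memv_cap => /andP[Wu uG]; split=> //.
by apply: gen_eigen_eigen nzu uG _; rewrite // adE; apply: root_lie.
Qed.

Lemma gen_weights W z d : hstable h W -> z \in h ->
  (forall a v, v \in W -> v != 0 -> v \in root_space a -> wt a z = d) ->
  (W <= gen_eigen (ad z) d)%VS.
Proof.
move=> stW hz wtW; apply: stable_gen => //; first exact: hstable_ad.
move=> c v Wv nzv; rewrite adE => zv.
have [a [u [Wu nzu ua <-]]] := eigen_weight stW hz Wv nzv zv.
exact: wtW ua.
Qed.

Lemma root_gen a v z : v \in root_space a -> z \in h -> v \in gen_eigen (ad z) (wt a z).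
Proof. by move=> va hz; rewrite eigen_gen // adE; apply: root_lie. Qed.

Lemma root_gen_eq a v z c : v != 0 -> v \in root_space a -> z \in h ->
  v \in gen_eigen (ad z) c -> wt a z = c.
Proof.
by move=> nzv va hz vG; apply: gen_eigen_eigen nzv vG _; rewrite // adE; apply: root_lie.
Qed.

(* Otherwise [h] acts on the quotient of this space by [h] with a common eigenvector, of weight 0
   by regularity of [t]; a representative of it normalizes [h]. *)
Lemma gen0_eq_h t : t \in h -> {in R, forall a, wt a t != 0} -> gen_eigen (ad t) 0 = h.
Proof.
move=> ht reg; apply/eqP; rewrite eqEsubv h_sub_gen0 // andbT; apply/negPn/negP => nG.
have [v [Gv hv sv]] := hstable_common_eigen charK clh nilh hstable_h
  (@hstable_gen t 0 ht) (h_sub_gen0 ht) nG.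
case/negP: hv; have [_ _ selfh] := cartan_h; apply: selfh => s hs.
have [c sc] := sv s hs; rewrite lie_anti memvN.
have [c0 | nzc] := eqVneq c 0; first by rewrite c0 scale0r subr0 in sc.
rewrite -(subrK (c *: v) (lie s v)) memvD // memvZ //.
(* Since [ad s] is nilpotent on [h], its [N]-th power clears the error term in [h] and leaves a true
   eigenvector, congruent to [c ^+ N *: v] modulo [h]. *)
pose N := dim L; pose v' := lpow (ad s) N v.
have hs_st : {in h, forall w, ad s w \in h} by move=> w hw; rewrite adE memh_lie.
have v'h : v' - c ^+ N *: v \in h by apply: lpow_mod => //; rewrite adE.
have [v'0 | nzv'] := eqVneq v' 0.
  by move: v'h; rewrite v'0 sub0r memvN -{2}[v](scalerK (expf_neq0 N nzc)); apply: memvZ.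
have sv' : lie s v' = c *: v'.
  apply/eqP; rewrite -subr_eq0 -[lie s v']adE -lpowS lpowSr -linearZ -linearB /= adE.
  by have := subvP (h_sub_gen0 hs) _ sc; rewrite gen_eigen0 memv_ker.
have Gv' : v' \in gen_eigen (ad t) 0.
  by apply: lpow_img Gv; apply: hstable_ad => //; apply: hstable_gen.
have [a [u [Gu nzu ua as_c]]] := eigen_weight (@hstable_gen t 0 ht) hs Gv' nzv' sv'.
have [a0 | Ra] := weight_root nzu ua.
  by move/eqP: nzc; case; rewrite -as_c /wt a0 zero_lfunE.
by have := reg a Ra; rewrite (root_gen_eq nzu ua ht Gu) eqxx.
Qed.

End Cartan.

(** * The Killing form *)

Section Killing.

Variables (K : fieldType) (L : lieAlgType K).
Implicit Types (x y z : L).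

Definition killing x y : K := lfun_tr (ad x \o ad y)%VF.

Lemma ad_lie x y : ad (lie x y) = (ad x \o ad y)%VF - (ad y \o ad x)%VF.
Proof.
by apply/lfunP => z; rewrite add_lfunE opp_lfunE !comp_lfunE !adE lie_liel.
Qed.

Lemma killingC x y : killing x y = killing y x.
Proof. exact: lfun_trM. Qed.

Lemma killing_is_linear x : linear (killing x : L -> K^o).
Proof.
by move=> c y z; rewrite /killing linearP comp_lfunDr lfun_trD -comp_lfunZr lfun_trZ.
Qed.

HB.instance Definition _ x :=
  GRing.isLinear.Build K L K^o _ (killing x : L -> K^o) (killing_is_linear x).

Lemma killing_inv x y z : killing (lie x y) z = killing x (lie y z).
Proof.
rewrite /killing !ad_lie comp_lfunDl comp_lfunDr comp_lfunNl comp_lfunNr.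
rewrite !lfun_trB -comp_lfunA; congr (_ - _).
by rewrite comp_lfunA [RHS]lfun_trM comp_lfunA.
Qed.

Definition killing_map x : 'Dual(L) := linfun (killing x : L -> K^o).

Lemma killing_mapE x y : killing_map x y = killing x y.
Proof. by rewrite lfunE. Qed.

Lemma killing_map_is_linear : linear killing_map.
Proof.
move=> c x y; apply/lfunP => z; rewrite add_lfunE scale_lfunE !killing_mapE.
by rewrite ![killing _ z]killingC [LHS]linearP.
Qed.

HB.instance Definition _ :=
  GRing.isLinear.Build K L 'Dual(L) _ killing_map killing_map_is_linear.

Definition killing_radical : {vspace L} := lker (linfun killing_map).

Lemma killing_radicalP x : reflect (forall y, killing x y = 0) (x \in killing_radical).
Proof.
rewrite memv_ker lfunE /=; apply: (iffP eqP) => [E y | E].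
  by rewrite -killing_mapE E zero_lfunE.
by apply/lfunP => y; rewrite killing_mapE E zero_lfunE.
Qed.

Lemma killing_radical_ideal : lie_ideal killing_radical.
Proof.
apply/lie_spaceP => x y _ /killing_radicalP yR; apply/killing_radicalP => z.
by rewrite lie_anti killingC linearN /= killingC killing_inv yR oppr0.
Qed.

Lemma killing_nondeg : simple_lie L -> (exists x y, killing x y != 0) ->
  forall x, (forall y, killing x y = 0) -> x = 0.
Proof.
move=> [_ simp] [x [y nz]] z /killing_radicalP zR.
have [E | E] := simp _ killing_radical_ideal; first by apply/eqP; rewrite -memv0 -E.
have /killing_radicalP xR : x \in killing_radical by rewrite E memvf.
by rewrite xR eqxx in nz.
Qed.

End Killing.

Section CartanKilling.

Variables (K : closedFieldType) (L : lieAlgType K) (h : {vspace L}).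
Hypothesis charK : [pchar K] =i pred0.
Hypothesis cartan_h : cartan_subalgebra h.
Variable R : seq 'Dual(subvs_of h).
Hypothesis root_R : root_system R.
Implicit Types (x y z s t : L) (U W : {vspace L}) (a b : 'Dual(subvs_of h)).

Let clh : lie_closed h. Proof. by case: cartan_h. Qed.
Let nilh : nilpotent_lie h. Proof. by case: cartan_h. Qed.

(* The trace of [(ad z)^2] is a sum of squares of integers. *)
Lemma killing_integral z : z \in h ->
  {in R, forall a, exists n : int, wt a z = n%:~R} ->
  (exists2 a, a \in R & wt a z != 0) -> killing z z != 0.
Proof.
move=> hz intR [a0 Ra0 nza0].
have eig c v : v != 0 -> (ad z \o ad z)%VF v = c *: v -> exists k : nat, c = k%:R.
  move=> nzv zzv; have [m Em] : exists m, m ^+ 2 = c.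
    have [m] := closed_rootP ('X^2 - c%:P) (ltac:(by rewrite size_XnsubC)).
    by rewrite /root !hornerE subr_eq0 => /eqP; exists m.
  (* This eigenspace of the square is stable under [ad z]; an eigenvector of [ad z] in it shows that
     [c] is the square of a weight value. *)
  pose U := lker ((ad z \o ad z)%VF - c *: \1%VF).
  have Uv : v \in U by rewrite memv_ker shiftE zzv subrr.
  have [|| d [u [Uu nzu]]] := @stable_eigenvector _ _ U (ad z).
  - by apply: contra nzv => /eqP E; rewrite -memv0 -E.
  - move=> u; rewrite !memv_ker !shiftE !comp_lfunE !subr_eq0 => /eqP ->.
    by rewrite linearZ.
  rewrite adE => zu.
  have [a [w [_ nzw wa wd]]] := eigen_weight charK cartan_h (@hstable_full _ _ h) hz (memvf u) nzu zu.
  have Ec : c = d ^+ 2.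
    move: Uu; rewrite memv_ker shiftE comp_lfunE !adE zu lieZr zu scalerA -scalerBl.
    by rewrite scaler_eq0 (negPf nzu) orbF subr_eq0 => /eqP <-.
  have [n En] : exists n : int, d = n%:~R.
    have [a0' | Ra] := weight_root root_R nzw wa; last first.
      by have [n] := intR a Ra; rewrite wd; exists n.
    by exists 0; rewrite -wd /wt a0' zero_lfunE.
  exists (`|n| ^ 2)%N; rewrite Ec En -rmorphXn /= pmulrn; congr (_%:~R).
  by rewrite -abszX gez0_abs // Num.Theory.sqr_ge0.
have [cs [_ tr_cs csP]] := lfun_eigenvalues (ad z \o ad z)%VF.
have natcs : {in cs, forall c, exists k : nat, c = k%:R}.
  by move=> c /csP[v nzv zv]; apply: eig zv.
have csn0 : has (predC1 0) cs.
  have /andP[nza] : (a0 != 0) && (root_space a0 != 0%VS) by rewrite -root_R.2.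
  rewrite -vpick0 => nzv; set v := vpick _ in nzv.
  have va : v \in root_space a0 by apply: memv_pick.
  apply/hasP; exists (wt a0 z ^+ 2); last by rewrite /= expf_neq0.
  by apply/csP; exists v; rewrite // comp_lfunE !adE !(root_lie va hz, lieZr) scalerA.
rewrite /killing tr_cs.
have [n [-> np]] : exists n, \sum_(c <- cs) c = n%:R :> K /\ has (predC1 0) cs ==> (0 < n)%N.
  elim: (cs) natcs => [|c r IHr] natr; first by exists 0%N; rewrite big_nil.
  have [|n [En np]] := IHr; first by move=> d rd; apply: natr; rewrite inE rd orbT.
  have [k ck] := natr c (mem_head _ _); exists (k + n)%N; rewrite big_cons En ck natrD.
  split=> //=; rewrite pchar0_natr_eq0 //; move: np; case: k {ck} => //= k.
by rewrite pchar0_natr_eq0 // -lt0n; rewrite csn0 in np.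
Qed.

(* [ad z \o ad s] is nilpotent: it maps each step of a flag of [h]-stable subspaces into the
   previous one. *)
Lemma killing_nil z s : z \in h -> s \in h -> {in R, forall a, wt a z = 0} ->
  killing z s = 0.
Proof.
move=> hz hs z0.
have nilz W v d : hstable h W -> v \notin W -> lie z v - d *: v \in W ->
    d = 0.
  move=> stW Wv zv; apply/eqP/negPn/negP => nzd; case/negP: Wv.
  have /subvP/(_ v (memvf v)) : (fullv <= gen_eigen (ad z) 0)%VS.
    apply: (gen_weights charK cartan_h (@hstable_full _ _ h) hz) => a u _ nzu ua.
    have [-> | /z0 //] := weight_root root_R nzu ua.
    by rewrite /wt zero_lfunE.
  rewrite gen_eigen0 memv_ker => /eqP zv0.
  have := @lpow_mod _ _ W (ad z) d v (dim L) (hstable_ad hz stW).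
  rewrite adE zv0 sub0r memvN => /(_ zv).
  by rewrite -{2}[v](scalerK (expf_neq0 (dim L) nzd)); apply: memvZ.
suff nil W : hstable h W -> (exists k, forall v, v \in W -> lpow (ad z \o ad s)%VF k v = 0) ->
    exists k, forall v, lpow (ad z \o ad s)%VF k v = 0.
  have [||k zs0] := nil 0%VS; first exact: hstable0.
    by exists 0%N => v; rewrite memv0 => /eqP->; rewrite linear0.
  have [cs [_ tr_cs csP]] := lfun_eigenvalues (ad z \o ad s)%VF.
  rewrite /killing tr_cs big_seq big1 // => c /csP[v nzv zv].
  apply/eqP; have /eqP := zs0 v; rewrite (lpow_eig k zv) scaler_eq0 (negPf nzv) orbF.
  by rewrite expf_eq0 => /andP[].
have [n] := ubnP (dim L - \dim W)%N; elim: n W => // n IHn W ltn stW [k kP].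
have [WF | nWF] := boolP (fullv <= W)%VS.
  by exists k => v; apply/kP/(subvP WF)/memvf.
have [v [_ Wv vP]] := hstable_common_eigen charK clh nilh stW (@hstable_full _ _ h) (subvf W) nWF.
have [d zv] := vP z hz; have d0 := nilz _ _ _ stW Wv zv.
rewrite d0 scale0r subr0 in zv; have [e sv] := vP s hs.
apply: (IHn (W + <[v]>)%VS).
- have ltW: (\dim W < \dim (W + <[v]>))%N.
    rewrite ltn_neqAle dimvS ?addvSl // andbT.
    rewrite (dimv_leqif_eq (addvSl W <[v]>)).2; apply: contra Wv => /eqP->.
    by rewrite memvE addvSr.
  rewrite -ltnS; apply: leq_trans ltn; rewrite ltnS ltn_sub2l //.
  by apply: leq_trans ltW _; rewrite -dimvf dimvS ?subvf.
- move=> r u hr /memv_addP[w Ww [_ /vlineP[c ->] ->]].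
  rewrite lieDr lieZr; have [d' rv] := vP r hr.
  rewrite -[lie r v](subrK (d' *: v)) scalerDr addrA.
  by rewrite memv_add ?memvD ?memvZ ?stW ?memv_line.
exists k.+1 => u /memv_addP[w Ww [_ /vlineP[c ->] ->]].
rewrite lpowSr kP // linearD linearZ /= !comp_lfunE !adE memvD ?stW // memvZ //.
rewrite -[lie s v](subrK (e *: v)) lieDr lieZr memvD ?memvZ //; exact: stW.
Qed.

Lemma killing_shift z t x n :
  killing z (lpow (ad t) n x) = (-1) ^+ n * killing (lpow (ad t) n z) x.
Proof.
elim: n z x => [|n IHn] z x; first by rewrite !lpow0 mul1r.
rewrite lpowS adE -killing_inv lie_anti -adE killingC linearN /= killingC IHn.
by rewrite -lpowSr exprS mulN1r mulNr.
Qed.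

End CartanKilling.

Section BigSum.

Variables (K : fieldType) (V : vectType K) (I : eqType).
Implicit Types (r : seq I) (G : I -> {vspace V}).

Lemma subv_bigsum r G i : i \in r -> (G i <= \sum_(j <- r) G j)%VS.
Proof.
elim: r => // j r IHr; rewrite inE big_cons => /predU1P[-> | /IHr sub].
  exact: addvSl.
exact: subv_trans sub (addvSr _ _).
Qed.

Lemma bigsum_subv r G W : (forall i, i \in r -> (G i <= W)%VS) ->
  (\sum_(j <- r) G j <= W)%VS.
Proof.
elim: r => [|j r IHr] sub; first by rewrite big_nil sub0v.
rewrite big_cons subv_add sub ?mem_head // IHr // => i ri.
by rewrite sub // inE ri orbT.
Qed.

End BigSum.

(** * sl2-triples and one-dimensional root spaces *)

Section Sl2.

Variables (K : closedFieldType) (L : lieAlgType K) (h : {vspace L}).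
Hypothesis charK : [pchar K] =i pred0.
Hypothesis cartan_h : cartan_subalgebra h.
Variable R : seq 'Dual(subvs_of h).
Hypothesis root_R : root_system R.
Hypothesis nondeg : forall x : L, (forall y, killing x y = 0) -> x = 0.
Implicit Types (x y z s t : L) (U W : {vspace L}) (a b : 'Dual(subvs_of h)).

Let clh : lie_closed h. Proof. by case: cartan_h. Qed.

Lemma root_neq0 a : a \in R -> a != 0.
Proof. by rewrite root_R.2 => /andP[]. Qed.

Lemma exists_regular (F : seq 'Dual(subvs_of h)) :
  exists2 t, t \in h & {in F, forall u, u != 0 -> wt u t != 0}.
Proof.
have [t tF] := avoid_hyperplanes F; exists (vsval t); first exact: subvsP.
by move=> u Fu nzu; rewrite /wt vsvalK tF.
Qed.

(** For regular [t], Fitting's decomposition splits [L] into [h] and the image of a power of [ad t];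
    the latter is orthogonal to [h] by invariance, as [ad t] is nilpotent on [h]. *)
Lemma killing_h_nondeg z : z \in h -> {in h, forall s, killing z s = 0} -> z = 0.
Proof.
move=> hz z0; have [t ht treg] := exists_regular R.
have Gh : gen_eigen (ad t) 0 = h.
  by apply: (gen0_eq_h charK cartan_h root_R) => // a Ra; rewrite treg ?root_neq0.
apply: nondeg => x; have [y [w [yG ->]]] := Fitting (ad t) x.
rewrite linearD /= z0; last by rewrite -Gh gen_eigen0 memv_ker yG.
rewrite killing_shift; have: z \in gen_eigen (ad t) 0 by rewrite Gh.
rewrite gen_eigen0 memv_ker => /eqP->.
by rewrite killingC linear0 mulr0 addr0.
Qed.

Lemma h_weights0 z : z \in h -> {in R, forall a, wt a z = 0} -> z = 0.
Proof.
move=> hz z0; apply: killing_h_nondeg => // s hs.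
exact: killing_nil z0.
Qed.

(** Invariance makes [e] orthogonal to the image of [ad t + wt a t], so by Fitting some vector of
    the complementary generalized eigenspace pairs with [e]. *)
Lemma exists_killing_dual a e t : e != 0 -> e \in root_space a -> t \in h ->
  exists2 y, y \in gen_eigen (ad t) (- wt a t) & killing e y != 0.
Proof.
move=> nze ea ht; have [x ex] : exists x, killing e x != 0.
  have [E | /lfunPn[x]] := eqVneq (killing_map e) 0.
    case/eqP: nze; apply: nondeg => x.
    by rewrite -killing_mapE E zero_lfunE.
  by rewrite killing_mapE zero_lfunE; exists x.
pose f := ad t - (- wt a t) *: \1%VF.
have ef u : killing e (f u) = 0.
  rewrite shiftE linearB linearZ /= adE -killing_inv lie_anti (root_lie ea ht).
  by rewrite killingC linearN linearZ /= killingC scaleNr subrr.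
have [y [w [fy Ex]]] := Fitting f x; exists y; first by rewrite memv_ker fy.
apply: contra ex => /eqP ey; rewrite Ex linearD /= ey add0r.
case L0: (dim L) => [|n]; last by rewrite lpowS ef.
have /eqP F0 : fullv == 0%VS :> {vspace L} by rewrite -dimv_eq0 dimvf L0.
by case/eqP: nze; apply/eqP; rewrite -memv0 -F0 memvf.
Qed.

Lemma killing_bracket a e y s : e \in root_space a -> s \in h ->
  killing (lie e y) s = wt a s * killing e y.
Proof.
move=> ea hs; rewrite killing_inv lie_anti linearN /= -killing_inv lie_anti.
rewrite (root_lie ea hs) killingC linearN linearZ /= opprK.
by rewrite killingC.
Qed.

Lemma exists_wt_neq0 a : a != 0 -> exists2 s, s \in h & wt a s != 0.
Proof.
case/lfunPn => s; rewrite zero_lfunE => nzs; exists (vsval s); first exact: subvsP.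
by rewrite /wt vsvalK.
Qed.

Section OneRoot.

Variables (a : 'Dual(subvs_of h)) (e t : L) (n : nat).
Hypotheses (Ra : a \in R) (ea : e \in root_space a) (nze : e != 0) (ht : t \in h).
Hypothesis treg : {in R, forall b, wt b t != 0}.
Hypothesis tsep : forall b k, b = 0 \/ b \in R -> (k <= n)%N ->
  wt b t = - (k%:R * wt a t) -> b = - (a *+ k).
Hypotheses (n_gt1 : (1 < n)%N) (naR : - (a *+ n) \notin R).

(** Substitute for the root space of [- (a *+ k)]: by [tsep] no other weight occurs in it for
    [k <= n]. The chain ends because [G n] vanishes. *)
Let G k := gen_eigen (ad t) (- (k%:R * wt a t)).

Let G0h : gen_eigen (ad t) 0 = h. Proof. exact: (gen0_eq_h charK cartan_h root_R). Qed.

Lemma wtN_mul b k z : wt (- (b *+ k)) z = - (k%:R * wt b z).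
Proof.
rewrite /wt opp_lfunE; congr (- _); elim: k => [|k IHk].
  by rewrite mulr0n zero_lfunE mul0r.
by rewrite mulrS add_lfunE IHk -natr1 mulrDl mul1r addrC.
Qed.

Let Gweight k b v : (k <= n)%N -> v \in G k -> v != 0 -> v \in root_space b -> b = - (a *+ k).
Proof.
move=> len Gv nzv vb; apply: tsep => //; first exact: (weight_root root_R nzv).
exact: root_gen_eq nzv vb ht Gv.
Qed.

Let stG k : hstable h (G k). Proof. exact: hstable_gen. Qed.

Let mula_neq0 k : (0 < k)%N -> - (a *+ k) != 0.
Proof.
move=> k_gt0; rewrite oppr_eq0 -scaler_nat scaler_eq0 negb_or pchar0_natr_eq0 // -lt0n k_gt0.
exact: root_neq0.
Qed.

Let Gn0 : G n = 0%VS.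
Proof.
apply/eqP/negPn/negP => nzG.
have [b [v [Gv nzv vb]]] := exists_root_vector charK cartan_h (@stG n) nzG.
have Eb := Gweight (leqnn n) Gv nzv vb.
have [b0 | Rb] := weight_root root_R nzv vb; last by case/negP: naR; rewrite -Eb.
by have := mula_neq0 (ltnW n_gt1); rewrite -Eb b0 eqxx.
Qed.

Let eG : e \in gen_eigen (ad t) (wt a t). Proof. exact: root_gen. Qed.

Let lie_eG k x : x \in G k.+1 -> lie e x \in G k.
Proof.
move=> xG; rewrite /G (_ : - _ = wt a t + - (k.+1%:R * wt a t)) ?lie_gen_eigen //.
by rewrite -natr1 mulrDl mul1r opprD addrCA subrr addr0.
Qed.

(** The vector [y] pairs with [e] under the Killing form, and [z = lie e y] acts as a commutator, so
    its trace vanishes on every space stable under [ad e] and [ad y]. Such traces show first that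
    [wt a z] is nonzero, then that [G 1] is the line of [y] and that no further multiple of [- a] is
    a root. *)
Lemma opposite_root : exists y, [/\ y \in root_space (- a), lie e y \in h, wt a (lie e y) != 0,
  root_space (- a) = <[y]>%VS & forall k, (1 < k < n)%N -> - (a *+ k) \notin R].
Proof.
have [y yG1 ey] := exists_killing_dual nze ea ht.
have {}yG1 : y \in G 1 by rewrite /G mul1r.
pose z := lie e y; have lie_y1 x : x \in G 1 -> lie e x \in h.
  by move/lie_eG; rewrite /G mul0r oppr0 G0h.
have hz : z \in h by apply: lie_y1.
have lie_yG k x : x \in G k -> lie y x \in G k.+1.
  move=> xG; rewrite /G (_ : - _ = - (1 * wt a t) + - (k%:R * wt a t)) ?lie_gen_eigen //.
  by rewrite -natr1 mulrDl opprD addrC.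
have Gz k : (k <= n)%N -> (G k <= gen_eigen (ad z) (- (k%:R * wt a z)))%VS.
  move=> len; apply: (gen_weights charK cartan_h) => // b v Gv nzv vb.
  by rewrite (Gweight len Gv nzv vb) wtN_mul.
have zv x : lie e (lie y x) - lie y (lie e x) = lie z x by rewrite -lie_liel.
have nzaz : wt a z != 0.
  apply/negP => /eqP az0.
  (* If [a] vanishes at [z], both [ad e] and [ad y] preserve each generalized eigenspace of [ad z];
     the trace forces [wt b z] to be 0 for every root [b], whence [z] is 0. *)
  have ze : e \in gen_eigen (ad z) 0.
    by rewrite -az0; apply: root_gen.
  have zy : y \in gen_eigen (ad z) 0.
    have := subvP (Gz 1 (ltnW n_gt1)) y yG1.
    by rewrite az0 mulr0 oppr0.
  have z0 b : b \in R -> wt b z = 0.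
    move=> Rb; apply/eqP/negPn/negP => nzb.
    have /andP[_] : (b != 0) && (root_space b != 0%VS) by rewrite -root_R.2.
    rewrite -vpick0 => nzv; set v := vpick _ in nzv.
    have vb : v \in root_space b by apply: memv_pick.
    case/eqP: (nzv); apply/eqP; rewrite -memv0.
    have <- : gen_eigen (ad z) (wt b z) = 0%VS; last exact: root_gen.
    apply: (@stable_trace _ _ charK _ (ad e) (ad y) (wt b z)) => //.
    - by move=> x xG; rewrite adE -[wt b z]add0r lie_gen_eigen.
    - by move=> x xG; rewrite adE -[wt b z]add0r lie_gen_eigen.
    move=> c x xG nzx; rewrite !adE zv => zx; exists 1%N; rewrite // mul1r.
    by apply: gen_eigen_eigen nzx xG _; rewrite // adE.
  have [s hs nzs] := exists_wt_neq0 (root_neq0 Ra).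
  have := killing_bracket y ea hs; rewrite -/z (h_weights0 hz z0) killingC linear0.
  by move/esym/eqP; rewrite mulf_eq0 (negPf nzs) (negPf ey).
(* The part of [G 1] orthogonal to [e] is killed by [ad e], by nondegeneracy on [h]; without this
   cut [ad e] would lead from [G 1] into [h]. *)
pose U0 := (G 1 :&: lker (killing_map e))%VS.
have U0P x : (x \in U0) = (x \in G 1) && (killing e x == 0).
  by rewrite memv_cap memv_ker killing_mapE.
(* [M] is stable under [ad e] and [ad y], and all eigenvalues of [ad [e, y]] on it are negative
   multiples of [wt a z]: its trace being 0, [M] vanishes. *)
pose M := (U0 + \sum_(k <- index_iota 2 n) G k)%VS.
have U0M : (U0 <= M)%VS by apply: addvSl.
have GM k : (1 < k <= n)%N -> (G k <= M)%VS.
  case/andP=> k1; rewrite leq_eqVlt => /predU1P[-> | kn]; first by rewrite Gn0 sub0v.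
  apply: subv_trans (addvSr _ _); apply: (@subv_bigsum _ _ _ _ G).
  by rewrite mem_index_iota k1.
have eU0 x : x \in U0 -> lie e x = 0.
  rewrite U0P => /andP[xG /eqP ex]; apply: killing_h_nondeg; first exact: lie_y1.
  by move=> s hs; rewrite (killing_bracket _ ea hs) ex mulr0.
have M0 : M = 0%VS.
  apply: (@stable_trace _ _ charK M (ad e) (ad y) (- wt a z)); last 1 first.
  - move=> c v Mv nzv; rewrite !adE zv -adE => zc.
    have sM : (M <= \sum_(k <- index_iota 1 n) gen_eigen (ad z) (- (k%:R * wt a z)))%VS.
      rewrite subv_add; apply/andP; split.
        apply: subv_trans (capvSl _ _) _; apply: subv_trans (Gz 1 (ltnW n_gt1)) _.
        apply: (@subv_bigsum _ _ _ _ (fun k => gen_eigen (ad z) (- (k%:R * wt a z)))).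
        by rewrite mem_index_iota /=.
      apply: bigsum_subv => k; rewrite mem_index_iota => /andP[k2 kn].
      apply: subv_trans (Gz k (ltnW kn)) _.
      apply: (@subv_bigsum _ _ _ _ (fun k => gen_eigen (ad z) (- (k%:R * wt a z)))).
      by rewrite mem_index_iota kn ltnW.
    have [k] := gen_eigen_sum nzv zc (subvP sM v Mv).
    by rewrite mem_index_iota => /andP[k1 _] ->; exists k; rewrite // mulrN.
  - suff: (M <= ad e @^-1: M)%VS by move/subvP=> sM v /sM; rewrite -memv_preim.
    rewrite subv_add; apply/andP; split.
      by apply/subvP => x xU; rewrite -memv_preim adE eU0 ?mem0v.
    apply: bigsum_subv => k; rewrite mem_index_iota => /andP[k2 kn].
    apply/subvP => x xG; rewrite -memv_preim adE.
    case: k k2 kn xG => // k; rewrite ltnS leq_eqVlt => /predU1P[<- | k1] kn /lie_eG exG.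
      by apply: (subvP U0M); rewrite U0P exG -killing_inv liexx killingC linear0 eqxx.
    by apply: subvP exG; apply: GM; rewrite k1 ltnW // ltnW.
  - suff: (M <= ad y @^-1: M)%VS by move/subvP=> sM v /sM; rewrite -memv_preim.
    rewrite subv_add; apply/andP; split.
      apply/subvP => x; rewrite U0P => /andP[/lie_yG yx _]; rewrite -memv_preim adE.
      by apply: subvP yx; apply: GM; rewrite n_gt1.
    apply: bigsum_subv => k; rewrite mem_index_iota => /andP[k2 kn].
    apply/subvP => x /lie_yG xG; rewrite -memv_preim adE.
    by apply: subvP xG; apply: GM; rewrite kn ltnS ltnW.
  - by rewrite oppr_eq0.
have G1y : G 1 = <[y]>%VS.
  apply/eqP; rewrite eqEsubv -memvE yG1 andbT; apply/subvP => x xG.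
  have: x - (killing e x / killing e y) *: y \in U0.
    rewrite U0P memvB ?memvZ //= linearB linearZ /= subr_eq0.
    by rewrite -[_ *: _]/(_ * _) mulfVK.
  move/(subvP U0M); rewrite M0 memv0 subr_eq0 => /eqP->.
  by rewrite memvZ ?memv_line.
have nzy : y != 0 by apply: contra ey => /eqP->; rewrite linear0.
have [|b [v [Gv nzv vb]]] := exists_root_vector charK cartan_h (@stG 1).
  by rewrite G1y; apply: contra nzy => /eqP E; rewrite -memv0 -E memv_line.
have Eb : b = - a by rewrite (Gweight (ltnW n_gt1) Gv nzv vb).
have ya : y \in root_space (- a).
  rewrite -Eb; move: Gv nzv; rewrite G1y => /vlineP[c Ev]; rewrite Ev scaler_eq0 negb_or.
  by case/andP=> nzc _; rewrite -[y](scalerK nzc) memvZ // -Ev.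
exists y; split=> //.
  apply/eqP; rewrite eqEsubv -memvE ya andbT -G1y; apply/subvP => x xa.
  have := root_gen xa ht; rewrite (_ : wt (- a) t = - (1%:R * wt a t)) //.
  by rewrite -wtN_mul.
move=> k /andP[k1 kn]; apply/negP => Rk.
have /andP[_] : (- (a *+ k) != 0) && (root_space (- (a *+ k)) != 0%VS) by rewrite -root_R.2.
rewrite -subv0; case/negP; apply/subvP => x xa; rewrite -M0.
have kle : (1 < k <= n)%N by rewrite k1 ltnW.
apply: (subvP (GM k kle)).
by have := root_gen xa ht; rewrite wtN_mul.
Qed.

End OneRoot.

Lemma root_sl2 a e m : a \in R -> e \in root_space a -> e != 0 ->
  exists f, [/\ f \in root_space (- a), lie e f \in h, wt a (lie e f) = 2%:R,
    root_space (- a) = <[f]>%VS & forall k, (1 < k < m)%N -> - (a *+ k) \notin R].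
Proof.
move=> Ra ea nze.
(* Pigeonhole: [(size R).+1] distinct multiples cannot all be roots. *)
have [n nm naR] : exists2 n, (maxn 2 m <= n)%N & - (a *+ n) \notin R.
  pose s := [seq - (a *+ k) | k <- iota (maxn 2 m) (size R).+1].
  have us : uniq s.
    rewrite map_inj_in_uniq ?iota_uniq // => i j _ _ /oppr_inj /eqP.
    rewrite -!scaler_nat -subr_eq0 -scalerBl scaler_eq0 (negPf (root_neq0 Ra)) orbF subr_eq0.
    by move/eqP/(pchar0_natr_inj charK).
  have [/allP sR | /allPn[_ /mapP[k] + ->]] := boolP (all (mem R) s).
    by have := uniq_leq_size us sR; rewrite size_map size_iota ltnn.
  by rewrite mem_iota => /andP[km _] kR; exists k.
(* Regularity on [F] means nonvanishing on the roots and separation of every weight from the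
   multiples of [- a] up to [n]. *)
pose F := R ++ [seq b + a *+ k | b <- 0 :: R, k <- iota 0 n.+1].
have [t ht tF] := exists_regular F.
have [||||y [ya hz nzaz Ey kR]] := @opposite_root a e t n Ra ea nze ht.
- by move=> b Rb; apply: tF; rewrite ?root_neq0 // mem_cat Rb.
- move=> b k Rb kn /eqP Ebt; apply/eqP; rewrite -addr_eq0; apply/negPn/negP => nz.
  have := tF (b + a *+ k); rewrite nz mem_cat => /(_ _ isT).
  have ->: wt (b + a *+ k) t = wt b t + k%:R * wt a t.
    rewrite /wt add_lfunE; congr (_ + _).
    by have := wtN_mul a k t; rewrite /wt opp_lfunE => /oppr_inj.
  rewrite (eqP Ebt) addNr eqxx => E.
  suff: false by []. apply: E; apply/orP; right; apply/allpairsP; exists (b, k).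
  rewrite mem_iota ltnS kn; split=> //; rewrite inE.
  by case: Rb => [-> | ->]; rewrite ?eqxx ?orbT.
- by apply: leq_trans nm; rewrite leq_maxl.
- by [].
exists ((2%:R / wt a (lie e y)) *: y); split.
- by rewrite memvZ.
- by rewrite lieZr memvZ.
- by rewrite lieZr wtZ mulfVK.
- rewrite Ey; apply/eqP; rewrite eqEsubv -!memvE memvZ ?memv_line // andbT.
  have nz2 : 2%:R / wt a (lie e y) != 0.
    by rewrite mulf_neq0 ?invr_eq0 // pchar0_natr_eq0.
  by rewrite -{1}[y](scalerK nz2) memvZ ?memv_line.
move=> k /andP[k1 km]; apply: kR; rewrite k1.
by apply: leq_trans km (leq_trans (leq_maxr 2 m) nm).
Qed.

End Sl2.

(** * Roots of D4 *)

Section D4.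

Variables (K : closedFieldType) (L : lieAlgType K) (h : {vspace L}).
Hypothesis charK : [pchar K] =i pred0.
Variables (R : seq 'Dual(subvs_of h)) (Pi : 4.-tuple 'Dual(subvs_of h)).
Hypothesis simple_L : simple_lie L.
Hypothesis cartan_h : cartan_subalgebra h.
Hypothesis root_R : root_system R.
Hypothesis base_Pi : root_base R Pi.
Hypothesis typeD4 : has_cartan_matrix R Pi cartan_D4.
Implicit Types (x y z s t : L) (a b : 'Dual(subvs_of h)).

Definition simple_comb (w0 w1 w2 w3 : int) : 'Dual(subvs_of h) :=
  Pi`_0 *~ w0 + Pi`_1 *~ w1 + Pi`_2 *~ w2 + Pi`_3 *~ w3.

Lemma coroots : exists t : nat -> L, forall i, (i < 4)%N -> [/\ t i \in h,
  forall j, (j < 4)%N -> wt Pi`_j (t i) = (cartan_D4 i j)%:~R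
  & {in R, forall b, b - wt b (t i) *: Pi`_i \in R}].
Proof.
have [t tP] := typeD4; exists (fun i => vsval (t i)) => i i4.
rewrite -[4%N](size_tuple Pi) in i4; have [[_ refl] tj] := tP i i4.
split; first exact: subvsP.
  by move=> j j4; rewrite /wt vsvalK tj // size_tuple.
by move=> b Rb; rewrite /wt vsvalK refl.
Qed.

Lemma wt_simple_comb w0 w1 w2 w3 z : wt (simple_comb w0 w1 w2 w3) z =
  w0%:~R * wt Pi`_0 z + w1%:~R * wt Pi`_1 z + w2%:~R * wt Pi`_2 z + w3%:~R * wt Pi`_3 z.
Proof.
have E a (n : int) : wt (a *~ n) z = n%:~R * wt a z.
  by rewrite /wt -scaler_int scale_lfunE.
by rewrite -!E /wt !add_lfunE.
Qed.

Lemma pchar0_intr_eq0 (n : int) : ((n%:~R : K) == 0) = (n == 0).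
Proof.
by case: n => n; rewrite ?NegzE ?rmorphN /= ?oppr_eq0 -?pmulrn pchar0_natr_eq0.
Qed.

Lemma pchar0_intr_inj (m n : int) : m%:~R = n%:~R :> K -> m = n.
Proof.
move/eqP; rewrite -subr_eq0 -rmorphB /= pchar0_intr_eq0 subr_eq0.
by move/eqP.
Qed.

(* The coweight dual to a simple root, from the inverse of the Cartan matrix of D4. *)
Lemma coweights : exists u : nat -> L, forall i, (i < 4)%N -> u i \in h /\
  forall j, (j < 4)%N -> wt Pi`_j (u i) = (j == i)%:R.
Proof.
have [t tP] := coroots.
have n2 : (2%:R : K) != 0 by rewrite pchar0_natr_eq0.
have [h0 w0 _] := tP 0%N isT; have [h1 w1 _] := tP 1%N isT.
have [h2 w2 _] := tP 2%N isT; have [h3 w3 _] := tP 3%N isT.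
pose t0 := t 0%N; pose t1 := t 1%N; pose t2 := t 2%N; pose t3 := t 3%N.
exists (fun i => nth 0 [:: t0 + t1 + 2%:R^-1 *: t2 + 2%:R^-1 *: t3;
  t0 + 2%:R *: t1 + t2 + t3; 2%:R^-1 *: t0 + t1 + t2 + 2%:R^-1 *: t3;
  2%:R^-1 *: t0 + t1 + 2%:R^-1 *: t2 + t3] i).
move=> i i4; split.
  by case: i i4 => [|[|[|[|//]]]] _; rewrite !memvD ?memvZ.
move=> j j4; case: i i4 => [|[|[|[|//]]]] _; case: j j4 => [|[|[|[|//]]]] _;
  by rewrite !wtD ?wtZ ?w0 ?w1 ?w2 ?w3 //= /cartan_D4 /=; field.
Qed.

Lemma simple_comb_eq0 w0 w1 w2 w3 : simple_comb w0 w1 w2 w3 = 0 -> [/\ w0 = 0, w1 = 0, w2 = 0 & w3 = 0].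
Proof.
move=> E; have [u uP] := coweights.
have W i : (i < 4)%N -> wt (simple_comb w0 w1 w2 w3) (u i) = 0 by rewrite E /wt zero_lfunE.
have U i j (i4 : (i < 4)%N) (j4 : (j < 4)%N) := (uP i i4).2 j j4.
split; apply: pchar0_intr_inj.
- by have := W 0%N isT; rewrite wt_simple_comb !U //= !mulr0 mulr1 !addr0.
- by have := W 1%N isT; rewrite wt_simple_comb !U //= !mulr0 mulr1 !addr0 add0r.
- by have := W 2%N isT; rewrite wt_simple_comb !U //= !mulr0 mulr1 !addr0 !add0r.
by have := W 3%N isT; rewrite wt_simple_comb !U //= !mulr0 mulr1 !add0r.
Qed.

Lemma simple_combD v0 v1 v2 v3 w0 w1 w2 w3 :
  simple_comb v0 v1 v2 v3 + simple_comb w0 w1 w2 w3 = simple_comb (v0 + w0) (v1 + w1) (v2 + w2) (v3 + w3).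
Proof. by rewrite /simple_comb !mulrzDr addrACA; congr (_ + _); rewrite addrACA; congr (_ + _); rewrite addrACA. Qed.

Lemma simple_combN w0 w1 w2 w3 : - simple_comb w0 w1 w2 w3 = simple_comb (- w0) (- w1) (- w2) (- w3).
Proof. by rewrite /simple_comb !mulrNz !opprD. Qed.

Lemma nat_combE b : nat_comb Pi b <-> exists n0 n1 n2 n3 : nat, b = simple_comb n0 n1 n2 n3.
Proof.
rewrite /nat_comb size_tuple; split=> [[n ->] | [n0 [n1 [n2 [n3 ->]]]]].
  exists (n 0%N), (n 1%N), (n 2%N), (n 3%N).
  by rewrite !big_ord_recr big_ord0 /= add0r /simple_comb !pmulrn.
exists (fun i => nth 0%N [:: n0; n1; n2; n3] i).
by rewrite !big_ord_recr big_ord0 /= add0r /simple_comb !pmulrn.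
Qed.

Lemma root_simple_comb b : b \in R -> exists w0 w1 w2 w3, b = simple_comb w0 w1 w2 w3.
Proof.
have [_ _ sgn] := base_Pi; case/sgn => /nat_combE[n0 [n1 [n2 [n3 E]]]].
  by exists n0, n1, n2, n3.
by exists (- n0%:Z), (- n1%:Z), (- n2%:Z), (- n3%:Z); rewrite -simple_combN -E opprK.
Qed.

Lemma root_coefs_sign w0 w1 w2 w3 : simple_comb w0 w1 w2 w3 \in R ->
  [/\ 0 <= w0, 0 <= w1, 0 <= w2 & 0 <= w3] \/ [/\ w0 <= 0, w1 <= 0, w2 <= 0 & w3 <= 0].
Proof.
have [_ _ sgn] := base_Pi; case/sgn => /nat_combE[n0 [n1 [n2 [n3 E]]]]; [left | right].
  have: simple_comb (w0 - n0%:Z) (w1 - n1%:Z) (w2 - n2%:Z) (w3 - n3%:Z) = 0 by rewrite -simple_combD -simple_combN E subrr.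
  by case/simple_comb_eq0; split; lia.
have: simple_comb (w0 + n0%:Z) (w1 + n1%:Z) (w2 + n2%:Z) (w3 + n3%:Z) = 0 by rewrite -simple_combD -E subrr.
by case/simple_comb_eq0; split; lia.
Qed.

Lemma Pi_simple_comb i : (i < 4)%N -> Pi`_i = simple_comb (i == 0)%N (i == 1)%N (i == 2)%N (i == 3)%N.
Proof.
by case: i => [|[|[|[|//]]]] _; rewrite /simple_comb /= ?mulr0z ?mulr1z ?add0r ?addr0.
Qed.

Lemma refl_simple_comb w0 w1 w2 w3 : simple_comb w0 w1 w2 w3 \in R ->
  [/\ simple_comb (w1 - w0) w1 w2 w3 \in R, simple_comb w0 (w0 + w2 + w3 - w1) w2 w3 \in R,
      simple_comb w0 w1 (w1 - w2) w3 \in R & simple_comb w0 w1 w2 (w1 - w3) \in R].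
Proof.
move=> Rw; have [t tP] := coroots.
have [_ p0 r0] := tP 0%N isT; have [_ p1 r1] := tP 1%N isT.
have [_ p2 r2] := tP 2%N isT; have [_ p3 r3] := tP 3%N isT.
have E i c : (i < 4)%N -> wt (simple_comb w0 w1 w2 w3) (t i) = c%:~R ->
  simple_comb w0 w1 w2 w3 - wt (simple_comb w0 w1 w2 w3) (t i) *: Pi`_i =
  simple_comb (w0 - c * (i == 0)%N%:Z) (w1 - c * (i == 1)%N%:Z) (w2 - c * (i == 2)%N%:Z) (w3 - c * (i == 3)%N%:Z).
  move=> i4 ->; rewrite Pi_simple_comb // scaler_int.
  have -> : simple_comb (i == 0)%N (i == 1)%N (i == 2)%N (i == 3)%N *~ c =
    simple_comb (c * (i == 0)%N%:Z) (c * (i == 1)%N%:Z) (c * (i == 2)%N%:Z) (c * (i == 3)%N%:Z).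
    by rewrite /simple_comb !mulrzDl -!mulrzA ![c * _]mulrC.
  by rewrite simple_combN simple_combD.
split.
- have := r0 _ Rw; rewrite (E 0%N (2 * w0 - w1)) //=.
    by congr (simple_comb _ _ _ _ \in R); lia.
  by rewrite wt_simple_comb !p0 // /cartan_D4 /=; ring.
- have := r1 _ Rw; rewrite (E 1%N (2 * w1 - w0 - w2 - w3)) //=.
    by congr (simple_comb _ _ _ _ \in R); lia.
  by rewrite wt_simple_comb !p1 // /cartan_D4 /=; ring.
- have := r2 _ Rw; rewrite (E 2%N (2 * w2 - w1)) //=.
    by congr (simple_comb _ _ _ _ \in R); lia.
  by rewrite wt_simple_comb !p2 // /cartan_D4 /=; ring.
have := r3 _ Rw; rewrite (E 3%N (2 * w3 - w1)) //=.
  by congr (simple_comb _ _ _ _ \in R); lia.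
by rewrite wt_simple_comb !p3 // /cartan_D4 /=; ring.
Qed.

Lemma simple_root i : (i < 4)%N -> Pi`_i \in R.
Proof.
by move=> i4; have [sPi _ _] := base_Pi; rewrite sPi // mem_nth // size_tuple.
Qed.

Lemma nondegL x : (forall y, killing x y = 0) -> x = 0.
Proof.
move=> x0; apply: (killing_nondeg simple_L _ x0).
have [t tP] := coroots; have [ht pt _] := tP 0%N isT; exists (t 0%N), (t 0%N).
apply: (killing_integral charK cartan_h root_R ht).
  move=> b /root_simple_comb[w0 [w1 [w2 [w3 ->]]]]; rewrite wt_simple_comb !pt // /cartan_D4 /=.
  exists (2 * w0 - w1); ring.
exists Pi`_0; first exact: simple_root.
by rewrite pt // /cartan_D4 /= pchar0_natr_eq0.
Qed.

Lemma root_vector a : a \in R -> exists2 e, e != 0 & e \in root_space a.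
Proof.
rewrite root_R.2 => /andP[_]; rewrite -vpick0 => nz.
by exists (vpick (root_space a)); rewrite ?memv_pick.
Qed.

Lemma root_spaceN0 a v : v \in root_space a -> v != 0 -> a != 0 -> a \in R.
Proof. by move=> va nzv nza; have [/eqP|//] := weight_root root_R nzv va; rewrite (negPf nza). Qed.

Lemma opp_root a : a \in R -> - a \in R.
Proof.
move=> Ra; have [e nze ea] := root_vector Ra.
have [f [fa _ ef _ _]] := root_sl2 charK cartan_h root_R nondegL 0 Ra ea nze.
have nzf : f != 0.
  apply: contra_eq_neq ef => ->; rewrite lie0r /wt linear0 linear0 eq_sym.
  by rewrite pchar0_natr_eq0.
by apply: root_spaceN0 fa nzf _; rewrite oppr_eq0 (root_neq0 root_R).
Qed.

(** [root_sl2] makes the space of the opposite root a line, so it is applied to [- a]. *)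
Lemma root_line a v x : a \in R -> v \in root_space a -> v != 0 -> x \in root_space a ->
  exists c, x = c *: v.
Proof.
move=> Ra va nzv xa; have Ra' := opp_root Ra; have [e nze ea] := root_vector Ra'.
have [f [_ _ _ + _]] := root_sl2 charK cartan_h root_R nondegL 0 Ra' ea nze.
rewrite opprK => E; rewrite E in va xa.
have [c Ec] := vlineP _ _ va; have [d Ed] := vlineP _ _ xa; exists (d / c).
have nzc : c != 0 by apply: contraNneq nzv => c0; rewrite Ec c0 scale0r.
by rewrite Ec Ed scalerA divfK.
Qed.

Lemma mul_notin_root a k : a \in R -> (1 < k)%N -> a *+ k \notin R.
Proof.
move=> Ra k1; have Ra' := opp_root Ra; have [e nze ea] := root_vector Ra'.
have [f [_ _ _ _ /(_ k)]] := root_sl2 charK cartan_h root_R nondegL k.+1 Ra' ea nze.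
by rewrite k1 ltnS leqnn mulNrn opprK => /(_ isT).
Qed.

(** The twelve positive roots: the three outer simple roots, eight with central coefficient 1, and
    the highest root with central coefficient 2. *)
Definition D4_positive (w0 w1 w2 w3 : int) : bool :=
  [&& (0 <= w0 <= 1)%R, (0 <= w2 <= 1)%R, (0 <= w3 <= 1)%R &
    ((w1 == 0) && (w0 + w2 + w3 == 1)) || (w1 == 1) || ((w1 == 2) && (w0 + w2 + w3 == 3))].

(* Descent: some simple root has a positive Cartan number with the root, the form of D4 being
   positive definite, and reflecting in it lowers the height. *)
Lemma root_coefs_positive w0 w1 w2 w3 : simple_comb w0 w1 w2 w3 \in R ->
  [/\ 0 <= w0, 0 <= w1, 0 <= w2 & 0 <= w3] -> D4_positive w0 w1 w2 w3.
Proof.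
have [n] : exists n : nat, (w0 + w1 + w2 + w3 < n%:Z)%R.
  by exists `|(w0 + w1 + w2 + w3)%R|.+1%N; lia.
elim: n w0 w1 w2 w3 => [|n IHn] w0 w1 w2 w3 ltn Rw [p0 p1 p2 p3]; first by lia.
have nz : ~~ [&& w0 == 0, w1 == 0, w2 == 0 & w3 == 0].
  apply/and4P => -[/eqP E0 /eqP E1 /eqP E2 /eqP E3]; have := root_neq0 root_R Rw.
  by rewrite E0 E1 E2 E3 /simple_comb !mulr0z !addr0 eqxx.
have multi i w : (i < 4)%N -> (0 <= w)%R -> Pi`_i *~ w \in R -> w = 1.
  move=> i4; case: w => // k _; rewrite -pmulrn => Rk.
  case: k Rk => [|[|k]] //; first by rewrite mulr0n => /(root_neq0 root_R); rewrite eqxx.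
  by rewrite (negPf (mul_notin_root (simple_root i4) _)).
have [R0 R1 R2 R3] := refl_simple_comb Rw.
have [c|nc0] : (0 < 2 * w0 - w1 \/ 2 * w0 - w1 <= 0)%R by lia.
  have [[q0 q1 q2 q3] | [q0 q1 q2 q3]] := root_coefs_sign R0.
    have ltn' : (w1 - w0 + w1 + w2 + w3 < n%:Z)%R by lia.
    by have := IHn _ _ _ _ ltn' R0 (And4 q0 q1 q2 q3); rewrite /D4_positive; lia.
  (* The reflection changes one coefficient only; if the result is negative, the others vanish and
     the root is a multiple of a simple root. *)
  have [E1 E2 E3] : [/\ w1 = 0, w2 = 0 & w3 = 0] by split; lia.
  move: Rw; rewrite E1 E2 E3 /simple_comb !mulr0z !addr0 => /multi -> //.
have [c|nc1] : (0 < 2 * w1 - w0 - w2 - w3 \/ 2 * w1 - w0 - w2 - w3 <= 0)%R by lia.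
  have [[q0 q1 q2 q3] | [q0 q1 q2 q3]] := root_coefs_sign R1.
    have ltn' : (w0 + (w0 + w2 + w3 - w1) + w2 + w3 < n%:Z)%R by lia.
    by have := IHn _ _ _ _ ltn' R1 (And4 q0 q1 q2 q3); rewrite /D4_positive; lia.
  have [E1 E2 E3] : [/\ w0 = 0, w2 = 0 & w3 = 0] by split; lia.
  move: Rw; rewrite E1 E2 E3 /simple_comb !mulr0z !addr0 add0r => /multi -> //.
have [c|nc2] : (0 < 2 * w2 - w1 \/ 2 * w2 - w1 <= 0)%R by lia.
  have [[q0 q1 q2 q3] | [q0 q1 q2 q3]] := root_coefs_sign R2.
    have ltn' : (w0 + w1 + (w1 - w2) + w3 < n%:Z)%R by lia.
    by have := IHn _ _ _ _ ltn' R2 (And4 q0 q1 q2 q3); rewrite /D4_positive; lia.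
  have [E1 E2 E3] : [/\ w0 = 0, w1 = 0 & w3 = 0] by split; lia.
  move: Rw; rewrite E1 E2 E3 /simple_comb !mulr0z !addr0 !add0r => /multi -> //.
have [c|nc3] : (0 < 2 * w3 - w1 \/ 2 * w3 - w1 <= 0)%R by lia.
  have [[q0 q1 q2 q3] | [q0 q1 q2 q3]] := root_coefs_sign R3.
    have ltn' : (w0 + w1 + w2 + (w1 - w3) < n%:Z)%R by lia.
    by have := IHn _ _ _ _ ltn' R3 (And4 q0 q1 q2 q3); rewrite /D4_positive; lia.
  have [E1 E2 E3] : [/\ w0 = 0, w1 = 0 & w2 = 0] by split; lia.
  move: Rw; rewrite E1 E2 E3 /simple_comb !mulr0z !add0r => /multi -> //.
by lia.
Qed.

End D4.

(** * Polynomial functions and algebraic groups *)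

Lemma mpoly_ring_ind (R : comNzRingType) n (Q : {mpoly R[n]} -> Prop) :
  (forall c, Q c%:MP) -> (forall i, Q 'X_i) ->
  (forall p q, Q p -> Q q -> Q (p + q)) -> (forall p q, Q p -> Q q -> Q (p * q)) ->
  forall p, Q p.
Proof.
move=> QC QX QD QM p; rewrite (mpolyE p).
elim/big_ind: _ => [||m _]; [by rewrite -mpolyC0; apply: QC | exact: QD |].
rewrite -mul_mpolyC; apply: (QM) => //; rewrite mpolyXE_id.
elim/big_ind: _ => [||i _]; [by rewrite -mpolyC1; apply: QC | exact: QM |].
by elim: (m i) => [|k IHk]; rewrite ?expr0 -?mpolyC1 // exprS; apply: QM.
Qed.

Section Curves.

Variables (K : closedFieldType) (n : nat).
Implicit Types (P : {mpoly K[n]}) (c : 'I_n -> {poly K}).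

Definition mpoly_curve P c : {poly K} := mmap (@polyC K) c P.

Lemma mpoly_curveC a c : mpoly_curve a%:MP c = a%:P.
Proof. exact: mmapC. Qed.

Lemma mpoly_curveX i c : mpoly_curve 'X_i c = c i.
Proof. by rewrite /mpoly_curve mmapX mmap1U. Qed.

Lemma mpoly_curveD P Q c : mpoly_curve (P + Q) c = mpoly_curve P c + mpoly_curve Q c.
Proof. exact: mmapD. Qed.

Lemma mpoly_curveM P Q c : mpoly_curve (P * Q) c = mpoly_curve P c * mpoly_curve Q c.
Proof. exact: rmorphM. Qed.

Lemma horner_mpoly_curve P c s :
  (mpoly_curve P c).[s] = P.@[fun i => (c i).[s]].
Proof.
elim/mpoly_ring_ind: P => [a|i|p q IHp IHq|p q IHp IHq].
- by rewrite mpoly_curveC hornerC mevalC.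
- by rewrite mpoly_curveX mevalXU.
- by rewrite mpoly_curveD hornerD IHp IHq mevalD.
by rewrite mpoly_curveM hornerM IHp IHq mevalM.
Qed.

Lemma deriv_mpoly_curve P c :
  (mpoly_curve P c)^`() = \sum_i mpoly_curve P^`M(i) c * (c i)^`().
Proof.
elim/mpoly_ring_ind: P => [a|j|p q IHp IHq|p q IHp IHq].
- rewrite mpoly_curveC derivC big1 // => i _.
  by rewrite mderivC -mpolyC0 mpoly_curveC mul0r.
- rewrite mpoly_curveX (bigD1 j) //= big1 ?addr0 => [|i nij].
    have ->: ('X_j : {mpoly K[n]})^`M(j) = 1%:MP.
      rewrite mderivX mnm1E eqxx scale1r mpolyC1 -mpolyX0; congr mpolyX.
      by apply/mnmP => l; rewrite mnmBE mnm0E subnn.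
    rewrite mpoly_curveC.
    by rewrite mul1r.
  rewrite mderivX mnm1E eq_sym (negPf nij) scale0r -mpolyC0 mpoly_curveC.
  by rewrite mul0r.
- rewrite mpoly_curveD derivD IHp IHq -big_split; apply: eq_bigr => i _.
  by rewrite mderivD mpoly_curveD mulrDl.
rewrite mpoly_curveM derivM IHp IHq mulr_suml mulr_sumr -big_split.
apply: eq_bigr => i _; rewrite mderivM mpoly_curveD !mpoly_curveM /=; ring.
Qed.

Lemma poly_eq0P (p : {poly K}) : (forall s, p.[s] = 0) -> p = 0.
Proof.
move=> p0; apply/eqP/negPn/negP => /closed_nonrootP[s].
by rewrite /root p0 eqxx.
Qed.

End Curves.

Section PolynomialFunctions.

Variables (K : closedFieldType) (V : vectType K).
Implicit Types (v w : V).

Lemma coordsD v w i : coords (v + w) i = coords v i + coords w i.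
Proof. by rewrite /coords linearD. Qed.

Lemma coordsZ a v i : coords (a *: v) i = a * coords v i.
Proof. by rewrite /coords linearZ. Qed.

Lemma coords_sum (I : Type) (r : seq I) (F : I -> V) i :
  coords (\sum_(j <- r) F j) i = \sum_(j <- r) coords (F j) i.
Proof. by rewrite /coords linear_sum. Qed.

(** Turns the differential in [lie_of_group] into the derivative at 0 of a one-variable polynomial.
    The length [n.+2] guarantees a constant and a linear term. *)
Lemma vector_curve n (c : nat -> V) (P : {mpoly K[\dim {:V}]}) :
  exists p : {poly K}, (forall s, p.[s] = P.@[coords (\sum_(k < n.+2) s ^+ k *: c k)]) /\
    p^`().[0] = mdiff P (c 0%N) (c 1%N).
Proof.
pose g i := \poly_(k < n.+2) coords (c k) i.
have gE s i : (g i).[s] = coords (\sum_(k < n.+2) s ^+ k *: c k) i.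
  rewrite horner_poly coords_sum; apply: eq_bigr => k _.
  by rewrite coordsZ mulrC.
exists (mpoly_curve P g); split=> [s|].
  by rewrite horner_mpoly_curve; apply: meval_eq => i; rewrite gE.
rewrite deriv_mpoly_curve horner_sum; apply: eq_bigr => i _.
rewrite hornerM horner_mpoly_curve; congr (_ * _); last first.
  by rewrite horner_coef0 coef_deriv coef_poly mulr1n.
apply: meval_eq => j; rewrite horner_coef0 coef_poly.
by [].
Qed.

(** Hides the chosen coordinates, so that equations can be written in terms of vectors and maps. *)
Definition polyfun (F : V -> K) := exists P : {mpoly K[\dim {:V}]},
  forall v, F v = P.@[coords v].

Lemma polyfun_cst a : polyfun (fun=> a).
Proof. by exists a%:MP => v; rewrite mevalC. Qed.

Lemma polyfunD F G : polyfun F -> polyfun G -> polyfun (fun v => F v + G v).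
Proof. by move=> [P FP] [Q GQ]; exists (P + Q) => v; rewrite mevalD FP GQ. Qed.

Lemma polyfunM F G : polyfun F -> polyfun G -> polyfun (fun v => F v * G v).
Proof. by move=> [P FP] [Q GQ]; exists (P * Q) => v; rewrite mevalM FP GQ. Qed.

Lemma polyfunN F : polyfun F -> polyfun (fun v => - F v).
Proof. by move=> [P FP]; exists (- P) => v; rewrite mevalN FP. Qed.

Lemma polyfunB F G : polyfun F -> polyfun G -> polyfun (fun v => F v - G v).
Proof. by move=> FP GP; apply: polyfunD FP _; apply: polyfunN. Qed.

Lemma polyfunX F k : polyfun F -> polyfun (fun v => F v ^+ k).
Proof. by move=> [P FP]; exists (P ^+ k) => v; rewrite rmorphXn /= FP. Qed.

Lemma polyfun_sum (I : Type) (r : seq I) (F : I -> V -> K) :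
  (forall i, polyfun (F i)) -> polyfun (fun v => \sum_(i <- r) F i v).
Proof.
move=> FP; elim: r => [|i r [P rP]].
  by exists 0 => v; rewrite big_nil meval0.
have [Q iQ] := FP i; exists (Q + P) => v.
by rewrite big_cons mevalD iQ rP.
Qed.

Lemma polyfun_linear (f : {linear V -> K^o}) : polyfun (fun v => f v).
Proof.
exists (\sum_(i < \dim {:V}) ((f (vbasis fullv)`_i : K))%:MP * 'X_i) => v.
rewrite {1}(coord_vbasis (memvf v)) linear_sum raddf_sum /=; apply: eq_bigr => i _.
by rewrite linearZ /= mevalM mevalC mevalXU mulrC.
Qed.

Lemma zariski_closed_family (I : Type) (F : I -> V -> K) :
  (forall i, polyfun (F i)) -> zariski_closed (fun v => forall i, F i v = 0).
Proof.
move=> FP; exists (fun P => exists i, forall v, F i v = P.@[coords v]) => v.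
split=> [v0 P [i iP] | vP i]; first by rewrite -iP.
by have [P iP] := FP i; rewrite iP; apply: vP; exists i.
Qed.

(** Doubly negated: openness only denies that all equations of the closed complement hold at [u], so
    an equation that fails can be extracted only under the goal [False]. Its restriction to the line
    is the polynomial [p]. *)
Lemma zariski_open_line (U : V -> Prop) u d : zariski_open U -> U u ->
  ~ (forall p : {poly K}, p.[0] != 0 -> (forall s, p.[s] != 0 -> U (u + s *: d)) -> False).
Proof.
case=> Z [S SZ] UZ /UZ nZu noP; apply: nZu; apply/SZ => P SP.
apply/eqP/negPn/negP => nzP.
pose g i := (coords u i)%:P + coords d i *: 'X.
have gE s i : (g i).[s] = coords (u + s *: d) i.
  by rewrite !hornerE coordsD coordsZ mulrC.
apply: (noP (mpoly_curve P g)).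
  rewrite horner_mpoly_curve; apply: contra nzP => /eqP <-; apply/eqP.
  by apply: meval_eq => i; rewrite gE scale0r addr0.
move=> s ps; apply/UZ => /SZ/(_ P SP) Ps0; case/eqP: ps; rewrite -Ps0 horner_mpoly_curve.
by apply: meval_eq => i; rewrite gE.
Qed.

End PolynomialFunctions.

Lemma big_triangle (V : zmodType) (F : nat -> nat -> V) N :
  \sum_(m < N) \sum_(i < m.+1) F i (m - i)%N = \sum_(i < N) \sum_(j < N - i) F i j.
Proof.
elim: N => [|N IHN]; first by rewrite !big_ord0.
rewrite big_ord_recr /= IHN [RHS]big_ord_recr /= subSnn big_ord1.
rewrite [X in _ + X]big_ord_recr /= subnn addrA; congr (_ + _).
rewrite -big_split; apply: eq_bigr => i _ /=.
by rewrite subSn ?(ltnW (ltn_ord i)) // big_ord_recr.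
Qed.

(** * Exponentials of nilpotent endomorphisms and derivations *)

Section Exponential.

Variables (K : closedFieldType) (V : vectType K).
Hypothesis charK : [pchar K] =i pred0.
Variables (D : 'End(V)) (n : nat).
Hypothesis nilD : lpow D n.+2 = 0.

Definition divpow k : 'End(V) := (k`!%:R)^-1 *: lpow D k.

(** The exponential of [s D]: the series stops because [lpow D n.+2] is 0. Being polynomial in [s],
    it is a curve of the kind used for tangent vectors. *)
Definition lexp s : 'End(V) := \sum_(k < n.+2) s ^+ k *: divpow k.

Lemma divpow_nil k x : (n.+2 <= k)%N -> divpow k x = 0.
Proof.
by move=> lek; rewrite scale_lfunE -(subnK lek) lpowD nilD zero_lfunE linear0 scaler0.
Qed.

Lemma divpow0 x : divpow 0 x = x.
Proof. by rewrite scale_lfunE lpow0 fact0 invr1 scale1r. Qed.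

Lemma divpow1 x : divpow 1 x = D x.
Proof. by rewrite scale_lfunE lpowS lpow0 invr1 scale1r. Qed.

Lemma divpowS k x : k.+1%:R *: divpow k.+1 x = D (divpow k x).
Proof.
rewrite !scale_lfunE [RHS]linearZ /= scalerA lpowS; congr (_ *: _).
by rewrite factS natrM invfM mulrA divff ?mul1r // pchar0_natr_eq0.
Qed.

Lemma divpowSr k x : k.+1%:R *: divpow k.+1 x = divpow k (D x).
Proof.
by rewrite divpowS !scale_lfunE -lpowSr linearZ /= lpowS.
Qed.

Lemma lexpE s x M : (n.+2 <= M)%N -> lexp s x = \sum_(k < M) s ^+ k *: divpow k x.
Proof.
move=> leM; rewrite -(subnKC leM) big_split_ord /= addrC big1 ?add0r => [|i _].
  by rewrite sum_lfunE; apply: eq_bigr => k _; rewrite scale_lfunE.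
by rewrite divpow_nil ?scaler0 // leq_addr.
Qed.

(** If [lpow D m.+1 x] is 0, applying [lpow D m] to [lexp s x = 0] leaves only the term
    [lpow D m x]; descending on [m] reaches [x] itself. *)
Lemma lexp_inj s : lker (lexp s) == 0%VS.
Proof.
rewrite -subv0; apply/subvP => x; rewrite memv_ker memv0 => /eqP ex.
have [k kP] := ubnP n.+2; have: lpow D k.-1 x = 0.
  case: k kP => // k; rewrite ltnS => lek.
  by rewrite /= -(subnK lek) lpowD nilD zero_lfunE linear0.
elim: (k.-1) => [|m IHm]; first by rewrite lpow0 => ->.
move=> Dm0; apply: IHm.
have D0 j : lpow D m (lpow D j.+1 x) = 0.
  by rewrite -lpowD addnC addSn -addnS lpowD Dm0 linear0.
have := congr1 (lpow D m) ex; rewrite linear0 (lexpE _ _ (leqnn _)) big_ord_recl.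
rewrite linearD /= divpow0 expr0 scale1r linear_sum big1 ?addr0 // => i _.
by rewrite linearZ /= scale_lfunE linearZ /= [lpow D m _]D0 !scaler0.
Qed.

End Exponential.

Section LieExponential.

Variables (K : closedFieldType) (L : lieAlgType K).
Hypothesis charK : [pchar K] =i pred0.
Variables (z : L) (n : nat).
Hypothesis nilz : lpow (ad z) n.+2 = 0.
Local Notation d := (divpow (ad z)).

Lemma divpow_lie m x y :
  d m (lie x y) = \sum_(i < m.+1) lie (d i x) (d (m - i)%N y).
Proof.
elim: m => [|m IHm]; first by rewrite big_ord1 !divpow0.
have nzm : (m.+1%:R : K) != 0 by rewrite pchar0_natr_eq0.
apply: (scalerI nzm); rewrite divpowS // IHm linear_sum /=.
have E (i : 'I_m.+1) : ad z (lie (d i x) (d (m - i) y)) =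
    i.+1%:R *: lie (d i.+1 x) (d (m - i) y) + (m - i).+1%:R *: lie (d i x) (d (m - i).+1 y).
  by rewrite adE lie_lier -!adE -!divpowS // !adE lieZl lieZr.
rewrite (eq_bigr _ (fun i _ => E i)) big_split /=.
have -> : \sum_(i < m.+1) i.+1%:R *: lie (d i.+1 x) (d (m - i) y) =
    \sum_(i < m.+2) i%:R *: lie (d i x) (d (m.+1 - i) y).
  by rewrite [RHS]big_ord_recl scale0r add0r.
have -> : \sum_(i < m.+1) (m - i).+1%:R *: lie (d i x) (d (m - i).+1 y) =
    \sum_(i < m.+2) (m.+1 - i)%:R *: lie (d i x) (d (m.+1 - i) y).
  rewrite [RHS]big_ord_recr /= subnn scale0r addr0; apply: eq_bigr => i _.
  by rewrite subSn // -ltnS.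
rewrite scaler_sumr -big_split; apply: eq_bigr => i _ /=.
by rewrite -scalerDl -natrD subnKC // -ltnS.
Qed.

Lemma lexp_lie s x y : lexp (ad z) n s (lie x y) = lie (lexp (ad z) n s x) (lexp (ad z) n s y).
Proof.
(* With twice the length, the triangle of index pairs contains the whole square on which terms can
   be nonzero. *)
pose N := (n.+2 + n.+2)%N.
have leN : (n.+2 <= N)%N by rewrite leq_addr.
rewrite (lexpE nilz _ _ leN).
have -> : \sum_(k < N) s ^+ k *: d k (lie x y) =
  \sum_(k < N) \sum_(i < k.+1) s ^+ i *: (s ^+ (k - i) *: lie (d i x) (d (k - i) y)).
  apply: eq_bigr => k _; rewrite divpow_lie scaler_sumr; apply: eq_bigr => i _.
  by rewrite scalerA -exprD subnKC // -ltnS.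
rewrite (big_triangle (fun i j => s ^+ i *: (s ^+ j *: lie (d i x) (d j y)))).
rewrite {1}/N big_split_ord /= [X in _ + X]big1 ?addr0 => [|i _]; last first.
  apply: big1 => j _; rewrite [d (_ + _) x](divpow_nil nilz) ?leq_addr //.
  by rewrite lie0l !scaler0.
rewrite [X in lie X _](lexpE nilz _ _ (leqnn _)) lie_anti linear_sum -sumrN.
apply: eq_bigr => i _ /=; rewrite lieZr -scalerN -lie_anti -scaler_sumr; congr (_ *: _).
rewrite (@lexpE _ _ _ _ nilz s y (N - i)).
  by rewrite linear_sum; apply: eq_bigr => j _; rewrite /= lieZr.
by rewrite /N -addnBA ?leq_addr // ltnW.
Qed.

Lemma lexp_aut s : lie_aut (lexp (ad z) n s).
Proof. by split; [apply: lexp_inj | move=> x y; apply: lexp_lie]. Qed.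

End LieExponential.

(** * Automorphisms preserving a ratio of polynomial functions *)

Section InvariantGroup.

Variables (K : closedFieldType) (L : lieAlgType K).
Variables (A B : 'Dual(L) -> K) (f0 : 'Dual(L)).
Hypothesis Bf0 : B f0 != 0.
Hypothesis polA : forall f, polyfun (fun phi : 'End(L) => A (f \o phi)%VF).
Hypothesis polB : forall f, polyfun (fun phi : 'End(L) => B (f \o phi)%VF).

Definition inv_group (phi : 'End(L)) := lie_aut phi /\
  exists c, forall f : 'Dual(L), A (f \o phi)%VF = c * A f /\ B (f \o phi)%VF = c * B f.

Definition lfun_app (x : L) (l : 'Dual(L)) : 'End(L) -> K^o := fun phi => l (phi x).

Lemma lfun_app_is_linear x l : linear (lfun_app x l).
Proof.
by move=> c phi psi; rewrite /lfun_app add_lfunE scale_lfunE linearP.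
Qed.

HB.instance Definition _ x l :=
  GRing.isLinear.Build K 'End(L) K^o _ (lfun_app x l) (lfun_app_is_linear x l).

Lemma polyfun_app x (l : 'Dual(L)) : polyfun (fun phi : 'End(L) => l (phi x) : K).
Proof. exact: (polyfun_linear (lfun_app x l)). Qed.

Lemma polyfun_lie (l : 'Dual(L)) x y : polyfun (fun phi : 'End(L) => l (lie (phi x) (phi y)) : K).
Proof.
have E (phi : 'End(L)) : (l (lie (phi x) (phi y)) : K) =
    \sum_(i < \dim {:L}) \sum_(j < \dim {:L}) (coord (vbasis fullv) i (phi x) *
       coord (vbasis fullv) j (phi y)) * (l (lie (vbasis fullv)`_i (vbasis fullv)`_j) : K).
  rewrite {1}(coord_vbasis (memvf (phi x))) lie_anti linear_sum -sumrN linear_sum.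
  apply: eq_bigr => i _; rewrite -lie_anti lieZl.
  rewrite {1}(coord_vbasis (memvf (phi y))) linear_sum scaler_sumr linear_sum.
  apply: eq_bigr => j _; rewrite /= lieZr scalerA linearZ /=.
  by [].
have pc i u : polyfun (fun phi : 'End(L) => coord (vbasis fullv) i (phi u)).
  pose ci : 'Dual(L) := linfun (coord (vbasis fullv) i : L -> K^o).
  have [P PE] := polyfun_app u ci.
  by exists P => v; rewrite -PE lfunE.
have [P PE] : polyfun (fun phi : 'End(L) => \sum_(i < \dim {:L}) \sum_(j < \dim {:L}) (coord (vbasis fullv) i (phi x) *
       coord (vbasis fullv) j (phi y)) * (l (lie (vbasis fullv)`_i (vbasis fullv)`_j) : K)).
  apply: polyfun_sum => i; apply: polyfun_sum => j.
  apply: polyfunM; last exact: polyfun_cst.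
  by apply: polyfunM; apply: pc.
by exists P => phi; rewrite E PE.
Qed.

Lemma inv_group_algebraic : algebraic_subgroup inv_group.
Proof.
have lk1 : lker (\1%VF : 'End(L)) == 0%VS.
  by rewrite -subv0; apply/subvP => x; rewrite memv_ker id_lfunE memv0.
split.
- by move=> phi [].
- split; first by split=> // x y; rewrite !id_lfunE.
  by exists 1 => f; rewrite comp_lfun1r !mul1r.
- move=> phi psi [[kphi mphi] [c cP]] [[kpsi mpsi] [d dP]]; split.
    split=> [|x y]; last by rewrite !comp_lfunE mpsi mphi.
    rewrite -subv0; apply/subvP => x; rewrite memv_ker comp_lfunE memv0.
    rewrite -[_ == 0]memv_ker (eqP kphi) memv0 -[_ == 0]memv_ker (eqP kpsi).
    by rewrite memv0.
  exists (d * c) => f; rewrite !comp_lfunA.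
  by have [-> ->] := dP (f \o phi)%VF; have [-> ->] := cP f; rewrite !mulrA.
(* Composing [f0 \o phi^-1] with [phi] gives back [f0], where [B] does not vanish, so the factor
   cannot be 0. *)
- move=> phi [[kphi mphi] [c cP]]; have nzc : c != 0.
    apply/eqP => c0; have [_] := cP (f0 \o phi^-1)%VF.
    by rewrite -comp_lfunA lker0_compVf // comp_lfun1r c0 mul0r => /eqP; apply/negP.
  split; last first.
    exists c^-1 => f; have [] := cP (f \o phi^-1)%VF.
    by rewrite -comp_lfunA lker0_compVf // comp_lfun1r => -> ->; rewrite !mulKf.
  split=> [|x y].
    rewrite -subv0; apply/subvP => x; rewrite memv_ker => /eqP px.
    by rewrite -[x](lker0_lfunVK kphi) px linear0 mem0v.
  apply: (lker0P kphi); rewrite mphi.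
  by rewrite !lker0_lfunVK.
(* The common factor is eliminated by comparison with its value [B (f0 \o phi) / B f0]. *)
pose I := ((L * L * 'Dual(L)) + ('Dual(L) * bool))%type.
pose F (i : I) (phi : 'End(L)) : K := match i with
  | inl (x, y, l) => (l (phi (lie x y)) : K) - l (lie (phi x) (phi y))
  | inr (f, true) => A (f \o phi)%VF * B f0 - B (f0 \o phi)%VF * A f
  | inr (f, false) => B (f \o phi)%VF * B f0 - B (f0 \o phi)%VF * B f
  end.
exists (fun phi => forall i, F i phi = 0).
  apply: zariski_closed_family => -[[[x y] l]|[f []]] /=.
  - by apply: polyfunB; [apply: polyfun_app | apply: polyfun_lie].
  - by apply: polyfunB; apply: polyfunM => //; apply: polyfun_cst.
  - by apply: polyfunB; apply: polyfunM => //; apply: polyfun_cst.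
move=> phi; split=> [[[kphi mphi] [c cP]] | [kphi Fphi]].
  split=> // -[[[x y] l]|[f []]] /=; first by rewrite mphi subrr.
    by have [-> _] := cP f; have [_ ->] := cP f0; rewrite mulrAC subrr.
  by have [_ ->] := cP f; have [_ ->] := cP f0; rewrite mulrAC subrr.
split.
  split=> // x y; apply/eqP; rewrite -subr_eq0; apply/eqP.
  rewrite [LHS](coord_vbasis (memvf _)); apply: big1 => i _.
  pose ci : 'Dual(L) := linfun (coord (vbasis fullv) i : L -> K^o).
  have := Fphi (inl (x, y, ci)); rewrite /= /ci !lfunE /= => /eqP.
  by rewrite subr_eq0 => /eqP E; rewrite linearB /= E subrr scale0r.
exists (B (f0 \o phi)%VF / B f0) => f.
have := Fphi (inr (f, true)); have := Fphi (inr (f, false)) => /=.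
move/eqP; rewrite subr_eq0 => /eqP EB /eqP; rewrite subr_eq0 => /eqP EA.
by split; apply: (mulIf Bf0); rewrite ?EA ?EB mulrAC divfK.
Qed.

Lemma mdiffD (P : {mpoly K[\dim {:'End(L)}]}) v X Y : mdiff P v (X + Y) = mdiff P v X + mdiff P v Y.
Proof.
by rewrite /mdiff -big_split; apply: eq_bigr => i _; rewrite coordsD mulrDr.
Qed.

Lemma mdiffZ (P : {mpoly K[\dim {:'End(L)}]}) v c X : mdiff P v (c *: X) = c * mdiff P v X.
Proof.
by rewrite /mdiff mulr_sumr; apply: eq_bigr => i _; rewrite coordsZ mulrCA.
Qed.

Lemma lie_of_groupD (G : 'End(L) -> Prop) X Y :
  lie_of_group G X -> lie_of_group G Y -> lie_of_group G (X + Y).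
Proof. by move=> GX GY P PG; rewrite mdiffD GX // GY // addr0. Qed.

Lemma lie_of_groupZ (G : 'End(L) -> Prop) c X :
  lie_of_group G X -> lie_of_group G (c *: X).
Proof. by move=> GX P PG; rewrite mdiffZ GX // mulr0. Qed.

(* The value [s = -1] is left out since [1 + s D] is singular there for a projection [D]. *)
Lemma lie_of_group_curve (G : 'End(L) -> Prop) n (c : nat -> 'End(L)) :
  c 0%N = \1%VF -> (forall s, s != -1 -> G (\sum_(k < n.+2) s ^+ k *: c k)) ->
  lie_of_group G (c 1%N).
Proof.
move=> c0 cG P PG; have [p [pE Ep]] := vector_curve n c P; rewrite -c0 -Ep.
suff ->: p = 0 by rewrite linear0 horner0.
have: p * ('X + 1) = 0.
  apply: poly_eq0P => s; rewrite !hornerE; have [-> | nzs] := eqVneq s (-1).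
    by rewrite addNr mulr0.
  by rewrite pE PG ?mul0r //; apply: cG.
move/eqP; rewrite mulf_eq0 => /orP[/eqP //|].
by rewrite -size_poly_eq0 -[1]/(1%:P) size_XaddC.
Qed.

End InvariantGroup.

(** * Semi-invariants of the parabolic subalgebra *)

(* The basis of p is numbered 0: f; 1: e0; 2-4: e_i; 5-7: v_i; 8-10: s_i; 11: b; 12: t; 13: h0;
   14-16: the coweights dual to the three outer simple roots. *)
Definition root_bracket (i j : nat) : option nat :=
  match i, j with
  | 1, 0 => Some 13
  | 0, 5 => Some 2 | 0, 6 => Some 3 | 0, 7 => Some 4 | 0, 12 => Some 11
  | 1, 2 => Some 5 | 1, 3 => Some 6 | 1, 4 => Some 7 | 1, 11 => Some 12
  | 2, 6 => Some 10 | 2, 7 => Some 9 | 3, 5 => Some 10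
  | 3, 7 => Some 8 | 4, 5 => Some 9 | 4, 6 => Some 8
  | 2, 8 => Some 11 | 3, 9 => Some 11 | 4, 10 => Some 11
  | 5, 8 => Some 12 | 6, 9 => Some 12 | 7, 10 => Some 12
  | _, _ => None
  end%N.

(** Values of the roots of p at h0, the coroot of alpha2, in the order of the basis; [h_weightE]
    checks them against the roots. *)
Definition h0_weights : seq int := [:: -2; 2; -1; -1; -1; 1; 1; 1; 0; 0; 0; -1; 1].
Definition u_weights (i : nat) : seq int :=
  match i with
  | 0%N => [:: 0; 0; 1; 0; 0; 1; 0; 0; 0; 1; 1; 1; 1]
  | 1%N => [:: 0; 0; 0; 1; 0; 0; 1; 0; 1; 0; 1; 1; 1]
  | _ => [:: 0; 0; 0; 0; 1; 0; 0; 1; 1; 1; 0; 1; 1]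
  end.
Definition h_weight (i j : nat) : int :=
  if i == 13%N then h0_weights`_j else (u_weights (i - 14))`_j.

(** Every bracket of two basis vectors is an integer multiple of one basis vector; the pair is
    coefficient and index, and for a zero bracket the index 0 is a dummy. *)
Definition br (i j : nat) : int * nat :=
  if (13 <= i)%N then (if (13 <= j)%N then (0, 0%N) else (h_weight i j, j))
  else if (13 <= j)%N then (- h_weight j i, i)
  else if root_bracket i j is Some l then (1, l)
  else if root_bracket j i is Some l then (-1, l) else (0, 0%N).

Section Polynomials.

Variable R : comNzRingType.
Implicit Types F : nat -> R.

Definition pT F : R :=
  F 11 ^+ 2 * F 1 + F 11 * F 12 * F 13 - F 12 ^+ 2 * F 0
  + (F 11 * F 5 - F 12 * F 2) * F 8 + (F 11 * F 6 - F 12 * F 3) * F 9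
  + (F 11 * F 7 - F 12 * F 4) * F 10 - 2%:R * F 8 * F 9 * F 10.

Definition pH1 F : R := F 11 * F 5 - F 12 * F 2 - F 9 * F 10.
Definition pH2 F : R := F 11 * F 6 - F 12 * F 3 - F 8 * F 10.
Definition pH3 F : R := F 11 * F 7 - F 12 * F 4 - F 8 * F 9.
Definition pB F : R := pH1 F * pH2 F * pH3 F.

(** Partial derivatives of [pT], in the order of the basis; the default 0 of [nth] covers the
    coweights, which do not occur in T. *)
Definition dT F (k : nat) : R :=
  [:: - F 12 ^+ 2; F 11 ^+ 2; - (F 12 * F 8); - (F 12 * F 9); - (F 12 * F 10);
      F 11 * F 8; F 11 * F 9; F 11 * F 10;
      F 11 * F 5 - F 12 * F 2 - 2%:R * F 9 * F 10;
      F 11 * F 6 - F 12 * F 3 - 2%:R * F 8 * F 10;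
      F 11 * F 7 - F 12 * F 4 - 2%:R * F 8 * F 9;
      2%:R * F 11 * F 1 + F 12 * F 13 + F 5 * F 8 + F 6 * F 9 + F 7 * F 10;
      F 11 * F 13 - 2%:R * F 12 * F 0 - F 2 * F 8 - F 3 * F 9 - F 4 * F 10;
      F 11 * F 12]`_k.

Definition dH1 F (k : nat) : R :=
  [:: 0; 0; - F 12; 0; 0; F 11; 0; 0; 0; - F 10; - F 9; F 5; - F 2]`_k.
Definition dH2 F (k : nat) : R :=
  [:: 0; 0; 0; - F 12; 0; 0; F 11; 0; - F 10; 0; - F 8; F 6; - F 3]`_k.
Definition dH3 F (k : nat) : R :=
  [:: 0; 0; 0; 0; - F 12; 0; 0; F 11; - F 9; - F 8; 0; F 7; - F 4]`_k.
Definition dB F k : R :=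
  dH1 F k * (pH2 F * pH3 F) + dH2 F k * (pH1 F * pH3 F) + dH3 F k * (pH1 F * pH2 F).

Definition table_range := iota 0 17.

Definition lin G (y : nat -> R) : R := \sum_(k <- table_range) y k * G k.

(* The characters by which p acts on T ([i = 0]) and on H_i. *)
Definition chi (i m : nat) : int :=
  if (m < 14)%N then 0 else if i == 0%N then 2 else if m == (13 + i)%N then 2 else 1.

Definition brF F m k : R := (br m k).1%:~R * F (br m k).2.

(** The left side is the derivation of S(p) induced by the basis vector [m], applied to T: one
    polynomial identity for each basis vector. *)
Lemma inv_T F m : (m < 17)%N -> lin (brF F m) (dT F) = (chi 0 m)%:~R * pT F.
Proof.
rewrite /lin /table_range /brF /chi /pT /dT; do 17! [case: m => [_|m]; first by rewrite !big_cons big_nil /br /h_weight /=; ring].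
by [].
Qed.

Lemma inv_H1 F m : (m < 17)%N -> lin (brF F m) (dH1 F) = (chi 1 m)%:~R * pH1 F.
Proof.
rewrite /lin /table_range /brF /chi /pH1 /dH1; do 17! [case: m => [_|m]; first by rewrite !big_cons big_nil /br /h_weight /=; ring].
by [].
Qed.

Lemma inv_H2 F m : (m < 17)%N -> lin (brF F m) (dH2 F) = (chi 2 m)%:~R * pH2 F.
Proof.
rewrite /lin /table_range /brF /chi /pH2 /dH2; do 17! [case: m => [_|m]; first by rewrite !big_cons big_nil /br /h_weight /=; ring].
by [].
Qed.

Lemma inv_H3 F m : (m < 17)%N -> lin (brF F m) (dH3 F) = (chi 3 m)%:~R * pH3 F.
Proof.
rewrite /lin /table_range /brF /chi /pH3 /dH3; do 17! [case: m => [_|m]; first by rewrite !big_cons big_nil /br /h_weight /=; ring].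
by [].
Qed.

Lemma linD G y y' : lin G (fun k => y k + y' k) = lin G y + lin G y'.
Proof. by rewrite -big_split; apply: eq_bigr => k _; rewrite mulrDl. Qed.

Lemma linZ G c y : lin G (fun k => c * y k) = c * lin G y.
Proof. by rewrite /lin mulr_sumr; apply: eq_bigr => k _; rewrite mulrA. Qed.

Lemma eq_lin G y y' : y =1 y' -> lin G y = lin G y'.
Proof. by move=> E; apply: eq_bigr => k _; rewrite E. Qed.

Lemma lin_dB G F : lin G (dB F) = pH2 F * pH3 F * lin G (dH1 F) +
  pH1 F * pH3 F * lin G (dH2 F) + pH1 F * pH2 F * lin G (dH3 F).
Proof.
rewrite -!linZ -!linD; apply: eq_lin => k; rewrite /dB; ring.
Qed.

Definition chiB m : int := chi 1 m + chi 2 m + chi 3 m.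

Lemma inv_B F m : (m < 17)%N -> lin (brF F m) (dB F) = (chiB m)%:~R * pB F.
Proof.
by move=> m17; rewrite lin_dB inv_H1 // inv_H2 // inv_H3 // /chiB /pB; ring.
Qed.

Lemma chiBT m : (m < 17)%N -> chiB m = chi 0 m *+ 2.
Proof. by do 17! [case: m => [//|m]]. Qed.

Definition pY F k : R := (2%:R * pB F) * dT F k + (- pT F) * dB F k.

Lemma lin_Y G F : lin G (pY F) = (2%:R * pB F) * lin G (dT F) - pT F * lin G (dB F).
Proof. by rewrite linD !linZ mulNr. Qed.

Lemma inv_Y F m : (m < 17)%N -> lin (brF F m) (pY F) = 0.
Proof.
move=> m17; rewrite lin_Y inv_T // inv_B // chiBT //; ring.
Qed.

Lemma Euler_T F : lin F (dT F) = 3%:R * pT F.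
Proof. rewrite /lin !big_cons big_nil /= /pT /dT /=; ring. Qed.

Lemma Euler_B F : lin F (dB F) = 6%:R * pB F.
Proof.
rewrite lin_dB /pB.
have -> : lin F (dH1 F) = 2%:R * pH1 F by rewrite /lin !big_cons big_nil /= /pH1 /dH1 /=; ring.
have -> : lin F (dH2 F) = 2%:R * pH2 F by rewrite /lin !big_cons big_nil /= /pH2 /dH2 /=; ring.
have -> : lin F (dH3 F) = 2%:R * pH3 F by rewrite /lin !big_cons big_nil /= /pH3 /dH3 /=; ring.
ring.
Qed.

Lemma Euler_Y F : lin F (pY F) = 0.
Proof. rewrite lin_Y Euler_T Euler_B; ring. Qed.

End Polynomials.

Section PolynomialCurves.

Variable K : closedFieldType.
Implicit Types P : nat -> {poly K}.

Local Notation ev P s := (fun k => (P k).[s]).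

Lemma horner2 s : (2%:R : {poly K}).[s] = 2%:R.
Proof. by rewrite -polyC_natr hornerC. Qed.

Definition horner_ringE := (horner2, horner_exp, hornerM, hornerN, hornerD).

Lemma horner_pT P s : (pT P).[s] = pT (ev P s).
Proof. by rewrite /pT !horner_ringE. Qed.

Lemma horner_pB P s : (pB P).[s] = pB (ev P s).
Proof. by rewrite /pB /pH1 /pH2 /pH3 !horner_ringE. Qed.

Lemma horner_dT P s k : (dT P k).[s] = dT (ev P s) k.
Proof.
rewrite /dT; do 14! [case: k => [|k]; first by rewrite /= !horner_ringE].
by rewrite /= !nth_nil horner0.
Qed.

Lemma horner_dB P s k : (dB P k).[s] = dB (ev P s) k.
Proof.
have dH : [/\ (dH1 P k).[s] = dH1 (ev P s) k, (dH2 P k).[s] = dH2 (ev P s) k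
    & (dH3 P k).[s] = dH3 (ev P s) k].
  rewrite /dH1 /dH2 /dH3.
  do 13! [case: k => [|k]; first by rewrite /= ?horner_ringE ?horner0].
  by rewrite /= !nth_nil horner0.
by case: dH => E1 E2 E3; rewrite /dB /pH1 /pH2 /pH3 !horner_ringE E1 E2 E3.
Qed.

Lemma horner_2MB (p q p' q' : {poly K}) s :
  (2%:R * p' * q - p * q').[s] = 2%:R * p'.[s] * q.[s] - p.[s] * q'.[s].
Proof. by rewrite !horner_ringE. Qed.

Lemma horner_pY P s k : (pY P k).[s] = pY (ev P s) k.
Proof.
have E (a b c d : {poly K}) : (2%:R * a * c + (- b) * d).[s] =
    2%:R * a.[s] * c.[s] + (- b.[s]) * d.[s] by rewrite !horner_ringE.
by rewrite /pY E horner_pT horner_pB horner_dT horner_dB.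
Qed.

Lemma horner_lin (G y : nat -> {poly K}) s : (lin G y).[s] = lin (ev G s) (ev y s).
Proof. by rewrite /lin horner_sum; apply: eq_bigr => k _; rewrite hornerM. Qed.

(** The chain rule; it confirms that the explicit list [dT] is the gradient of [pT]. *)
Lemma deriv_pT P : (pT P)^`() = lin (fun k => (P k)^`()) (dT P).
Proof.
have d2 : (2%:R : {poly K})^`() = 0 by rewrite -polyC_natr derivC.
rewrite /lin !big_cons big_nil /= /pT /dT /= !expr2 !(d2, derivB, derivD, derivM); ring.
Qed.

Lemma deriv_pH1 P : (pH1 P)^`() = lin (fun k => (P k)^`()) (dH1 P).
Proof.
rewrite /lin !big_cons big_nil /= /pH1 /dH1 /= !(derivB, derivD, derivM); ring.
Qed.

Lemma deriv_pH2 P : (pH2 P)^`() = lin (fun k => (P k)^`()) (dH2 P).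
Proof.
rewrite /lin !big_cons big_nil /= /pH2 /dH2 /= !(derivB, derivD, derivM); ring.
Qed.

Lemma deriv_pH3 P : (pH3 P)^`() = lin (fun k => (P k)^`()) (dH3 P).
Proof.
rewrite /lin !big_cons big_nil /= /pH3 /dH3 /= !(derivB, derivD, derivM); ring.
Qed.

Lemma deriv_pB P : (pB P)^`() = lin (fun k => (P k)^`()) (dB P).
Proof.
by rewrite lin_dB /pB !derivM deriv_pH1 deriv_pH2 deriv_pH3; ring.
Qed.

End PolynomialCurves.

Lemma poly_deriv0 (K : closedFieldType) (p : {poly K}) : [pchar K] =i pred0 ->
  p^`() = 0 -> forall s, p.[s] = p.[0].
Proof.
move=> charK dp s; suff -> : p = (p`_0)%:P by rewrite !hornerC.
apply/polyP => -[|i]; rewrite coefC //=.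
have := congr1 (fun q : {poly K} => q`_i) dp; rewrite coef_deriv coef0 => /eqP.
by rewrite -mulr_natl mulf_eq0 pchar0_natr_eq0 //= => /eqP.
Qed.

(* Equality of logarithmic derivatives forces proportionality; compared coefficientwise at 0. *)
Lemma poly_log_deriv (K : closedFieldType) (p q : {poly K}) : [pchar K] =i pred0 ->
  q.[0] != 0 -> p^`() * q = p * q^`() -> forall s, p.[s] * q.[0] = p.[0] * q.[s].
Proof.
move=> charK nzq E s; pose W := q.[0] *: p - p.[0] *: q.
suff W0 : W = 0.
  have := congr1 (horner^~ s) W0; rewrite /W !hornerE => /eqP.
  by rewrite subr_eq0 mulrC => /eqP.
have WE : W^`() * q = W * q^`().
  rewrite /W derivB !derivZ !mulrBl -!scalerAl E; congr (_ - _ *: _).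
  by rewrite mulrC.
apply/polyP => i; rewrite coef0; have [n] := ubnP i; elim: n i => // n IHn [_|i lei].
  by rewrite -horner_coef0 /W !hornerE mulrC subrr.
have := congr1 (fun r : {poly K} => r`_i) WE; rewrite !coefM.
rewrite [RHS]big1 => [|j _]; last first.
  by rewrite IHn ?mul0r //; apply: leq_trans (ltn_ord j) lei.
rewrite big_ord_recr big1 /= => [|j _]; last first.
  rewrite coef_deriv IHn ?mul0rn ?mul0r //.
  by apply: leq_ltn_trans (ltn_ord j) _; rewrite -ltnS.
rewrite add0r subnn coef_deriv -horner_coef0 => /eqP.
by rewrite mulf_eq0 (negPf nzq) orbF -mulr_natl mulf_eq0 pchar0_natr_eq0 //= => /eqP.
Qed.

Lemma polyfun_ext (K : closedFieldType) (V : vectType K) (F G : V -> K) :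
  F =1 G -> polyfun F -> polyfun G.
Proof. by move=> E [P PE]; exists P => v; rewrite -E. Qed.

Section SemiInvariants.

Variables (K : closedFieldType) (L : lieAlgType K) (X : 17.-tuple L).
Hypothesis charK : [pchar K] =i pred0.
Hypothesis basisX : basis_of fullv X.
Hypothesis brX : forall i j, (i < 17)%N -> (j < 17)%N ->
  lie X`_i X`_j = (br i j).1%:~R *: X`_(br i j).2.
Implicit Types (f g : 'Dual(L)) (x y z : L).

Definition cf f k : K := f X`_k.
Definition fT f := pT (cf f).
Definition fA f := fT f ^+ 2.
Definition fB f := pB (cf f).
Definition comb (v : nat -> K) : L := \sum_(k <- table_range) v k *: X`_k.
Definition fY f := comb (pY (cf f)).

Lemma mem_table_range k : (k \in table_range) = (k < 17)%N.
Proof. by rewrite mem_iota add0n. Qed.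

Lemma cf_lie f m k : (m < 17)%N -> (k < 17)%N -> (f (lie X`_m X`_k) : K) = brF (cf f) m k.
Proof. by move=> m17 k17; rewrite brX // linearZ. Qed.

Lemma app_comb f v : (f (comb v) : K) = lin (cf f) v.
Proof. by rewrite /comb linear_sum; apply: eq_bigr => k _; rewrite linearZ. Qed.

Lemma combE x : x = comb (fun k => if (k < 17)%N then coord X (inord k) x else 0).
Proof.
rewrite {1}(coord_basis basisX (memvf x)) /comb /table_range -[iota 0 17]/(index_iota 0 17) big_mkord.
by apply: eq_bigr => i _; rewrite ltn_ord inord_val.
Qed.

Lemma basis_ind (Q : L -> Prop) : (forall c x y, Q x -> Q y -> Q (c *: x + y)) -> Q 0 ->
  (forall k, (k < 17)%N -> Q X`_k) -> forall x, Q x.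
Proof.
move=> QD Q0 QX x; rewrite (combE x) /comb big_seq.
elim/big_ind: _ => // [y z Qy Qz | k]; first by rewrite -[y]scale1r; apply: QD.
rewrite mem_table_range => k17; rewrite -[_ *: _]addr0; apply: QD => //; exact: QX.
Qed.

Lemma fY_stab f : fY f \in form_stab f.
Proof.
apply/form_stabP; apply: basis_ind => [c x y fx fy||m m17].
- by rewrite lieDr lieZr linearD linearZ /= fx fy scaler0 addr0.
- by rewrite lie0r linear0.
rewrite lie_anti linearN linear_sum linear_sum /=; apply/eqP; rewrite oppr_eq0; apply/eqP.
rewrite -[RHS](inv_Y (cf f) m17) /lin [LHS]big_seq [RHS]big_seq; apply: eq_bigr => k.
by rewrite mem_table_range => k17; rewrite lieZr linearZ /= cf_lie.
Qed.

Definition dform (c : nat -> K) : 'Dual(L) :=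
  \sum_(k < 17) (c k : K) *: (linfun (coord X k : L -> K^o) : 'Dual(L)).

Lemma cf_dform c k : (k < 17)%N -> cf (dform c) k = c k.
Proof.
move=> k17; rewrite /cf /dform sum_lfunE (bigD1 (Ordinal k17)) //= big1 => [|i nik].
  rewrite scale_lfunE lfunE /= -[k]/(val (Ordinal k17)) coord_free ?(basis_free basisX) //.
  by rewrite eqxx addr0 -[_ *: _]/(_ * _) mulr1.
rewrite scale_lfunE lfunE /= -[k]/(val (Ordinal k17)) coord_free ?(basis_free basisX) //.
by rewrite eq_sym (negPf nik) scaler0.
Qed.

Lemma eq_pT (F G : nat -> K) : (forall k, (k < 17)%N -> F k = G k) -> pT F = pT G.
Proof. by move=> E; rewrite /pT !E. Qed.

Lemma eq_pB (F G : nat -> K) : (forall k, (k < 17)%N -> F k = G k) -> pB F = pB G.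
Proof. by move=> E; rewrite /pB /pH1 /pH2 /pH3 !E. Qed.

Lemma eq_dT (F G : nat -> K) k : (forall k, (k < 17)%N -> F k = G k) -> dT F k = dT G k.
Proof. by move=> E; rewrite /dT !E. Qed.

Lemma eq_dB (F G : nat -> K) k : (forall k, (k < 17)%N -> F k = G k) -> dB F k = dB G k.
Proof. by move=> E; rewrite /dB /dH1 /dH2 /dH3 /pH1 /pH2 /pH3 !E. Qed.

(** At this form every H_i is 1 and T is the free parameter [e0], so T^2/B takes the value
    [e0 ^+ 2]. *)
Definition base_point (e0 : K) : nat -> K :=
  fun k => [:: 0; e0; 0; 0; 0; 1; 1; 1; 0; 0; 0; 1]`_k.

Lemma fT_base_point e0 : fT (dform (base_point e0)) = e0.
Proof. rewrite /fT (eq_pT (@cf_dform _)) /pT /base_point /=; ring. Qed.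

Lemma fB_base_point e0 : fB (dform (base_point e0)) = 1.
Proof. rewrite /fB (eq_pB (@cf_dform _)) /pB /pH1 /pH2 /pH3 /base_point /=; ring. Qed.

Lemma polyfun_cf f k : polyfun (fun phi : 'End(L) => cf (f \o phi)%VF k).
Proof.
by apply: polyfun_ext (polyfun_app X`_k f) => phi; rewrite /cf comp_lfunE.
Qed.

Lemma polyfun_fB f : polyfun (fun phi : 'End(L) => fB (f \o phi)%VF).
Proof.
by rewrite /fB /pB /pH1 /pH2 /pH3; do ![apply: polyfunM | apply: polyfunB | apply: polyfun_cf].
Qed.

Lemma polyfun_fA f : polyfun (fun phi : 'End(L) => fA (f \o phi)%VF).
Proof.
have: polyfun (fun phi : 'End(L) => fT (f \o phi)%VF).
  by rewrite /fT /pT; do ![apply: polyfunB | apply: polyfunD | apply: polyfunM | apply: polyfunX |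
    apply: polyfun_cf | apply: polyfun_cst].
by move=> Tp; apply: polyfunX.
Qed.

Definition semi_inv_group := inv_group fA fB.

Let Bf0 : fB (dform (base_point 1)) != 0. Proof. by rewrite fB_base_point oner_eq0. Qed.

Lemma semi_inv_group_algebraic : algebraic_subgroup semi_inv_group.
Proof. exact: inv_group_algebraic Bf0 polyfun_fA polyfun_fB. Qed.

(** Infinitesimal invariance of T and B, with trivial character; [inf_invX] gives it for all basis
    vectors but the three coweights. *)
Definition inf_inv z := forall f,
  lin (fun k => f (lie z X`_k)) (dT (cf f)) = 0 /\ lin (fun k => f (lie z X`_k)) (dB (cf f)) = 0.

Lemma lin_funD (G1 G2 y : nat -> K) c : lin (fun k => c * G1 k + G2 k) y = c * lin G1 y + lin G2 y.
Proof.
rewrite /lin mulr_sumr -big_split; apply: eq_bigr => k _ /=; ring.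
Qed.

Lemma eq_linl (G1 G2 y : nat -> K) : (forall k, (k < 17)%N -> G1 k = G2 k) -> lin G1 y = lin G2 y.
Proof.
move=> E; rewrite /lin big_seq [RHS]big_seq; apply: eq_bigr => k.
by rewrite mem_table_range => /E->.
Qed.

Lemma inf_inv_lin c x y : inf_inv x -> inf_inv y -> inf_inv (c *: x + y).
Proof.
move=> ix iy f; have [xT xB] := ix f; have [yT yB] := iy f.
have E k : (k < 17)%N -> (f (lie (c *: x + y) X`_k) : K) = c * f (lie x X`_k) + f (lie y X`_k).
  by move=> _; rewrite lieDl lieZl linearD linearZ.
by rewrite !(eq_linl _ E) !lin_funD xT xB yT yB mulr0 addr0.
Qed.

Lemma inf_invX m : (m < 14)%N -> inf_inv X`_m.
Proof.
move=> m14 f; have m17 : (m < 17)%N by apply: leq_trans m14 _.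
have E k : (k < 17)%N -> (f (lie X`_m X`_k) : K) = brF (cf f) m k by apply: cf_lie.
by rewrite !(eq_linl _ E) inv_T // inv_B // chiBT // /chi m14 mul0rn !mul0r.
Qed.

(** Along the forms [f \o exp (t ad z)] the derivative of T, and likewise of B, is the infinitesimal
    action of [z] at the moving form, hence 0. Both are constant in characteristic zero, and the
    common factor is 1. *)
Lemma lexp_semi_inv z n s : lpow (ad z) n.+2 = 0 -> inf_inv z -> semi_inv_group (lexp (ad z) n s).
Proof.
move=> nilz iz; split; first exact: lexp_aut.
exists 1 => f; rewrite !mul1r.
pose P k : {poly K} := \poly_(j < n.+2) (f (divpow (ad z) j X`_k) : K).
have PE t k : (P k).[t] = cf (f \o lexp (ad z) n t)%VF k.
  rewrite horner_poly /cf comp_lfunE (lexpE nilz t X`_k (leqnn _)) linear_sum.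
  by apply: eq_bigr => j _; rewrite linearZ mulrC.
have dPE t k : ((P k)^`()).[t] = (f \o lexp (ad z) n t)%VF (lie z X`_k).
  rewrite comp_lfunE (lexpE nilz t _ (leqnn _)) linear_sum.
  have -> : (P k)^`() = \poly_(j < n.+2) (f (divpow (ad z) j (ad z X`_k)) : K).
    apply/polyP => j; rewrite coef_deriv !coef_poly ltnS.
    rewrite -(divpowSr charK) linearZ /=.
    case: (ltngtP j n.+1) => [ltj | ltj | ->].
    - by rewrite ltnS (ltnW ltj) -[_ *: _]/(_ * _) mulr_natl.
    - by rewrite ltnS leqNgt ltj mul0rn.
    by rewrite ltnS leqnn mul0rn (divpow_nil nilz) // linear0 scaler0.
  rewrite horner_poly; apply: eq_bigr => j _.
  by rewrite linearZ adE mulrC.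
have cst (p : {poly K}) : (forall t, (p^`()).[t] = 0) -> p.[s] = p.[0].
  by move=> dp; apply: poly_deriv0 => //; apply: poly_eq0P.
have f0 : (f \o lexp (ad z) n 0)%VF = f.
  apply/lfunP => x; rewrite comp_lfunE (lexpE nilz 0 x (leqnn _)) big_ord_recl.
  rewrite expr0 scale1r divpow0 big1 ?addr0 // => i _.
  by rewrite exprS mul0r scale0r.
have ez t := iz (f \o lexp (ad z) n t)%VF.
have lE t (y : nat -> {poly K}) (c : nat -> K) : (forall k, (y k).[t] = c k) ->
   (lin (fun k => (P k)^`()) y).[t] = lin (fun k => (f \o lexp (ad z) n t)%VF (lie z X`_k)) c.
  move=> yc; rewrite /lin horner_sum; apply: eq_bigr => k _.
  by rewrite hornerM yc dPE.
have T0 t : ((pT P)^`()).[t] = 0.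
  rewrite deriv_pT horner_lin -(ez t).1; rewrite /lin; apply: eq_bigr => k _.
  by rewrite dPE horner_dT; congr (_ * _); apply: eq_dT => j _; rewrite PE.
have B0 t : ((pB P)^`()).[t] = 0.
  rewrite deriv_pB horner_lin -(ez t).2; rewrite /lin; apply: eq_bigr => k _.
  by rewrite dPE horner_dB; congr (_ * _); apply: eq_dB => j _; rewrite PE.
have ET := cst _ T0; have EB := cst _ B0; rewrite !horner_pT in ET; rewrite !horner_pB in EB.
have E t : (fun k => (P k).[t]) =1 cf (f \o lexp (ad z) n t)%VF by move=> k; rewrite PE.
rewrite /fA /fT /fB -!(eq_pT (fun k _ => E s k)) -!(eq_pB (fun k _ => E s k)) ET EB.
by rewrite (eq_pT (fun k _ => E 0 k)) (eq_pB (fun k _ => E 0 k)) f0.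
Qed.

End SemiInvariants.

(** Applies the adjoint action of basis vector [m] to a multiple of a basis vector, so that its
    powers are computed by evaluating the table. *)
Definition br_step (m : nat) (ck : int * nat) : int * nat :=
  ((ck.1 * (br m ck.2).1), (br m ck.2).2).

Lemma br_nilpotent : all (fun m => all (fun k => (iter 4 (br_step m) (1, k)).1 == 0) (iota 0 17))
  (iota 0 13).
Proof. by vm_compute. Qed.

Lemma br_bound : all (fun m => all (fun k => (br m k).2 < 17)%N (iota 0 17)) (iota 0 17).
Proof. by vm_compute. Qed.

Definition torus_weight (m k : nat) : int := if (13 <= k)%N then 0 else h_weight m k.

(** Outer simple roots occur in the roots of p with coefficient 0 or 1, so the outer coweights act
    on p as projections. *)
Lemma torus_weight01 : all (fun m => all (fun k =>
  torus_weight m k * torus_weight m k == torus_weight m k) (iota 0 17)) (iota 14 3).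
Proof. by vm_compute. Qed.

(** * The Lie algebra of the semi-invariance group *)

Section SemiInvariantGroup.

Variables (K : closedFieldType) (L : lieAlgType K) (X : 17.-tuple L).
Hypothesis charK : [pchar K] =i pred0.
Hypothesis basisX : basis_of fullv X.
Hypothesis brX : forall i j, (i < 17)%N -> (j < 17)%N ->
  lie X`_i X`_j = (br i j).1%:~R *: X`_(br i j).2.
Implicit Types (f g : 'Dual(L)) (x y z : L).

Local Notation semi_inv_group := (semi_inv_group X).
Local Notation cf := (cf X).

Lemma br_lt i j : (i < 17)%N -> (j < 17)%N -> ((br i j).2 < 17)%N.
Proof.
move=> i17 j17; have /allP/(_ i) := br_bound; rewrite mem_iota => /(_ i17)/allP/(_ j).
by rewrite mem_iota => /(_ j17).
Qed.

Lemma lpow_adX m n k : (m < 17)%N -> (k < 17)%N ->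
  let ck := iter n (br_step m) (1, k) in
  lpow (ad X`_m) n X`_k = ck.1%:~R *: X`_ck.2 /\ (ck.2 < 17)%N.
Proof.
move=> m17 k17; elim: n => [|n]; first by rewrite lpow0 /= mulr1z scale1r.
rewrite iterS; case: (iter n _ _) => c j /= [E j17]; split; last exact: br_lt.
by rewrite comp_lfunE E linearZ /= adE brX // scalerA -rmorphM.
Qed.

Lemma lfun_basis_eq (f g : 'End(L)) : (forall k, (k < 17)%N -> f X`_k = g X`_k) -> f = g.
Proof.
move=> E; apply/lfunP; apply: (basis_ind basisX) => [c x y fx fy||k /E //].
  by rewrite !linearD !linearZ /= fx fy.
by rewrite !linear0.
Qed.

Lemma nilX m : (m < 13)%N -> lpow (ad X`_m) 4 = 0.
Proof.
move=> m13; apply: lfun_basis_eq => k k17; rewrite zero_lfunE.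
have [->] := lpow_adX 4 (leq_trans m13 (isT : (13 <= 17)%N)) k17.
have /allP/(_ m) := br_nilpotent; rewrite mem_iota => /(_ m13)/allP/(_ k).
by rewrite mem_iota => /(_ k17)/eqP->; rewrite scale0r.
Qed.

Lemma lie_semi_inv_nil z n : lpow (ad z) n.+2 = 0 -> inf_inv X z -> lie_of_group semi_inv_group (ad z).
Proof.
move=> nilz iz; have <- : divpow (ad z) 1 = ad z by apply/lfunP => x; rewrite divpow1.
apply: (@lie_of_group_curve _ _ _ n).
  by apply/lfunP => x; rewrite divpow0 id_lfunE.
move=> s _; exact: lexp_semi_inv.
Qed.

Lemma lie_semi_invX m : (m < 13)%N -> lie_of_group semi_inv_group (ad X`_m).
Proof.
move=> m13; apply: (@lie_semi_inv_nil _ 2); first exact: nilX.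
by apply: inf_invX => //; apply: leq_trans m13 _.
Qed.

(* Writes h0 as a combination of ad-nilpotent elements: this is [exp (ad e0) f]. *)
Definition nilp_h0 := X`_0 + X`_13 - X`_1.

Lemma lexp_e0_f : lexp (ad X`_1) 2 1 X`_0 = nilp_h0.
Proof.
rewrite (lexpE (nilX (isT : (1 < 13)%N)) _ _ (leqnn _)) !big_ord_recl big_ord0.
rewrite divpow0 /= !expr1n !scale1r /divpow !scale_lfunE.
rewrite -[bump 0 0]/1%N -[bump 0 _]/2%N -[bump 0 _]/3%N.
have E1 : lpow (ad X`_1) 1 X`_0 = X`_13.
  by rewrite lpowS lpow0 adE brX //= scale1r.
have E2 : lpow (ad X`_1) 2 X`_0 = - (2%:R *: X`_1).
  by rewrite lpowS E1 adE brX //= -scaleNr; congr (_ *: _).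
have E3 : lpow (ad X`_1) 3 X`_0 = 0.
  by rewrite lpowS E2 linearN linearZ /= adE liexx scaler0 oppr0.
rewrite E1 E2 E3 scaler0 !addr0 invr1 scale1r scalerN scalerA mulVf ?scale1r.
  by rewrite /nilp_h0 addrA.
by rewrite pchar0_natr_eq0.
Qed.

(** Conjugation by the automorphism [exp (ad e0)] carries [ad f] to [ad nilp_h0]. *)
Lemma nilpotent_nilp_h0 : lpow (ad nilp_h0) 4 = 0.
Proof.
set E := lexp (ad X`_1) 2 1; have [kE mE] : lie_aut E by apply: lexp_aut => //; apply: nilX.
have EX n x : lpow (ad nilp_h0) n (E x) = E (lpow (ad X`_0) n x).
  elim: n => [|n IHn]; first by rewrite !lpow0.
  by rewrite !lpowS IHn !adE mE -lexp_e0_f.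
apply/lfunP => x; rewrite zero_lfunE -[x](lker0_lfunVK kE) EX.
by rewrite (nilX (isT : (0 < 13)%N)) zero_lfunE linear0.
Qed.

Lemma lie_semi_inv_h0 : lie_of_group semi_inv_group (ad X`_13).
Proof.
have -> : ad X`_13 = ad nilp_h0 + ((-1) *: ad X`_0 + ad X`_1).
  rewrite -!linearZ -!linearD /=; congr (ad _).
  by rewrite scaleN1r /nilp_h0 [X`_0 + X`_13]addrC -addrA [- X`_1 + _]addrCA addNr addr0 addrK.
apply: lie_of_groupD; last first.
  by apply: lie_of_groupD; [apply: lie_of_groupZ|]; apply: lie_semi_invX.
apply: (@lie_semi_inv_nil _ 2); first exact: nilpotent_nilp_h0.
have iX m : (m < 14)%N -> inf_inv X X`_m by apply: inf_invX.
rewrite /nilp_h0; have -> : X`_0 + X`_13 - X`_1 = (-1) *: X`_1 + (1 *: X`_0 + X`_13).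
  by rewrite scale1r scaleN1r addrC.
by apply: inf_inv_lin; [apply: iX|apply: inf_inv_lin; apply: iX].
Qed.

(** [D] is both a derivation and a projection, so [1 + s D] multiplies its fixed vectors by [1 + s]
    and is an automorphism: a torus element linear in [s], where an exponential would not be
    polynomial. *)
Lemma lie_semi_inv_torus m : (13 < m < 17)%N -> lie_of_group semi_inv_group (ad X`_m).
Proof.
case/andP=> m14 m17; pose D := ad X`_m.
have DX k : (k < 17)%N -> D X`_k = (torus_weight m k)%:~R *: X`_k.
  move=> k17; rewrite /D adE brX // /br (ltnW m14) /torus_weight; case: ifP => //= _.
  by rewrite !scale0r.
have DD x : D (D x) = D x.
  rewrite -comp_lfunE; congr (fun_of_lfun _ x); apply: lfun_basis_eq => k k17.
  rewrite comp_lfunE DX // linearZ /= DX // scalerA -rmorphM; congr (_%:~R *: _).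
  have /allP/(_ m) := torus_weight01; rewrite mem_iota m14 => /(_ m17)/allP/(_ k).
  by rewrite mem_iota => /(_ k17)/eqP.
pose c (k : nat) : 'End(L) := if k == 0%N then \1%VF else if k == 1%N then D else 0.
apply: (@lie_of_group_curve _ _ _ 0 c) => // s ns1.
rewrite !big_ord_recl big_ord0 /= expr0 expr1 scale1r addr0 /c /=.
set phi := (_ + _); have phiE x : phi x = x + s *: D x.
  by rewrite /phi add_lfunE scale_lfunE id_lfunE.
have nz1s : 1 + s != 0 by apply: contra ns1; rewrite addrC addr_eq0.
split.
  split=> [|x y].
    rewrite -subv0; apply/subvP => x; rewrite memv_ker memv0 phiE => /eqP E.
    have: (1 + s) *: D x = 0.
      by rewrite scalerDl scale1r -{2}DD -linearZ -linearD /= E linear0.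
    move/eqP; rewrite scaler_eq0 (negPf nz1s) /= => /eqP Dx0.
    by rewrite -E Dx0 scaler0 addr0.
  have Dlie u v : D (lie u v) = lie (D u) v + lie u (D v) by rewrite /D !adE lie_lier.
  (* A bracket of two vectors of eigenvalue 1 would have eigenvalue 2: comparing [D (D (lie x y))]
     with [D (lie x y)] leaves twice this bracket. *)
  have DuDv : lie (D x) (D y) = 0.
    apply: (scalerI (_ : 2%:R != 0)); first by rewrite pchar0_natr_eq0.
    rewrite scaler0 scaler_nat mulr2n; have := DD (lie x y).
    rewrite !Dlie linearD /= !Dlie !DD.
    by rewrite -addrA => /addrI; rewrite addrA -{2}[lie x (D y)]add0r => /addIr.
  rewrite !phiE Dlie lieDl !lieDr !lieZl !lieZr DuDv !scaler0 addr0 -!addrA.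
  by congr (_ + _); rewrite scalerDr addrC.
have cfE f k : (k < 17)%N -> cf (f \o phi)%VF k = (1 + s * (torus_weight m k)%:~R) * cf f k.
  move=> k17; rewrite /cf comp_lfunE phiE DX // scalerA -{1}[X`_k]scale1r -scalerDl linearZ.
  by [].
(* T has weight 2 under each outer coweight and B has weight 4, so T^2 and B scale alike. *)
exists ((1 + s) ^+ 4) => f; rewrite /fA /fT /fB (eq_pT (cfE f)) (eq_pB (cfE f)).
suff [-> ->] : pT (fun k => (1 + s * (torus_weight m k)%:~R) * cf f k) = (1 + s) ^+ 2 * pT (cf f)
   /\ pB (fun k => (1 + s * (torus_weight m k)%:~R) * cf f k) = (1 + s) ^+ 4 * pB (cf f).
  by split=> //; ring.
rewrite /pT /pB /pH1 /pH2 /pH3 /torus_weight /h_weight.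
have: m \in iota 14 3 by rewrite mem_iota m14.
rewrite !inE => /or3P[] /eqP-> /=; split; ring.
Qed.


End SemiInvariantGroup.

(** * Generic stabilizers and the contradiction *)

Section Stabilizers.

Variables (K : closedFieldType) (L : lieAlgType K) (X : 17.-tuple L).
Hypothesis charK : [pchar K] =i pred0.
Hypothesis basisX : basis_of fullv X.
Hypothesis brX : forall i j, (i < 17)%N -> (j < 17)%N ->
  lie X`_i X`_j = (br i j).1%:~R *: X`_(br i j).2.
Implicit Types (f g d : 'Dual(L)) (x y z : L) (s : K).

Local Notation semi_inv_group := (semi_inv_group X).
Local Notation cf := (cf X).
Local Notation fA := (fA X).
Local Notation fB := (fB X).
Local Notation fY := (fY X).

Lemma lie_semi_inv_ad x : lie_of_group semi_inv_group (ad x).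
Proof.
have l0 : lie_of_group semi_inv_group 0.
  rewrite -[0](scale0r (ad X`_0)); apply: lie_of_groupZ; exact: lie_semi_invX.
elim/(basis_ind basisX): x => [c x y lx ly||k k17].
- by rewrite linearD linearZ; apply: lie_of_groupD => //; apply: lie_of_groupZ.
- by rewrite linear0.
have [k13 | k13 | ->] := ltngtP k 13; [exact: lie_semi_invX| |exact: lie_semi_inv_h0].
by apply: lie_semi_inv_torus => //; rewrite k13.
Qed.

Definition i11 : 'I_17 := inord 11.
Definition x11 x : K := coord X i11 x.

(* The entry added at b makes the Kirillov matrix invertible at generic [f]; the stabilizer
   of [f] is then at most a line, not contained in the hyperplane [x11 = 0]. *)
Definition kirillov_mx f : 'M[K]_17 :=
  \matrix_(i, j) ((f (lie X`_i X`_j) : K) + ((i == i11) && (j == i11))%:R).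

Definition kirillov_det f := \det (kirillov_mx f).

Lemma x11Z c x : x11 (c *: x) = c * x11 x.
Proof. by rewrite /x11 linearZ. Qed.

Lemma x11B x y : x11 (x - y) = x11 x - x11 y.
Proof. by rewrite /x11 linearB. Qed.

Lemma mul_kirillov_mx (v : 'rV[K]_17) f j :
  (v *m kirillov_mx f) 0 j = f (lie (\sum_k v 0 k *: X`_k) X`_j) + v 0 i11 * (j == i11)%:R.
Proof.
rewrite mxE lie_anti linearN linear_sum linear_sum -sumrN /=.
rewrite [X in _ = _ + X](_ : _ = \sum_k v 0 k * ((k == i11) && (j == i11))%:R).
  rewrite -big_split; apply: eq_bigr => k _ /=.
  by rewrite mxE mulrDr lieZr linearZ /= [lie X`_j _]lie_anti linearN /= scalerN opprK.
rewrite (bigD1 i11) //= eqxx big1 ?addr0 // => k nk.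
by rewrite (negPf nk) mulr0.
Qed.

Lemma stab_x11 f x : kirillov_det f != 0 -> x \in form_stab f -> x11 x = 0 -> x = 0.
Proof.
move=> nzD /form_stabP fx x0; pose v : 'rV[K]_17 := \row_k coord X k x.
have Ex : x = \sum_k v 0 k *: X`_k.
  by rewrite {1}(coord_basis basisX (memvf x)); apply: eq_bigr => k _; rewrite mxE.
have vM : v *m kirillov_mx f = 0.
  apply/rowP => j; rewrite mul_kirillov_mx -Ex fx add0r !mxE.
  by rewrite -/(x11 x) x0 mul0r.
have v0 : v = 0.
  by apply: (can_inj (mulmxK (_ : kirillov_mx f \in unitmx))); rewrite ?unitmxE ?unitfE // vM mul0mx.
by rewrite Ex big1 // => k _; rewrite v0 mxE scale0r.
Qed.

Lemma stab_line f x y : kirillov_det f != 0 -> x \in form_stab f -> y \in form_stab f ->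
  x11 x *: y = x11 y *: x.
Proof.
move=> nzD fx fy; apply/eqP; rewrite -subr_eq0; apply/eqP; apply: (stab_x11 nzD).
  by rewrite memvB ?memvZ.
by rewrite x11B !x11Z mulrC subrr.
Qed.

Definition line_cf f d k : {poly K} := (cf f k)%:P + cf d k *: 'X.

Lemma line_cfE f d s k : (line_cf f d k).[s] = cf (f + s *: d) k.
Proof.
by rewrite /line_cf !hornerE /cf add_lfunE scale_lfunE mulrC.
Qed.

Lemma line_T f d s : (pT (line_cf f d)).[s] = pT (cf (f + s *: d)).
Proof. by rewrite horner_pT; apply: eq_pT => k _; rewrite line_cfE. Qed.

Lemma line_B f d s : (pB (line_cf f d)).[s] = fB (f + s *: d).
Proof. by rewrite horner_pB; apply: eq_pB => k _; rewrite line_cfE. Qed.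

Lemma eq_pY (F G : nat -> K) k : (forall k, (k < 17)%N -> F k = G k) -> pY F k = pY G k.
Proof. by move=> E; rewrite /pY (eq_pT E) (eq_pB E) (eq_dT k E) (eq_dB k E). Qed.

Lemma line_Y f d s k : (pY (line_cf f d) k).[s] = pY (cf (f + s *: d)) k.
Proof.
by rewrite horner_pY; apply: eq_pY => j _; rewrite line_cfE.
Qed.

Lemma line_D f d : exists p : {poly K}, forall s, p.[s] = kirillov_det (f + s *: d).
Proof.
pose A := \matrix_(i < 17, j < 17) (((kirillov_mx f) i j)%:P + (d (lie X`_i X`_j) : K) *: 'X).
exists (\det A) => s; rewrite -/(horner_eval s _) -det_map_mx; congr (\det _).
apply/matrixP => i j; rewrite 2!mxE /= /horner_eval hornerD hornerZ hornerC hornerX !mxE add_lfunE scale_lfunE.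
by rewrite addrAC mulrC.
Qed.

Lemma coord_comb v (i : 'I_17) : coord X i (comb X v) = v i.
Proof.
rewrite /comb /table_range -[iota 0 17]/(index_iota 0 17) big_mkord.
by rewrite coord_sum_free // (basis_free basisX).
Qed.

Lemma x11_fY f : x11 (fY f) = pY (cf f) 11.
Proof. by rewrite /x11 coord_comb inordK. Qed.

Lemma fY_euler f : (f (fY f) : K) = 0.
Proof. by rewrite app_comb Euler_Y. Qed.

(* On the line through two forms with the same stabilizer, the covector [fY] stays in that
   stabilizer, which both forms annihilate; hence T^2/B is constant along it. *)
Lemma ratio_const f2 f3 : form_stab f2 = form_stab f3 -> kirillov_det f2 != 0 -> pY (cf f2) 11 != 0 ->
  fB f2 != 0 -> fA f3 * fB f2 = fA f2 * fB f3.
Proof.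
move=> eqS nzD nzY nzB; pose d := f3 - f2; pose P := line_cf f2 d.
pose fs s := f2 + s *: d; pose x := fY f2.
have x2 : x \in form_stab f2 by apply: fY_stab.
have xs s : x \in form_stab (fs s).
  apply/form_stabP => y; rewrite /fs add_lfunE scale_lfunE add_lfunE opp_lfunE.
  have /form_stabP -> := x2; have : x \in form_stab f3 by rewrite -eqS.
  by move/form_stabP->; rewrite subr0 add0r scaler0.
have nzx : x11 x != 0 by rewrite x11_fY.
have [D DE] := line_D f2 d.
(* Up to the factor T / B^2, this is the derivative of T^2/B along the line. *)
pose W := 2%:R * (pT P)^`() * pB P - pT P * (pB P)^`().
have WE s : W.[s] = d (fY (fs s)).
  rewrite app_comb lin_Y /W horner_2MB deriv_pT deriv_pB !horner_lin line_T line_B.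
  have dP k : ((P k)^`()).[s] = cf d k.
    by rewrite /P /line_cf derivD derivC add0r derivZ derivX hornerZ hornerC mulr1.
  have -> : lin (fun k => ((P k)^`()).[s]) (fun k => (dT P k).[s]) = lin (cf d) (dT (cf (fs s))).
    apply: eq_bigr => k _; rewrite dP horner_dT; congr (_ * _); apply: eq_dT => j _.
    exact: line_cfE.
  have -> : lin (fun k => ((P k)^`()).[s]) (fun k => (dB P k).[s]) = lin (cf d) (dB (cf (fs s))).
    apply: eq_bigr => k _; rewrite dP horner_dB; congr (_ * _); apply: eq_dB => j _.
    exact: line_cfE.
  by rewrite /fs /fB; ring.
have W0 : W = 0.
  (* The factor [D] drops the parameters where the stabilizer may fail to be a line, and ['X] drops
     0, where [fs s x = s * d x] gives no information on [d x]. *)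
  have : 'X * W * D = 0.
    apply: poly_eq0P => s; rewrite !hornerM hornerX WE.
    have [-> | nzDs] := eqVneq D.[s] 0; first by rewrite mulr0.
    rewrite DE in nzDs; have E := stab_line nzDs (xs s) (fY_stab basisX brX (fs s)).
    have E1 := congr1 (fun u : L => fs s u : K) E.
    have E2 := congr1 (fun u : L => d u : K) E.
    rewrite !linearZ /= -![_ *: _]/(_ * _) fY_euler mulr0 in E1.
    rewrite !linearZ /= -![_ *: _]/(_ * _) in E2.
    have fsx : (fs s x : K) = s * d x.
      by rewrite /fs add_lfunE scale_lfunE fY_euler add0r.
    apply/eqP; rewrite mulf_eq0; apply/orP; left.
    have: x11 x * (s * d (fY (fs s))) == 0.
      rewrite mulrCA E2 mulrCA -fsx -E1.
      by [].
    by rewrite mulf_eq0 (negPf nzx).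
  move/eqP; rewrite !mulf_eq0 polyX_eq0 /= => /orP[/eqP // | /eqP D0].
  by move: nzD; rewrite -[f2]addr0 -(scale0r d) -DE D0 horner0 eqxx.
have E2 : ((pT P) ^+ 2)^`() * pB P = (pT P) ^+ 2 * (pB P)^`().
  rewrite expr2 derivM; apply/eqP; rewrite -subr_eq0; apply/eqP.
  by rewrite -[RHS](mulr0 (pT P)) -W0 /W; ring.
have nzB0 : (pB P).[0] != 0 by rewrite line_B scale0r addr0.
have := poly_log_deriv charK nzB0 E2 1.
rewrite !horner_exp !line_T !line_B scale0r addr0 scale1r /d addrC subrK.
by [].
Qed.

Definition good f := [&& fB f != 0, kirillov_det f != 0 & pY (cf f) 11 != 0].

Lemma good_line f d : exists p : {poly K}, forall s, (p.[s] != 0) = good (f + s *: d).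
Proof.
have [D DE] := line_D f d.
exists (pB (line_cf f d) * D * pY (line_cf f d) 11) => s.
by rewrite hornerM [(pB _ * D).[_]]hornerM line_B DE line_Y 2!mulf_eq0 !negb_or -andbA.
Qed.

(** A single good form suffices: by [good_line], on any line through it only finitely many
    parameters are bad. *)
Lemma good_base_point : good (dform X (base_point 1)).
Proof.
set f := dform X (base_point 1).
have cfE k : (k < 17)%N -> cf f k = base_point 1 k by apply: cf_dform.
rewrite /good fB_base_point // oner_eq0 /=; apply/andP; split; last first.
  (* Here T = B = 1, while the partial derivatives with respect to b are 2 for T and 3 for B: the
     entry is 2 * 2 - 3. *)
  rewrite (eq_pY 11 cfE) /pY /pT /pB /pH1 /pH2 /pH3 /dT /dB /dH1 /dH2 /dH3 /pH1 /pH2 /pH3 /base_point /=.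
  rewrite (_ : _ + _ = 1); first exact: oner_neq0.
  ring.
apply/det0P => -[v nzv vM].
pose w k := v 0 (inord k).
have Ev : \sum_k v 0 k *: X`_k = comb X w.
  rewrite /comb /table_range -[iota 0 17]/(index_iota 0 17) big_mkord.
  by apply: eq_bigr => i _; rewrite /w inord_val.
have E' j : (j < 17)%N -> (f (lie (comb X w) X`_j) : K) = - (w 11%N * (j == 11%N)%:R).
  move=> j17; have := congr1 (fun u : 'rV_17 => u 0 (Ordinal j17)) vM.
  rewrite mul_kirillov_mx Ev mxE => /eqP; rewrite addr_eq0 => /eqP ->.
  by congr (- (_ * _%:R)); rewrite -val_eqE /= inordK.
(* When the kernel vector is paired with itself, the alternating part vanishes and the added entry
   leaves the square of [w 11]. The vector then lies in the stabilizer. *)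
have w11 : w 11%N = 0.
  apply/eqP; rewrite -[_ == 0]orbb -mulf_eq0 -oppr_eq0.
  have <- : (f (lie (comb X w) (comb X w)) : K) = - (w 11%N * w 11%N).
    rewrite {2}/comb !linear_sum big_seq.
    rewrite (eq_bigr (fun k => w k * - (w 11%N * (k == 11%N)%:R))) => [|k].
      by rewrite -big_seq /table_range !big_cons big_nil /=; ring.
    by rewrite mem_table_range => k17; rewrite /= lieZr linearZ /= E'.
  by rewrite liexx linear0.
have E j : (j < 17)%N -> \sum_(k <- table_range) w k * brF (base_point 1) k j = 0.
  move=> j17; have := E' j j17; rewrite w11 mul0r oppr0 => E0; apply: etrans E0.
  rewrite lie_anti linearN linear_sum linear_sum -sumrN big_seq [RHS]big_seq.
  apply: eq_bigr => k; rewrite mem_iota => /andP[_ k17] /=.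
  rewrite lieZr linearZ /= [lie X`_j _]lie_anti linearN /= scalerN opprK cf_lie //.
  rewrite /brF cfE //; exact: br_lt.
(* Up to order the linear system is triangular: each equation yields one coordinate from those
   already found to vanish. *)
have w0 := E 12%N isT; have w2 := E 8%N isT; have w3 := E 9%N isT; have w4 := E 10%N isT.
have S1 := E 1%N isT; have S5 := E 5%N isT; have S6 := E 6%N isT; have S7 := E 7%N isT.
have S2 := E 2%N isT; have S3 := E 3%N isT; have S4 := E 4%N isT; have S0 := E 0%N isT.
have S14 := E 14%N isT; have S15 := E 15%N isT; have S16 := E 16%N isT; have S13 := E 13%N isT.
move: w0 w2 w3 w4 S1 S5 S6 S7 S2 S3 S4 S0 S14 S15 S16 S13.
rewrite /table_range !big_cons !big_nil /brF /br /base_point /h_weight /=.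
rewrite !(mulr0z, mulr1z, mulrN1z, mul0r, mulr0, add0r, addr0, mulr1, mulrN, mulN1r) w11.
move=> w0 w2 w3 w4; rewrite w2 w3 w4 oppr0 !add0r => /eqP; rewrite mulf_eq0 pchar0_natr_eq0 // orbF.
move/eqP=> w13; rewrite w13 !add0r => w14 w15 w16 e8 e9 e10 /eqP; rewrite oppr_eq0 => /eqP w12.
rewrite !addr0 => e5 e6 e7; rewrite e5 e6 e7 !addr0 => /eqP.
rewrite oppr_eq0 mulf_eq0 pchar0_natr_eq0 // orbF => /eqP w1; rewrite w1 !add0r in e8 e9 e10.
have opp0 (a : K) : - a = 0 -> a = 0 by move/eqP; rewrite oppr_eq0 => /eqP.
have w5 := opp0 _ e5; have w6 := opp0 _ e6; have w7 := opp0 _ e7.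
have w8 := opp0 _ e8; have w9 := opp0 _ e9; have w10 := opp0 _ e10.
case/eqP: nzv; apply/rowP => i; rewrite mxE -[i in v 0 i]inord_val -/(w i).
have: (i : nat) \in table_range by rewrite mem_table_range.
rewrite /table_range !inE.
by do 16! [case/predU1P => [-> //|]]; move/eqP->.
Qed.

Theorem table_no_stable : ~ exists f : 'Dual(L), stable f.
Proof.
case=> f [N [U [openU Uf UN]] stabN].
have adG phi : alg_adjoint_group phi -> semi_inv_group phi.
  by apply; [apply: semi_inv_group_algebraic | apply: lie_semi_inv_ad].
pose g1 := dform X (base_point 1).
have [_ grp1 grpM grpV _] : algebraic_subgroup semi_inv_group by apply: semi_inv_group_algebraic.
(* On the line from [f] to a good form, membership in [U] and goodness both hold off finitely many
   parameters. *)
apply: (zariski_open_line (d := g1 - f) openU Uf) => p p0 pU.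
have [q qE] := good_line f (g1 - f).
have nzpq : p * q != 0.
  rewrite mulf_neq0 //.
    by apply: contraNneq p0 => ->; rewrite horner0.
  have: q.[1] != 0 by rewrite qE scale1r addrC subrK good_base_point.
  by apply: contraNneq => ->; rewrite horner0.
have [s] := closed_nonrootP _ nzpq; rewrite /root hornerM mulf_eq0 negb_or => /andP[ps qs].
set f1 := f + s *: (g1 - f) in qE; have Uf1 : U f1 by apply: pU.
have gf1 : good f1 by rewrite -qE.
have /and3P[nzB1 nzD1 nzY1] := gf1.
(* The ratio at the base point with parameter [e] is [e ^+ 2], and 0 and 1 cannot both be the ratio
   at [f1]. *)
have [e nze] : exists e : K, fA (dform X (base_point e)) * fB f1 != fA f1 * fB (dform X (base_point e)).
  have [E | ] := eqVneq (fA (dform X (base_point 1)) * fB f1) (fA f1 * fB (dform X (base_point 1))).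
    exists 0; apply/eqP => E'; case/eqP: nzB1.
    move: E E'; rewrite !fB_base_point // !mulr1 => <-.
    by rewrite /fA !fT_base_point // expr1n expr0n mul0r mul1r => ->.
  by exists 1.
set g := dform X (base_point e) in nze.
apply: (zariski_open_line (d := g - f1) openU Uf1) => p' p'0 p'U.
have [q' q'E] := good_line f1 (g - f1).
(* Cross-multiplied difference between the ratio on the line and the ratio at [f1]; it is nonzero at
   parameter 1, that is, at [g]. *)
pose c := pT (line_cf f1 (g - f1)) ^+ 2 * (fB f1)%:P - (fA f1)%:P * pB (line_cf f1 (g - f1)).
have cE t : c.[t] = fA (f1 + t *: (g - f1)) * fB f1 - fA f1 * fB (f1 + t *: (g - f1)).
  have H (a r : {poly K}) (u v : K) : (a ^+ 2 * u%:P - v%:P * r).[t] = a.[t] ^+ 2 * u - v * r.[t].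
    by rewrite !horner_ringE !hornerC.
  by rewrite /c H line_T line_B.
have nzc : p' * q' * c != 0.
  rewrite !mulf_neq0 //.
  - by apply: contraNneq p'0 => ->; rewrite horner0.
  - have: q'.[0] != 0 by rewrite q'E scale0r addr0.
    by apply: contraNneq => ->; rewrite horner0.
  have: c.[1] != 0 by rewrite cE scale1r [f1 + _]addrC subrK subr_eq0.
  by apply: contraNneq => ->; rewrite horner0.
have [t] := closed_nonrootP _ nzc.
rewrite /root !hornerM !mulf_eq0 !negb_or -andbA => /and3P[p't q't ct].
set f2 := f1 + t *: (g - f1) in q'E cE; have Uf2 : U f2 by apply: p'U.
have /and3P[nzB2 nzD2 nzY2] : good f2 by rewrite -q'E.
have [phi1 /adG G1 S1] := stabN f1 (UN _ Uf1).
have [phi2 /adG G2 S2] := stabN f2 (UN _ Uf2).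
pose phi := (phi2 \o phi1^-1)%VF.
have Gphi : semi_inv_group phi by apply: grpM => //; apply: grpV.
have [[k1 _] _] := G1.
have Sphi : form_stab f2 = (phi @: form_stab f1)%VS.
  by rewrite S1 S2 -limg_comp -comp_lfunA lker0_compVf // comp_lfun1r.
have [[kphi mphi] [a aP]] := Gphi.
(* The transport of [f1] by [phi] has the ratio of [f1] and the stabilizer of [f2], so that
   [ratio_const] applies to it and [f2]. *)
pose f3 := (f1 \o phi^-1)%VF.
have Ef1 : (f3 \o phi)%VF = f1 by rewrite -comp_lfunA lker0_compVf // comp_lfun1r.
have [A31 B31] := aP f3; rewrite Ef1 in A31 B31.
have S3 : form_stab f2 = form_stab f3.
  rewrite Sphi; apply/vspaceP => x; apply/idP/idP.
    case/memv_imgP => y /form_stabP fy ->; apply/form_stabP => z.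
    by rewrite comp_lfunE -[z](lker0_lfunVK kphi) -mphi lker0_lfunK // fy.
  move/form_stabP => f3x; rewrite -[x](lker0_lfunVK kphi) memv_img //.
  apply/form_stabP => y; have := f3x (phi y).
  by rewrite comp_lfunE -{1}[x](lker0_lfunVK kphi) -mphi lker0_lfunK.
have E := ratio_const S3 nzD2 nzY2 nzB2.
case/negP: ct; rewrite cE A31 B31 subr_eq0; apply/eqP.
rewrite mulrCA -[RHS]mulrA; congr (_ * _).
by rewrite E.
Qed.

End Stabilizers.

(** * The bracket table from a Chevalley basis *)

(** The vectors may be 0. Applying [f - c i] removes one term and turns the others into nonzero
    multiples of themselves. *)
Lemma eigen_sum_eq0 (K : fieldType) (V : vectType K) (I : eqType) (f : 'End(V)) (c : I -> K)
    (v : I -> V) (r : seq I) :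
  uniq [seq c i | i <- r] -> (forall i, f (v i) = c i *: v i) ->
  \sum_(i <- r) v i = 0 -> {in r, forall i, v i = 0}.
Proof.
move=> + fv; elim: r v fv => // i r IHr v fv /= /andP[ci uc]; rewrite big_cons => E.
have rv0 : {in r, forall j, v j = 0}.
  move=> j rj; have nz : c j - c i != 0.
    by rewrite subr_eq0; apply: contraNneq ci => <-; apply: map_f.
  apply: (scalerI nz); rewrite scaler0; move: j rj {nz}.
  apply: (IHr (fun j => (c j - c i) *: v j)) => //.
    by move=> j; rewrite linearZ /= fv !scalerA mulrC.
  have := congr1 f E; rewrite linear0 linearD /= fv linear_sum /=.
  rewrite (eq_bigr _ (fun j _ => fv j)); move: E => /eqP; rewrite addr_eq0 => /eqP ->.
  rewrite scalerN scaler_sumr addrC => E.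
  by rewrite -[RHS]E -sumrB; apply: eq_bigr => j _; rewrite scalerBl.
move=> j; rewrite inE => /predU1P[-> | /rv0 //].
by move: E; rewrite big_seq big1 ?addr0 // => k /rv0.
Qed.

(* Coordinates with respect to [Pi]: the second one is that of the central node. *)
Definition p_weight (k : nat) : int * int * int * int :=
  nth (0, 0, 0, 0) [:: (0, -1, 0, 0); (0, 1, 0, 0); (1, 0, 0, 0); (0, 0, 1, 0); (0, 0, 0, 1);
    (1, 1, 0, 0); (0, 1, 1, 0); (0, 1, 0, 1); (0, 1, 1, 1); (1, 1, 0, 1); (1, 1, 1, 0);
    (1, 1, 1, 1); (1, 2, 1, 1)] k.

Definition weight_add (v w : int * int * int * int) := let: (v0, v1, v2, v3) := v in
  let: (w0, w1, w2, w3) := w in (v0 + w0, v1 + w1, v2 + w2, v3 + w3).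

Definition D4_nonroot (w : int * int * int * int) : bool := let: (w0, w1, w2, w3) := w in
  [&& ~~ D4_positive w0 w1 w2 w3, ~~ D4_positive (- w0) (- w1) (- w2) (- w3) &
    (w0 != 0) || (w1 != 0) || (w2 != 0) || (w3 != 0)].

(** Accounts for the zeros of the table: a bracket of distinct root vectors that is not listed has a
    weight that is neither 0 nor a root. *)
Lemma weight_add_nonroot : all (fun i => all (fun j =>
  [|| root_bracket i j != None, root_bracket j i != None, i == j |
    D4_nonroot (weight_add (p_weight i) (p_weight j))]) (iota 0 13)) (iota 0 13).
Proof. by vm_compute. Qed.

Definition weight_at (m : nat) (w : int * int * int * int) : int := let: (w0, w1, w2, w3) := w in
  nth 0 [:: 2 * w1 - w0 - w2 - w3; w0; w2; w3] (m - 13)%N.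

Lemma h_weightE : all (fun m => all (fun k => h_weight m k == weight_at m (p_weight k)) (iota 0 13)) (iota 13 4).
Proof. by vm_compute. Qed.

Section Chevalley.

Variables (K : closedFieldType) (L : lieAlgType K) (h : {vspace L}).
Hypothesis charK : [pchar K] =i pred0.
Variables (R : seq 'Dual(subvs_of h)) (Pi : 4.-tuple 'Dual(subvs_of h)).
Hypothesis simple_L : simple_lie L.
Hypothesis cartan_h : cartan_subalgebra h.
Hypothesis root_R : root_system R.
Hypothesis base_Pi : root_base R Pi.
Hypothesis typeD4 : has_cartan_matrix R Pi cartan_D4.
Implicit Types (x y z s t : L) (a b : 'Dual(subvs_of h)).

Local Notation simple_comb := (simple_comb Pi).
Local Notation nondegL := (nondegL charK simple_L cartan_h root_R base_Pi typeD4).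
Local Notation root_line := (root_line charK simple_L cartan_h root_R base_Pi typeD4).
Local Notation opp_root := (opp_root charK simple_L cartan_h root_R base_Pi typeD4).

Lemma lie_root a b x y : x \in root_space a -> y \in root_space b -> lie x y \in root_space (a + b).
Proof.
move=> xa yb; apply/root_lieP => z hz; rewrite lie_lier (root_lie xa hz) (root_lie yb hz).
by rewrite lieZl lieZr -scalerDl /wt add_lfunE.
Qed.

Lemma root_space_nonroot a x : a \notin R -> a != 0 -> x \in root_space a -> x = 0.
Proof.
move=> nRa nza xa; apply/eqP; apply: contraNT nRa => nzx.
exact: (root_spaceN0 root_R xa).
Qed.

Definition wcomb (w : int * int * int * int) := let: (w0, w1, w2, w3) := w in simple_comb w0 w1 w2 w3.

Lemma wcombD v w : wcomb v + wcomb w = wcomb (weight_add v w).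
Proof. by case: v w => [[[v0 v1] v2] v3] [[[w0 w1] w2] w3]; rewrite /= simple_combD. Qed.

Lemma nonroot w x : D4_nonroot w -> x \in root_space (wcomb w) -> x = 0.
Proof.
case: w => [[[w0 w1] w2] w3] /and3P[np nn nz]; apply: root_space_nonroot.
  apply/negP => Rw; have [p | n] := root_coefs_sign charK base_Pi typeD4 Rw.
    by rewrite (root_coefs_positive charK simple_L cartan_h root_R base_Pi typeD4 Rw p) in np.
  have Rn := opp_root Rw; rewrite /= simple_combN in Rn.
  have := root_coefs_positive charK simple_L cartan_h root_R base_Pi typeD4 Rn.
  by move/(_ _)=> E; rewrite E in nn => //; case: n => *; split; lia.
apply: contraL nz => /eqP/(simple_comb_eq0 charK typeD4)[-> -> -> ->].
by rewrite !eqxx.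
Qed.

Lemma simple_comb_neq0 w0 w1 w2 w3 : (w0 != 0) || (w1 != 0) || (w2 != 0) || (w3 != 0) -> simple_comb w0 w1 w2 w3 != 0.
Proof.
by apply: contraL => /eqP/(simple_comb_eq0 charK typeD4)[-> -> -> ->]; rewrite !eqxx.
Qed.

Lemma h_abelian s t : s \in h -> t \in h -> lie s t = 0.
Proof.
move=> hs ht; have hst : lie s t \in h by apply: memh_lie.
apply: (h_weights0 charK cartan_h root_R nondegL hst) => b Rb.
have [e nze eb] := root_vector root_R Rb.
apply/eqP; have := root_lie eb hst; rewrite lie_liel !(root_lie eb, lieZr) //.
rewrite !scalerA mulrC subrr => /esym/eqP.
by rewrite scaler_eq0 (negPf nze) orbF.
Qed.

Lemma h_simple_weights0 z : z \in h -> (forall j, (j < 4)%N -> wt Pi`_j z = 0) -> z = 0.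
Proof.
move=> hz z0; apply: (h_weights0 charK cartan_h root_R nondegL hz) => b.
case/(root_simple_comb base_Pi) => w0 [w1 [w2 [w3 ->]]].
by rewrite wt_simple_comb !z0 // !mulr0 !addr0.
Qed.

(** [y] is the bottom of its string, where [f] inverts [e] exactly; this shows brackets to be
    nonzero and normalizes those with [f]. *)
Lemma lie_raise a b e f y : f \in root_space (- a) -> lie e f \in h -> y \in root_space b ->
  lie f y = 0 -> wt b (lie e f) = -1 -> lie f (lie e y) = y.
Proof.
move=> fa hef yb fy wtb; rewrite lie_lier fy lie0r addr0 [lie f e]lie_anti lieNl.
by rewrite (root_lie yb hef) wtb scaleN1r opprK.
Qed.

(* For [g] in the root space of [b], [lie e f] acts on [lie e g] by [2 + lam], whereas
   [lie e (lie f (lie e g)) = - lam *: lie e g], with [lam] the value to be found. *)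
Lemma cartan_neg1 a b e f : b \in R -> e \in root_space a -> f \in root_space (- a) ->
  lie e f \in h -> wt a (lie e f) = 2%:R ->
  a + b \in R -> (forall x, x \in root_space (b - a) -> x = 0) ->
  (forall x, x \in root_space (a + (a + b)) -> x = 0) -> wt b (lie e f) = -1.
Proof.
move=> Rb ea fa hef wta Rab bma0 aab0.
have [g nzg gb] := root_vector root_R Rb; set lam := wt b (lie e f).
have fg : lie f g = 0 by apply: bma0; rewrite [b - a]addrC lie_root.
set w := lie e g; have wab : w \in root_space (a + b) by apply: lie_root.
have hw : lie f w = - (lam *: g).
  by rewrite /w lie_lier fg lie0r addr0 [lie f e]lie_anti lieNl (root_lie gb hef).
have ew : lie e w = 0 by apply: aab0; apply: lie_root.
have wtab : wt (a + b) (lie e f) = 2%:R + lam by rewrite /wt add_lfunE -wta.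
have hef_w v : v \in root_space (a + b) -> lie e v = 0 -> (2%:R + lam) *: v = lie e (lie f v).
  move=> vab ev; rewrite -wtab -(root_lie vab hef) lie_liel ev lie0r subr0.
  by [].
have [w0 | nzw] := eqVneq w 0.
  have lam0 : lam = 0.
    apply/eqP; have /eqP := hw; rewrite w0 lie0r eq_sym oppr_eq0 scaler_eq0.
    by rewrite (negPf nzg) orbF.
  have [r nzr rab] := root_vector root_R Rab.
  have er : lie e r = 0 by apply: aab0; apply: lie_root.
  have frb : lie f r \in root_space b by have := lie_root fa rab; rewrite addKr.
  have [mu Emu] := root_line Rb gb nzg frb.
  have := hef_w r rab er; rewrite Emu lieZr -/w w0 scaler0 lam0 addr0 => /eqP.
  by rewrite scaler_eq0 pchar0_natr_eq0 //= (negPf nzr).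
have := hef_w w wab ew; rewrite hw lieNr lieZr -/w => /eqP.
rewrite -addr_eq0 -scalerDl scaler_eq0 (negPf nzw) orbF => /eqP E.
have n2 : (2%:R : K) != 0 by rewrite pchar0_natr_eq0.
by apply: (mulfI n2); apply/eqP; rewrite -subr_eq0; apply/eqP; rewrite -[RHS]E; ring.
Qed.

Lemma cartan_zero b e f : b \in R -> lie e f \in h ->
  (forall x, x \in root_space b -> lie e x = 0) -> (forall x, x \in root_space b -> lie f x = 0) ->
  wt b (lie e f) = 0.
Proof.
move=> Rb hef e0 f0; have [g nzg gb] := root_vector root_R Rb.
have := root_lie gb hef; rewrite lie_liel (f0 g gb) (e0 g gb) !lie0r subr0 => /esym/eqP.
by rewrite scaler_eq0 (negPf nzg) orbF => /eqP.
Qed.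

Lemma Pi_wcomb i : (i < 4)%N -> Pi`_i = wcomb ((i == 0)%N%:Z, (i == 1)%N%:Z, (i == 2)%N%:Z, (i == 3)%N%:Z).
Proof. exact: Pi_simple_comb. Qed.

(** [root_sl2] only fixes the value 2 of the root itself at [lie e f]. The values of the other
    simple roots follow from which sums and differences of simple roots are roots, so that [lie e f]
    has the values of the coroot. *)
Lemma chevalley_triple i : (i < 4)%N -> exists e f, [/\ e != 0, e \in root_space Pi`_i,
  f \in root_space (- Pi`_i), lie e f \in h &
  forall j, (j < 4)%N -> wt Pi`_j (lie e f) = (cartan_D4 i j)%:~R].
Proof.
move=> i4; have Ri := simple_root base_Pi i4; have [e nze ea] := root_vector root_R Ri.
have [f [fa hef wta _ _]] := root_sl2 charK cartan_h root_R nondegL 0 Ri ea nze.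
exists e, f; split=> // j j4; have Rj := simple_root base_Pi j4.
have [<- | nij] := eqVneq i j; first by rewrite wta /cartan_D4 eqxx.
have sub0 x : x \in root_space (Pi`_j - Pi`_i) -> x = 0.
  rewrite (Pi_wcomb i4) (Pi_wcomb j4) /= simple_combN simple_combD.
  apply: (@nonroot (_, _, _, _)); move: nij.
  by case: i i4 {e nze ea f fa hef wta Ri} => [|[|[|[|//]]]] _;
     case: j j4 {Rj} => [|[|[|[|//]]]] _.
rewrite /cartan_D4 (negPf nij); case: ifP => adj.
  rewrite mulrNz mulr1z; apply: (cartan_neg1 Rj ea fa hef wta _ sub0).
    have R0 : simple_comb 1 0 0 0 \in R by have := simple_root base_Pi (isT : (0 < 4)%N); rewrite Pi_simple_comb.
    have R2 : simple_comb 0 0 1 0 \in R by have := simple_root base_Pi (isT : (2 < 4)%N); rewrite Pi_simple_comb.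
    have R3 : simple_comb 0 0 0 1 \in R by have := simple_root base_Pi (isT : (3 < 4)%N); rewrite Pi_simple_comb.
    (* Reflecting an outer simple root in the central one produces their sum. *)
    have [_ A0 _ _] := refl_simple_comb typeD4 R0; have [_ A2 _ _] := refl_simple_comb typeD4 R2.
    have [_ A3 _ _] := refl_simple_comb typeD4 R3.
    rewrite (Pi_wcomb i4) (Pi_wcomb j4) wcombD.
    move: nij adj; clear -i4 j4 A0 A2 A3.
    by case: i i4 => [|[|[|[|//]]]] _; case: j j4 => [|[|[|[|//]]]] _.
  move=> x; rewrite (Pi_wcomb i4) (Pi_wcomb j4) !wcombD; apply: nonroot.
  move: nij adj; clear -i4 j4.
  by case: i i4 => [|[|[|[|//]]]] _; case: j j4 => [|[|[|[|//]]]] _.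
apply: cartan_zero => // x xb; last first.
  by apply: sub0; rewrite addrC lie_root.
apply: (@nonroot (weight_add ((i == 0)%N%:Z, (i == 1)%N%:Z, (i == 2)%N%:Z, (i == 3)%N%:Z)
   ((j == 0)%N%:Z, (j == 1)%N%:Z, (j == 2)%N%:Z, (j == 3)%N%:Z))).
  move: nij adj; clear -i4 j4.
  by case: i i4 => [|[|[|[|//]]]] _; case: j j4 => [|[|[|[|//]]]] _.
by rewrite -wcombD -!Pi_wcomb // lie_root.
Qed.

End Chevalley.

(** Ordered by the way the bracket is computed: the definition of h0, the brackets with f, those
    defining v_i and t, those of the outer e_i, and those of v_i with s_i. *)
Definition root_pairs : seq (nat * nat) :=
  [:: (1, 0); (0, 5); (0, 6); (0, 7); (0, 12); (1, 2); (1, 3); (1, 4); (1, 11);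
      (2, 6); (2, 7); (3, 5); (3, 7); (4, 5); (4, 6); (2, 8); (3, 9); (4, 10);
      (5, 8); (6, 9); (7, 10)]%N.

Lemma root_pairsP : all (fun i => all (fun j =>
  (root_bracket i j != None) ==> ((i, j) \in root_pairs)) (iota 0 13)) (iota 0 13).
Proof. by vm_compute. Qed.

Section ChevalleyBasis.

Variables (K : closedFieldType) (L : lieAlgType K) (h : {vspace L}).
Hypothesis charK : [pchar K] =i pred0.
Variables (R : seq 'Dual(subvs_of h)) (Pi : 4.-tuple 'Dual(subvs_of h)).
Hypothesis simple_L : simple_lie L.
Hypothesis cartan_h : cartan_subalgebra h.
Hypothesis root_R : root_system R.
Hypothesis base_Pi : root_base R Pi.
Hypothesis typeD4 : has_cartan_matrix R Pi cartan_D4.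
Implicit Types (x y z s t : L) (a b : 'Dual(subvs_of h)).

Local Notation wcomb := (wcomb Pi).
Local Notation nonroot := (nonroot charK simple_L cartan_h root_R base_Pi typeD4).
Local Notation root_line := (root_line charK simple_L cartan_h root_R base_Pi typeD4).

Variables e f : nat -> L.
Hypothesis nze : forall i, (i < 4)%N -> e i != 0.
Hypothesis ea : forall i, (i < 4)%N -> e i \in root_space Pi`_i.
Hypothesis fa : forall i, (i < 4)%N -> f i \in root_space (- Pi`_i).
Hypothesis hef : forall i, (i < 4)%N -> lie (e i) (f i) \in h.
Hypothesis wtef : forall i j, (i < 4)%N -> (j < 4)%N ->
  wt Pi`_j (lie (e i) (f i)) = (cartan_D4 i j)%:~R.
Variable u : nat -> L.
Hypothesis hu : forall i, (i < 4)%N -> u i \in h.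
Hypothesis wtu : forall i j, (i < 4)%N -> (j < 4)%N -> wt Pi`_j (u i) = (j == i)%:R.

Let v1 := lie (e 1%N) (e 0%N).
Let v2 := lie (e 1%N) (e 2%N).
Let v3 := lie (e 1%N) (e 3%N).
Let s12 := lie (e 0%N) v2.
Let s13 := lie (e 0%N) v3.
Let s23 := lie (e 2%N) v3.
Let b := lie (e 0%N) s23.
Let t := lie (e 1%N) b.
Let h0 := lie (e 1%N) (f 1%N).

(** All positive root vectors but the simple ones are iterated brackets, taken in the order that
    makes the listed structure constants 1. The labels 1, 2, 3 stand for the outer nodes 0, 2, 3,
    and [s23] is s_1, named by the labels it contains. *)
Definition chev_seq : seq L := [:: f 1%N; e 1%N; e 0%N; e 2%N; e 3%N; v1; v2; v3;
  s23; s13; s12; b; t; h0; u 0%N; u 2%N; u 3%N].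

Local Notation X := chev_seq.

Lemma Pi_wcombE : [/\ Pi`_0 = wcomb (1, 0, 0, 0), Pi`_1 = wcomb (0, 1, 0, 0), Pi`_2 = wcomb (0, 0, 1, 0)
  & Pi`_3 = wcomb (0, 0, 0, 1)].
Proof. by split; rewrite Pi_simple_comb. Qed.

Lemma e_root : [/\ e 0%N \in root_space (wcomb (1, 0, 0, 0)), e 1%N \in root_space (wcomb (0, 1, 0, 0)),
  e 2%N \in root_space (wcomb (0, 0, 1, 0)) & e 3%N \in root_space (wcomb (0, 0, 0, 1))].
Proof. by have [<- <- <- <-] := Pi_wcombE; split; apply: ea. Qed.

Lemma f_root : [/\ f 0%N \in root_space (wcomb (-1, 0, 0, 0)), f 1%N \in root_space (wcomb (0, -1, 0, 0)),
  f 2%N \in root_space (wcomb (0, 0, -1, 0)) & f 3%N \in root_space (wcomb (0, 0, 0, -1))].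
Proof.
have [E0 E1 E2 E3] := Pi_wcombE.
have N w0 w1 w2 w3 : wcomb (- w0, - w1, - w2, - w3) = - wcomb (w0, w1, w2, w3) by rewrite /= simple_combN.
split; [have := fa (isT : (0 < 4)%N) | have := fa (isT : (1 < 4)%N)
  | have := fa (isT : (2 < 4)%N) | have := fa (isT : (3 < 4)%N)];
  by rewrite ?E0 ?E1 ?E2 ?E3 -N !oppr0.
Qed.

Lemma lie_wcomb v w x y : x \in root_space (wcomb v) -> y \in root_space (wcomb w) ->
  lie x y \in root_space (wcomb (weight_add v w)).
Proof. by move=> xv yw; rewrite -wcombD; apply: lie_root. Qed.

Lemma lie_wcomb_eq (w v z : int * int * int * int) x y : x \in root_space (wcomb v) -> y \in root_space (wcomb z) ->
  weight_add v z == w -> lie x y \in root_space (wcomb w).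
Proof. by move=> xv yz /eqP <-; exact: lie_wcomb. Qed.

Lemma X_root k : (k < 13)%N -> X`_k \in root_space (wcomb (p_weight k)).
Proof.
have [e0 e1 e2 e3] := e_root; have [_ f1 _ _] := f_root.
have rv1 : v1 \in root_space (wcomb (1, 1, 0, 0)) by apply: lie_wcomb_eq e1 e0 _; vm_compute.
have rv2 : v2 \in root_space (wcomb (0, 1, 1, 0)) by apply: lie_wcomb_eq e1 e2 _; vm_compute.
have rv3 : v3 \in root_space (wcomb (0, 1, 0, 1)) by apply: lie_wcomb_eq e1 e3 _; vm_compute.
have rs12 : s12 \in root_space (wcomb (1, 1, 1, 0)) by apply: lie_wcomb_eq e0 rv2 _; vm_compute.
have rs13 : s13 \in root_space (wcomb (1, 1, 0, 1)) by apply: lie_wcomb_eq e0 rv3 _; vm_compute.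
have rs23 : s23 \in root_space (wcomb (0, 1, 1, 1)) by apply: lie_wcomb_eq e2 rv3 _; vm_compute.
have rb : b \in root_space (wcomb (1, 1, 1, 1)) by apply: lie_wcomb_eq e0 rs23 _; vm_compute.
have rtop : t \in root_space (wcomb (1, 2, 1, 1)) by apply: lie_wcomb_eq e1 rb _; vm_compute.
case: k => [_|k]; first exact: f1.
case: k => [_|k]; first exact: e1.
case: k => [_|k]; first exact: e0.
case: k => [_|k]; first exact: e2.
case: k => [_|k]; first exact: e3.
case: k => [_|k]; first exact: rv1.
case: k => [_|k]; first exact: rv2.
case: k => [_|k]; first exact: rv3.
case: k => [_|k]; first exact: rs23.
case: k => [_|k]; first exact: rs13.
case: k => [_|k]; first exact: rs12.
case: k => [_|k]; first exact: rb.
case: k => [_|k]; [exact: rtop | move=> k13; exfalso; clear -k13].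
by [].
Qed.

Lemma X_h k : (13 <= k < 17)%N -> X`_k \in h.
Proof.
do 13! [case: k => [//|k]].
by case: k => [|[|[|[|k]]]] //= _; rewrite /h0 ?hef ?hu.
Qed.

Lemma wt_wcomb_X m w : (13 <= m < 17)%N -> wt (wcomb w) X`_m = (weight_at m w)%:~R.
Proof.
case: w => [[[w0 w1] w2] w3] mP; rewrite /= wt_simple_comb.
have: m \in iota 13 4 by rewrite mem_iota.
rewrite !inE => /or4P[] /eqP-> /=.
- by rewrite !wtef //= /cartan_D4 /=; ring.
- by rewrite !wtu //=; ring.
- by rewrite !wtu //=; ring.
by rewrite !wtu //=; ring.
Qed.

Lemma lie_h_X m k : (13 <= m < 17)%N -> (k < 13)%N -> lie X`_m X`_k = (h_weight m k)%:~R *: X`_k.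
Proof.
move=> mP k13; rewrite (root_lie (X_root k13) (X_h mP)) wt_wcomb_X //.
have /allP/(_ m) := h_weightE; rewrite mem_iota => /(_ mP)/allP/(_ k).
by rewrite mem_iota => /(_ k13)/eqP->.
Qed.

Lemma nonroot_lie i j : (i < 13)%N -> (j < 13)%N -> root_bracket i j = None ->
  root_bracket j i = None -> lie X`_i X`_j = 0.
Proof.
move=> i13 j13 ij ji; have /allP/(_ i) := weight_add_nonroot; rewrite mem_iota => /(_ i13)/allP/(_ j).
rewrite mem_iota => /(_ j13); rewrite ij ji !eqxx /= => /orP[/eqP-> | nr]; first exact: liexx.
by apply: nonroot nr _; apply: lie_wcomb; apply: X_root.
Qed.

Lemma f_lower i w y : (i < 4)%N -> y \in root_space (wcomb w) -> lie (f i) y = 0 ->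
  wt (wcomb w) (lie (e i) (f i)) = -1 -> lie (f i) (lie (e i) y) = y.
Proof.
move=> i4 yw fy wty.
exact: (lie_raise (fa i4) (hef i4) yw fy wty).
Qed.

Lemma wt_wcomb_ef i w0 w1 w2 w3 : (i < 4)%N -> wt (wcomb (w0, w1, w2, w3)) (lie (e i) (f i)) =
  (w0 * cartan_D4 i 0 + w1 * cartan_D4 i 1 + w2 * cartan_D4 i 2 + w3 * cartan_D4 i 3)%:~R.
Proof. by move=> i4; rewrite /= wt_simple_comb !wtef //; ring. Qed.

(** Each new vector is [lie (e i) y] with [y] the bottom of its [i]-string, and [f i] brings it back
    to [y] by [lie_raise]. *)
Lemma X_neq0 k : (k < 13)%N -> X`_k != 0.
Proof.
have [f0r f1r f2r f3r] := f_root.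
have nz0 i w y : (i < 4)%N -> y != 0 -> y \in root_space (wcomb w) -> lie (f i) y = 0 ->
    wt (wcomb w) (lie (e i) (f i)) = -1 -> lie (e i) y != 0.
  move=> i4 nzy yw fy wty; apply: contra nzy => /eqP E.
  by rewrite -(f_lower i4 yw fy wty) E lie0r.
have XR j (j13 : (j < 13)%N) := X_root j13.
have nzv i : (i < 4)%N -> i != 1%N -> lie (e 1%N) (e i) != 0.
  move=> i4 ni1; have eir : e i \in root_space (wcomb ((i == 0)%N%:Z, (i == 1)%N%:Z, (i == 2)%N%:Z, (i == 3)%N%:Z)).
    by rewrite -(Pi_wcomb Pi i4); exact: ea i4.
  apply: (nz0 _ _ _ _ (nze i4) eir) => //.
    apply: nonroot (lie_wcomb f1r eir); move: ni1; clear -i4.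
    by case: i i4 => [|[|[|[|//]]]].
  rewrite wt_wcomb_ef //; move: ni1; clear -i4.
  by case: i i4 => [|[|[|[|//]]]].
have nzv1 : v1 != 0 by apply: nzv.
have nzv2 : v2 != 0 by apply: nzv.
have nzv3 : v3 != 0 by apply: nzv.
have rv2 := XR 6%N isT; have rv3 := XR 7%N isT; have rs23 := XR 8%N isT; have rb := XR 11%N isT.
have nzs12 : s12 != 0.
  by apply: (nz0 _ _ _ _ nzv2 rv2) => //; [apply: nonroot (lie_wcomb f0r rv2) | rewrite wt_wcomb_ef].
have nzs13 : s13 != 0.
  by apply: (nz0 _ _ _ _ nzv3 rv3) => //; [apply: nonroot (lie_wcomb f0r rv3) | rewrite wt_wcomb_ef].
have nzs23 : s23 != 0.
  by apply: (nz0 _ _ _ _ nzv3 rv3) => //; [apply: nonroot (lie_wcomb f2r rv3) | rewrite wt_wcomb_ef].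
have nzb : b != 0.
  by apply: (nz0 _ _ _ _ nzs23 rs23) => //; [apply: nonroot (lie_wcomb f0r rs23) | rewrite wt_wcomb_ef].
have nzt : t != 0.
  by apply: (nz0 _ _ _ _ nzb rb) => //; [apply: nonroot (lie_wcomb f1r rb) | rewrite wt_wcomb_ef].
have nzf1 : f 1%N != 0.
  apply/eqP => E; have := wtef (isT : (1 < 4)%N) (isT : (1 < 4)%N).
  rewrite E lie0r /wt !linear0 /cartan_D4 /= => /esym/eqP.
  by rewrite pchar0_natr_eq0.
case: k => [_|k]; first exact: nzf1.
case: k => [_|k]; first exact: (nze (isT : (1 < 4)%N)).
case: k => [_|k]; first exact: (nze (isT : (0 < 4)%N)).
case: k => [_|k]; first exact: (nze (isT : (2 < 4)%N)).
case: k => [_|k]; first exact: (nze (isT : (3 < 4)%N)).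
case: k => [_|k]; first exact: nzv1.
case: k => [_|k]; first exact: nzv2.
case: k => [_|k]; first exact: nzv3.
case: k => [_|k]; first exact: nzs23.
case: k => [_|k]; first exact: nzs13.
case: k => [_|k]; first exact: nzs12.
case: k => [_|k]; first exact: nzb.
case: k => [_|k]; [exact: nzt | move=> k13; exfalso; clear -k13].
by [].
Qed.

(** The outer simple root vectors commute, so by the Jacobi identity s_i and b do not depend on the
    order in which they are built; brackets with f come from [lie_raise]. *)
Lemma root_brackets i j l : (i, j) \in root_pairs -> root_bracket i j = Some l ->
  lie X`_i X`_j = X`_l.
Proof.
have Z i' j' (i13 : (i' < 13)%N) (j13 : (j' < 13)%N) ij ji := nonroot_lie i13 j13 ij ji.
have e02 : lie (e 0%N) (e 2%N) = 0 by apply: (Z 2%N 3%N).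
have e03 : lie (e 0%N) (e 3%N) = 0 by apply: (Z 2%N 4%N).
have e23 : lie (e 2%N) (e 3%N) = 0 by apply: (Z 3%N 4%N).
have XR k (k13 : (k < 13)%N) := X_root k13.
have low w y : y \in root_space (wcomb w) -> lie (f 1%N) y = 0 ->
    wt (wcomb w) (lie (e 1%N) (f 1%N)) = -1 -> lie (f 1%N) (lie (e 1%N) y) = y.
  exact: f_lower.
have sym i' j' : lie (e i') (e j') = 0 ->
    lie (e j') (lie (e 1%N) (e i')) = lie (e i') (lie (e 1%N) (e j')).
  move=> eij; rewrite [LHS]lie_lier [lie (e j') (e i')]lie_anti eij oppr0 lie0r addr0.
  by rewrite [lie (e j') (e 1%N)]lie_anti lieNl -lie_anti.
have s21 : lie (e 2%N) v1 = s12 by apply: sym.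
have s31 : lie (e 3%N) v1 = s13 by apply: sym.
have s32 : lie (e 3%N) v2 = s23 by apply: sym.
have b2 : lie (e 2%N) s13 = b.
  by rewrite /s13 lie_lier [lie (e 2%N) _]lie_anti e02 oppr0 lie0l add0r.
have b3 : lie (e 3%N) s12 = b.
  by rewrite /s12 lie_lier [lie (e 3%N) (e 0%N)]lie_anti e03 oppr0 lie0l add0r s32.
have vs i' s : lie (e i') s = b -> lie (e 1%N) s = 0 -> lie (lie (e 1%N) (e i')) s = t.
  by move=> es s0; rewrite lie_liel es s0 lie0r subr0.
rewrite !inE => /orP[/eqP[-> ->] [<-] // |].
do 4! [case/orP => [/eqP[-> ->] [<-]|]; first by
  apply: low; [apply: (XR 2%N isT) || apply: (XR 3%N isT) || apply: (XR 4%N isT) || apply: (XR 11%N isT)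
   | apply: (Z 0%N 2%N) || apply: (Z 0%N 3%N) || apply: (Z 0%N 4%N) || apply: (Z 0%N 11%N) | rewrite wt_wcomb_ef]].
do 4! [case/orP => [/eqP[-> ->] [<-]|]; first by []].
do 9! [case/orP => [/eqP[-> ->] [<-]|]; first by rewrite /= ?s21 ?s31 ?s32 ?b2 ?b3].
case/orP => [/eqP[-> ->] [<-]|]; first by apply: vs => //; apply: (Z 1%N 8%N).
case/orP => [/eqP[-> ->] [<-]|]; first by apply: vs => //; apply: (Z 1%N 9%N).
by move=> /eqP[-> ->] [<-]; apply: vs => //; apply: (Z 1%N 10%N).
Qed.

Lemma chev_table i j : (i < 17)%N -> (j < 17)%N -> lie X`_i X`_j = (br i j).1%:~R *: X`_(br i j).2.
Proof.
move=> i17 j17; rewrite /br.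
case: (leqP 13 i) => [i13 | i13]; case: (leqP 13 j) => [j13 | j13].
- rewrite scale0r; apply: (h_abelian charK simple_L cartan_h root_R base_Pi typeD4); apply: X_h.
    by rewrite i13.
  by rewrite j13.
- by rewrite lie_h_X ?i13.
- by rewrite lie_anti lie_h_X ?j13 // rmorphN scaleNr.
case E: (root_bracket i j) => [l|] /=.
  rewrite scale1r; apply: root_brackets (E).
  have /allP/(_ i) := root_pairsP; rewrite mem_iota => /(_ i13)/allP/(_ j).
  by rewrite mem_iota E => /(_ j13).
case E': (root_bracket j i) => [l|] /=; last by rewrite scale0r nonroot_lie.
rewrite lie_anti scaleN1r; congr (- _); apply: root_brackets (E').
have /allP/(_ j) := root_pairsP; rewrite mem_iota => /(_ j13)/allP/(_ i).
by rewrite mem_iota E' => /(_ i13).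
Qed.

End ChevalleyBasis.

(* The values of the weights on the element of [h] where the simple roots take the values
   1, 10, 2 and 4: these separate the weights of p. *)
Definition weight_height (w : int * int * int * int) : int := let: (w0, w1, w2, w3) := w in
  w0 + w1 * 10 + w2 * 2 + w3 * 4.

Definition p_height (k : nat) : int := if (k < 13)%N then weight_height (p_weight k) else 0.

(** Index 13 stands for all of [h], with weight 0. *)
Lemma p_height_uniq : uniq [seq p_height k | k <- iota 0 14].
Proof. by vm_compute. Qed.

Lemma D4_positive_p_weight w0 w1 w2 w3 : D4_positive w0 w1 w2 w3 ->
  exists2 k, (0 < k < 13)%N & p_weight k = (w0, w1, w2, w3).
Proof.
move=> pos; have : ((w0, w1, w2, w3) \in [seq p_weight k | k <- iota 1 12]).
  have [E0 | E0] : w0 = 0 \/ w0 = 1 by move: pos; rewrite /D4_positive; lia.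
    have [E2 | E2] : w2 = 0 \/ w2 = 1 by move: pos; rewrite /D4_positive; lia.
      have [E3 | E3] : w3 = 0 \/ w3 = 1 by move: pos; rewrite /D4_positive; lia.
        have -> : w1 = 1 by move: pos; rewrite /D4_positive; lia.
        by rewrite E0 E2 E3.
      have [-> | ->] : w1 = 0 \/ w1 = 1 by move: pos; rewrite /D4_positive; lia.
        by rewrite E0 E2 E3.
      by rewrite E0 E2 E3.
    have [E3 | E3] : w3 = 0 \/ w3 = 1 by move: pos; rewrite /D4_positive; lia.
      have [-> | ->] : w1 = 0 \/ w1 = 1 by move: pos; rewrite /D4_positive; lia.
        by rewrite E0 E2 E3.
      by rewrite E0 E2 E3.
    have -> : w1 = 1 by move: pos; rewrite /D4_positive; lia.
    by rewrite E0 E2 E3.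
  have [E2 | E2] : w2 = 0 \/ w2 = 1 by move: pos; rewrite /D4_positive; lia.
    have [E3 | E3] : w3 = 0 \/ w3 = 1 by move: pos; rewrite /D4_positive; lia.
      have [-> | ->] : w1 = 0 \/ w1 = 1 by move: pos; rewrite /D4_positive; lia.
        by rewrite E0 E2 E3.
      by rewrite E0 E2 E3.
    have -> : w1 = 1 by move: pos; rewrite /D4_positive; lia.
    by rewrite E0 E2 E3.
  have [E3 | E3] : w3 = 0 \/ w3 = 1 by move: pos; rewrite /D4_positive; lia.
    have -> : w1 = 1 by move: pos; rewrite /D4_positive; lia.
    by rewrite E0 E2 E3.
  have [-> | ->] : w1 = 1 \/ w1 = 2 by move: pos; rewrite /D4_positive; lia.
    by rewrite E0 E2 E3.
  by rewrite E0 E2 E3.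
by case/mapP => k; rewrite mem_iota => kP ->; exists k.
Qed.

(** * A basis of the parabolic subalgebra *)

Section Parabolic.

Variables (K : closedFieldType) (L : lieAlgType K) (h : {vspace L}).
Hypothesis charK : [pchar K] =i pred0.
Variables (R Rp : seq 'Dual(subvs_of h)) (Pi : 4.-tuple 'Dual(subvs_of h)).
Hypothesis simple_L : simple_lie L.
Hypothesis cartan_h : cartan_subalgebra h.
Hypothesis root_R : root_system R.
Hypothesis base_Pi : root_base R Pi.
Hypothesis typeD4 : has_cartan_matrix R Pi cartan_D4.
Hypothesis pos_Rp : positive_roots R Pi Rp.
Implicit Types (x y z s : L) (a : 'Dual(subvs_of h)).

Local Notation wcomb := (wcomb Pi).
Local Notation root_line := (root_line charK simple_L cartan_h root_R base_Pi typeD4).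

Definition parabolic : {vspace L} :=
  (root_space (- Pi`_1)%R + (h + \sum_(a <- Rp) root_space a))%VS.

Lemma parabolic_basis : exists X : 17.-tuple L, basis_of parabolic X /\
  forall i j, (i < 17)%N -> (j < 17)%N -> lie X`_i X`_j = (br i j).1%:~R *: X`_(br i j).2.
Proof.
have triple i : exists ef : L * L, (i < 4)%N -> [/\ ef.1 != 0, ef.1 \in root_space Pi`_i,
  ef.2 \in root_space (- Pi`_i), lie ef.1 ef.2 \in h &
  forall j, (j < 4)%N -> wt Pi`_j (lie ef.1 ef.2) = (cartan_D4 i j)%:~R].
  case: (ltnP i 4) => [i4 | ]; last by exists (0, 0).
  have [e [f E]] := chevalley_triple charK simple_L cartan_h root_R base_Pi typeD4 i4.
  by exists (e, f).
have [[[e0 f0] t0] [[e1 f1] t1]] := (triple 0%N, triple 1%N).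
have [[[e2 f2] t2] [[e3 f3] t3]] := (triple 2%N, triple 3%N).
pose e := nth 0 [:: e0; e1; e2; e3]; pose f := nth 0 [:: f0; f1; f2; f3].
have T i : (i < 4)%N -> [/\ e i != 0, e i \in root_space Pi`_i,
  f i \in root_space (- Pi`_i), lie (e i) (f i) \in h &
  forall j, (j < 4)%N -> wt Pi`_j (lie (e i) (f i)) = (cartan_D4 i j)%:~R].
  by case: i => [|[|[|[|//]]]] _; [apply: t0 | apply: t1 | apply: t2 | apply: t3].
have [u uP] := coweights charK typeD4.
have nze i : (i < 4)%N -> e i != 0 by move=> /T[].
have ea i : (i < 4)%N -> e i \in root_space Pi`_i by move=> /T[].
have fa i : (i < 4)%N -> f i \in root_space (- Pi`_i) by move=> /T[].
have hef i : (i < 4)%N -> lie (e i) (f i) \in h by move=> /T[].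
have wtef i j : (i < 4)%N -> (j < 4)%N -> wt Pi`_j (lie (e i) (f i)) = (cartan_D4 i j)%:~R.
  by case/T => _ _ _ _; apply.
have hu i : (i < 4)%N -> u i \in h by case/uP.
have wtu i j : (i < 4)%N -> (j < 4)%N -> wt Pi`_j (u i) = (j == i)%:R by case/uP => _; apply.
pose X := [tuple of chev_seq e f u]; exists X; split; last first.
  exact: (chev_table charK simple_L cartan_h root_R base_Pi typeD4 ea fa hef wtef hu wtu).
have Xr k (k13 : (k < 13)%N) : X`_k \in root_space (wcomb (p_weight k)) by exact: (X_root ea fa u k13).
have Xh k (kP : (13 <= k < 17)%N) : X`_k \in h by exact: (X_h hef hu kP).
have Xn k (k13 : (k < 13)%N) : X`_k != 0.
  exact: (X_neq0 charK simple_L cartan_h root_R base_Pi typeD4 nze ea fa hef wtef).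
have wtX m w : (13 <= m < 17)%N -> wt (wcomb w) X`_m = (weight_at m w)%:~R.
  by move=> mP; apply: (wt_wcomb_X wtef wtu).
have XE k : (k < 17)%N -> X`_k \in (X : seq L) by move=> k17; apply: mem_nth.
have freeX : free X.
  apply/freeP => c cX0; pose w j := c (inord j).
  pose t := u 0%N + 10%:R *: u 1%N + 2%:R *: u 2%N + 4%:R *: u 3%N.
  have ht : t \in h by rewrite !memvD ?memvZ ?hu.
  have wtt v : wt (wcomb v) t = (weight_height v)%:~R.
    case: v => [[[v0 v1] v2] v3]; rewrite /= wt_simple_comb /t !wtD !wtZ !wtu //=; ring.
  (* The four vectors of [h] are gathered into one term of eigenvalue 0, so that the eigenvalues of
     [ad t] are distinct. *)
  pose y k := if (k < 13)%N then w k *: X`_k else \sum_(j <- iota 13 4) w j *: X`_j.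
  have y0 : {in iota 0 14, forall k, y k = 0}.
    apply: (@eigen_sum_eq0 _ _ _ (ad t) (fun k => (p_height k)%:~R) y).
    - have := p_height_uniq; rewrite -(map_inj_uniq (pchar0_intr_inj charK)) -map_comp.
      by [].
    - move=> k; rewrite adE /y /p_height; case: ifP => [k13|_].
        by rewrite lieZr (root_lie (Xr k k13) ht) wtt !scalerA mulrC.
      rewrite scale0r linear_sum big_seq big1 // => j; rewrite mem_iota => jP; rewrite /= lieZr.
      rewrite (h_abelian charK simple_L cartan_h root_R base_Pi typeD4 ht) ?scaler0 //.
      exact: Xh.
    rewrite -[RHS]cX0 -[iota 0 14]/(iota 0 13 ++ [:: 13%N]) big_cat big_seq1.
    transitivity (\sum_(k <- iota 0 17) w k *: X`_k).
      rewrite -[iota 0 17]/(iota 0 13 ++ iota 13 4) big_cat; congr (_ + _).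
      rewrite big_seq [RHS]big_seq; apply: eq_bigr => k; rewrite mem_iota /y => /andP[_ k13].
      by rewrite k13.
    rewrite -[iota 0 17]/(index_iota 0 17) big_mkord; apply: eq_bigr => i _.
    by rewrite /w inord_val.
  have w13 k : (k < 13)%N -> w k = 0.
    move=> k13; have k14 : k \in iota 0 14 by rewrite mem_iota (leq_trans k13).
    have /eqP := y0 k k14; rewrite /y k13.
    by rewrite scaler_eq0 (negPf (Xn k k13)) orbF => /eqP.
  (* Within [h], independence is tested by the values of the simple roots. *)
  have E v : \sum_(j <- iota 13 4) w j * (weight_at j v)%:~R = 0.
    have wt_sum a (F : nat -> L) r : wt a (\sum_(j <- r) F j) = \sum_(j <- r) wt a (F j).
      by elim: r => [|j r IHr]; rewrite ?big_nil ?big_cons ?wtD ?IHr // /wt !linear0.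
    have W0 : wt (wcomb v) (\sum_(j <- iota 13 4) w j *: X`_j) = 0.
      by rewrite [X in wt _ X](y0 13%N isT) /wt !linear0.
    rewrite -[RHS]W0 wt_sum big_seq [RHS]big_seq; apply: eq_bigr => j; rewrite mem_iota => jP.
    by rewrite wtZ wtX.
  have := (E (0, 1, 0, 0), E (1, 0, 0, 0), E (0, 0, 1, 0), E (0, 0, 0, 1)).
  rewrite !big_cons !big_nil /weight_at /= => -[[[E1 E0] E2] E3].
  have n2 : (2%:R : K) != 0 by rewrite pchar0_natr_eq0.
  have w_13 : w 13%N = 0 by apply: (mulfI n2); rewrite mulr0 -[RHS]E1; ring.
  have w_14 : w 14%N = 0 by rewrite -[RHS]E0 w_13; ring.
  have w_15 : w 15%N = 0 by rewrite -[RHS]E2 w_13; ring.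
  have w_16 : w 16%N = 0 by rewrite -[RHS]E3 w_13; ring.
  move=> i; rewrite -[i]inord_val -/(w i); case: (ltnP i 13) => [|i13]; first exact: w13.
  have: (i : nat) \in iota 13 4 by rewrite mem_iota i13 ltn_ord.
  by rewrite !inE => /or4P[] /eqP->.
have simpleE := Pi_wcombE Pi.
have spanX : <<X>>%VS = parabolic.
  apply/eqP; rewrite eqEsubv; apply/andP; split.
    apply/span_subvP => x /(nthP 0)[k]; rewrite size_tuple => k17 <-.
    have [k13 | k13] := ltnP k 13; last first.
      apply: (subvP (addvSr _ _)); apply: (subvP (addvSl _ _)).
      by apply: Xh; rewrite k13.
    have [k0 | kp] := posnP k.
      apply: (subvP (addvSl _ _)); rewrite k0; exact: (fa 1%N).
    apply: (subvP (addvSr _ _)); apply: (subvP (addvSr _ _)).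
    apply: (subvP (subv_bigsum (fun a => root_space a) _)) (Xr k k13).
    apply/(pos_Rp.2 _); split.
      apply: (root_spaceN0 root_R (Xr k k13) (Xn k k13)).
      have: all (fun k => let: (w0, w1, w2, w3) := p_weight k in
        (w0 != 0) || (w1 != 0) || (w2 != 0) || (w3 != 0)) (iota 0 13) by vm_compute.
      move/allP/(_ k); rewrite mem_iota => /(_ k13); case: (p_weight k) => [[[w0 w1] w2] w3].
      exact: (simple_comb_neq0 charK typeD4).
    apply/nat_combE.
    have: all (fun k => let: (w0, w1, w2, w3) := p_weight k in
      [&& w0 == `|w0|%N, w1 == `|w1|%N, w2 == `|w2|%N & w3 == `|w3|%N]) (iota 1 12) by vm_compute.
    move/allP/(_ k); rewrite mem_iota kp => /(_ k13); case: (p_weight k) => [[[w0 w1] w2] w3].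
    case/and4P => /eqP E0 /eqP E1 /eqP E2 /eqP E3.
    by exists `|w0|%N, `|w1|%N, `|w2|%N, `|w3|%N; rewrite -E0 -E1 -E2 -E3.
  have inX k : (k < 17)%N -> X`_k \in <<X>>%VS by move=> k17; apply/memv_span/XE.
  rewrite !subv_add; apply/and3P; split.
  - apply/subvP => x xf; have fR := opp_root charK simple_L cartan_h root_R base_Pi typeD4
      (simple_root base_Pi (isT : (1 < 4)%N)).
    have [c ->] := root_line fR (fa 1%N isT) (Xn 0%N isT) xf.
    by rewrite memvZ // (inX 0%N).
  - apply/subvP => z hz.
    (* Of the four basis vectors of [h] only h0 has a nonzero value of alpha2, namely 2; the outer
       simple roots take the value -1 at h0, which the added [c13] compensates. *)
    pose c13 := wt Pi`_1 z / 2%:R.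
    pose z' := c13 *: X`_13 + (wt Pi`_0 z + c13) *: X`_14 + (wt Pi`_2 z + c13) *: X`_15
      + (wt Pi`_3 z + c13) *: X`_16.
    have n2 : (2%:R : K) != 0 by rewrite pchar0_natr_eq0.
    have hz' : z' \in h by rewrite !memvD // memvZ // Xh.
    suff -> : z = z' by rewrite /z' !memvD // memvZ // inX.
    apply/eqP; rewrite -subr_eq0; apply/eqP.
    apply: (h_simple_weights0 charK simple_L cartan_h root_R base_Pi typeD4); first by rewrite memvB.
    have [P0 P1 P2 P3] := simpleE.
    have wtB a : wt a (z - z') = wt a z - wt a z' by rewrite /wt !linearB.
    move=> j j4; rewrite wtB /z' !wtD !wtZ.
    case: j j4 => [|[|[|[|//]]]] _.
    - by rewrite [in wt _ X`_13]P0 [in wt _ X`_14]P0 [in wt _ X`_15]P0 [in wt _ X`_16]P0 !wtX //= /c13; field.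
    - by rewrite [in wt _ X`_13]P1 [in wt _ X`_14]P1 [in wt _ X`_15]P1 [in wt _ X`_16]P1 !wtX //= /c13; field.
    - by rewrite [in wt _ X`_13]P2 [in wt _ X`_14]P2 [in wt _ X`_15]P2 [in wt _ X`_16]P2 !wtX //= /c13; field.
    by rewrite [in wt _ X`_13]P3 [in wt _ X`_14]P3 [in wt _ X`_15]P3 [in wt _ X`_16]P3 !wtX //= /c13; field.
  apply: bigsum_subv => a /(pos_Rp.2 _)[Ra /nat_combE[n0 [n1 [n2 [n3 Ea]]]]].
  have pos : D4_positive n0 n1 n2 n3.
    apply: (root_coefs_positive charK simple_L cartan_h root_R base_Pi typeD4); first by rewrite -Ea.
    by split.
  have [k /andP[_ k13] Ek] := D4_positive_p_weight pos.
  apply/subvP => x xa; have Xa : X`_k \in root_space a by have := Xr k k13; rewrite Ek Ea.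
  have [c ->] := root_line Ra Xa (Xn k k13) xa.
  by rewrite memvZ // inX // (leq_trans k13).
by rewrite /basis_of spanX eqxx.
Qed.

End Parabolic.

(** * Transfer of the table to the subalgebra as a Lie algebra *)

Section SubTable.

Variables (K : closedFieldType) (L : lieAlgType K) (P : {vspace L}) (X : 17.-tuple L).
Hypothesis basisX : basis_of P X.
Hypothesis brX : forall i j, (i < 17)%N -> (j < 17)%N ->
  lie X`_i X`_j = (br i j).1%:~R *: X`_(br i j).2.

Lemma table_mem i : (i < 17)%N -> X`_i \in P.
Proof. by move=> i17; apply: (basis_mem basisX); rewrite mem_nth ?size_tuple. Qed.

Lemma table_closed : lie_closed P.
Proof.
have E x : x \in P -> exists c : 'I_17 -> K, x = \sum_i c i *: X`_i.
  by move=> Px; exists (fun i => coord X i x); exact: (coord_basis basisX).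
apply/lie_spaceP => x y /E[c ->] /E[d ->].
rewrite linear_sum; apply: memv_suml => i _ /=; rewrite lie_anti memvN linear_sum.
apply: memv_suml => j _; rewrite /= lieZr lie_anti lieZr scalerN memvN memvZ // memvZ // brX //.
by rewrite memvZ // table_mem // br_lt.
Qed.

Variable clP : lie_closed P.

Let Y : 17.-tuple (sub_lie clP) := [tuple of [seq vsproj P x | x <- X]].

Let YE i : (i < 17)%N -> vsval Y`_i = X`_i.
Proof. by move=> i17; rewrite (nth_map 0) ?size_tuple // vsprojK // table_mem. Qed.

Lemma sub_table_basis : basis_of fullv Y.
Proof.
have dP : \dim P = 17%N by apply: vector.size_basis basisX.
rewrite basisEfree subvf size_tuple dimvf dim_subvs dP leqnn !andbT.
apply/freeP => c cY0; apply: (freeP (basis_free basisX)).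
have := congr1 vsval cY0; rewrite linear_sum => E; apply: etrans E.
by apply: eq_bigr => i _; rewrite -[RHS]/(c i *: vsval Y`_i) YE.
Qed.

Lemma sub_table_br i j : (i < 17)%N -> (j < 17)%N ->
  lie Y`_i Y`_j = (br i j).1%:~R *: Y`_(br i j).2.
Proof.
move=> i17 j17; apply: subvs_inj.
rewrite -[RHS]/((br i j).1%:~R *: vsval Y`_(br i j).2) sub_bracketE !YE ?brX //.
exact: br_lt.
Qed.

Lemma sub_table_no_stable : [pchar K] =i pred0 -> ~ exists f : 'Dual(sub_lie clP), stable f.
Proof. by move=> charK; apply: (table_no_stable charK sub_table_basis sub_table_br). Qed.

End SubTable.

Theorem mainTheorem7 (K : closedFieldType) (charK : [pchar K] =i pred0)
    (g : lieAlgType K) (h : {vspace g}) (R Rp : seq 'Dual(subvs_of h))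
    (Pi : 4.-tuple 'Dual(subvs_of h))
    (simple_g : simple_lie g) (cartan_h : cartan_subalgebra h)
    (root_R : root_system R) (base_Pi : root_base R Pi)
    (typeD4 : has_cartan_matrix R Pi cartan_D4)
    (pos_Rp : positive_roots R Pi Rp) :
  let b : {vspace g} := (h + \sum_(a <- Rp) root_space a)%VS in
  let p : {vspace g} := (root_space (- Pi`_1)%R + b)%VS in
  exists p_sub : lie_closed p,
    ~ exists f : 'Dual(sub_lie p_sub), stable f.
Proof.
have [X [basisX brX]] :=
  parabolic_basis charK simple_g cartan_h root_R base_Pi typeD4 pos_Rp.
exists (table_closed basisX brX).
exact: (sub_table_no_stable basisX brX).
Qed.
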